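(* Let $s\in\{+1,-1\}$, $d\ge2$, and fix any signed orthonormal basis of $L^2(\mathbb S^{d-1})$. Then $$\mathbb B_s(\mathbb S^{d-1})\ \ge\ \frac{2\,\Gamma(\frac{d+1}{2})^{\frac{2}{d-1}}}{(4e^{1/12})^{\frac{2}{d-1}}(d^2-1)^{1/2}},$$ and moreover $\mathbb B_+(\mathbb S^{d-1})\le\sqrt2$ and $\mathbb B_-(\mathbb S^{d-1})\le 2\sqrt2$.
   Context: $\mathbb S^{d-1}\subseteq\mathbb R^d$ is the unit sphere with geodesic distance $d_g(\omega,\nu)=\arccos\langle\omega,\nu\rangle$ and normalized surface measure $\bar\sigma$ ($\bar\sigma(\mathbb S^{d-1})=1$); $L^2(\mathbb S^{d-1})$ consists of real-valued square-integrable functions. $\mathcal H^d_n$ is the space of (real) spherical harmonics of degree $n$, $h_n=\dim\mathcal H^d_n$, and $\eta=(0,\dots,0,1)$ is the north pole. An orthonormal basis $\{Y_{n,j}\in\mathcal H^d_n: n\in\mathbb N, 1\le j\le h_n\}$ of $L^2(\mathbb S^{d-1})$ is signed if $Y_{n,j}(\eta)\ge0$ for all $n,j$, and $Y_{n,j}(\eta)>0$ for all $j$ whenever $n$ is sufficiently large. Write $\widehat f(n,j)=\int f Y_{n,j}\,d\bar\sigma$. For $s\in\{+1,-1\}$, $\mathcal B_s(\mathbb S^{d-1})$ is the set of continuous $f:\mathbb S^{d-1}\to\mathbb R$ with $\widehat f(0,1)\le0$, such that there is $N$ with $s\widehat f(n,j)\ge0$ for all $n\ge N$ and all $j$, and $sf(\eta)\le0$.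 For such $f$ let $\theta(f)=\inf\{\theta\in(0,\pi]: f(\omega)\ge0\text{ whenever }d_g(\omega,\eta)\ge\theta\}$ and $k(s\widehat f)=\min\{k\ge1: s\widehat f(n,j)\ge0\text{ for all }n\ge k\text{ and all }j\}$. Define $\mathbb B_s(\mathbb S^{d-1})=\inf_{f\in\mathcal B_s(\mathbb S^{d-1})\setminus\{0\}}(1-\cos\theta(f))^{1/2}k(s\widehat f)$. *)

(* Defs.v *)
From HB Require Import structures.
From mathcomp Require Import all_boot all_order all_algebra.
From mathcomp Require Import all_classical all_reals all_analysis.
From mathcomp Require mpoly.
Import (canonicals, coercions) mpoly.

Unset Strict Implicit.
Unset Printing Implicit Defensive.

Import Order.TTheory GRing.Theory Num.Theory.
Import numFieldNormedType.Exports.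

Local Open Scope classical_set_scope.
Local Open Scope ring_scope.

Section SphereDefs.
Context {R : realType}.

Definition sqnorm {d : nat} (v : 'rV[R]_d) : R := \sum_(i < d) v ord0 i ^+ 2.

Definition sphere (d : nat) : set 'rV[R]_d := [set v | sqnorm v = 1].

Definition north (d : nat) : 'rV[R]_d :=
  \row_(i < d) (if (i : nat) == d.-1 then 1 else 0).

Definition geodist {d : nat} (w v : 'rV[R]_d) : R :=
  acos (\sum_(i < d) w ord0 i * v ord0 i).

(** Iterated Lebesgue integral over R^n (coordinates 0..n-1 of a nat-indexed
    point); for the continuous/bounded compactly supported integrands used
    below this is the n-dimensional Lebesgue integral (Fubini). *)
Fixpoint iint (n : nat) (F : (nat -> R) -> R) : R :=
  match n with
  | 0 => F (fun _ => 0)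
  | m.+1 => \int[@lebesgue_measure R]_(t in setT)
              iint m (fun x => F (fun i => if i == m then t else x i))
  end.

Definition vint {d : nat} (G : 'rV[R]_d -> R) : R :=
  iint d (fun x => G (\row_(i < d) x i)).

Definition ballind {d : nat} (v : 'rV[R]_d) : R :=
  if sqnorm v <= 1 then 1 else 0.

(** Integral against the normalized surface measure sigma-bar on S^{d-1},
    defined by the cone construction:
    int g d(sigma-bar) = (int_{B} g(x/|x|) dx) / |B|. *)
Definition sint {d : nat} (g : 'rV[R]_d -> R) : R :=
  vint (fun v => ballind v * g ((Num.sqrt (sqnorm v))^-1 *: v))
  / vint (@ballind d).

Definition laplacian {d : nat} (p : mpoly.mpoly d R) : mpoly.mpoly d R :=
  \sum_(i < d) mpoly.mderiv i (mpoly.mderiv i p).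

Definition sph_harm (d n : nat) (Z : 'rV[R]_d -> R) : Prop :=
  exists p : mpoly.mpoly d R,
    [/\ all (fun m => mpoly.mdeg m == n) (mpoly.msupp p),
        laplacian p = 0 &
        forall v, sphere d v -> Z v = mpoly.meval (fun i => v ord0 i) p].

Definition Yf {d : nat} (Y : nat -> seq ('rV[R]_d -> R)) (n j : nat) :
  'rV[R]_d -> R := nth (fun _ => 0) (Y n) j.

(** Orthonormal basis {Y_{n,j} in H^d_n : n, 1 <= j <= h_n} of L^2(S^{d-1}):
    each Y_{n,j} lies in H^d_n, the Y_{n,j} (j < size (Y n)) span H^d_n
    (so size (Y n) = h_n), and the whole family is orthonormal in L^2(sigma-bar). *)
Definition sph_onb {d : nat} (Y : nat -> seq ('rV[R]_d -> R)) : Prop :=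
  [/\ (forall n j, (j < size (Y n))%N -> sph_harm d n (Yf Y n j)),
      (forall n Z, sph_harm d n Z ->
         exists c : nat -> R, forall v, sphere d v ->
           Z v = \sum_(j < size (Y n)) c j * Yf Y n j v) &
      (forall n j n' j', (j < size (Y n))%N -> (j' < size (Y n'))%N ->
         sint (fun v => Yf Y n j v * Yf Y n' j' v)
         = if (n == n') && (j == j') then 1 else 0)].

Definition signed_onb {d : nat} (Y : nat -> seq ('rV[R]_d -> R)) : Prop :=
  [/\ sph_onb Y,
      (forall n j, (j < size (Y n))%N -> 0 <= Yf Y n j (north d)) &
      exists N, forall n j, (N <= n)%N -> (j < size (Y n))%N ->
         0 < Yf Y n j (north d)].

(** Fourier coefficient f^(n,j) (j 0-indexed, so f^(0,1) is coef f 0 0). *)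
Definition coef {d : nat} (Y : nat -> seq ('rV[R]_d -> R))
  (f : 'rV[R]_d -> R) (n j : nat) : R :=
  sint (fun v => f v * Yf Y n j v).

Definition tailpos {d : nat} (Y : nat -> seq ('rV[R]_d -> R)) (s : R)
  (f : 'rV[R]_d -> R) (k : nat) : Prop :=
  forall n j, (k <= n)%N -> (j < size (Y n))%N -> 0 <= s * coef Y f n j.

Definition classB {d : nat} (Y : nat -> seq ('rV[R]_d -> R)) (s : R)
  (f : 'rV[R]_d -> R) : Prop :=
  [/\ {within sphere d, continuous f},
      coef Y f 0 0 <= 0,
      (exists N, tailpos Y s f N) &
      s * f (north d) <= 0].

(** theta(f) = inf {theta in (0,pi] : f(w) >= 0 whenever d_g(w,eta) >= theta},
    as an extended real (+oo if the set is empty). *)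
Definition theta_set {d : nat} (f : 'rV[R]_d -> R) : set R :=
  [set t | 0 < t <= pi /\
           forall w, sphere d w -> t <= geodist w (north d) -> 0 <= f w].

Definition thetaE {d : nat} (f : 'rV[R]_d -> R) : \bar R :=
  ereal_inf ((fun t => t%:E) @` theta_set f).

Definition kmin {d : nat} (Y : nat -> seq ('rV[R]_d -> R)) (s : R)
  (f : 'rV[R]_d -> R) : nat :=
  xget 0%N [set k | [/\ (1 <= k)%N, tailpos Y s f k &
                        forall m, (1 <= m)%N -> tailpos Y s f m -> (k <= m)%N]].

Definition Bquot {d : nat} (Y : nat -> seq ('rV[R]_d -> R)) (s : R)
  (f : 'rV[R]_d -> R) : \bar R :=
  match thetaE f with
  | EFin th => (Num.sqrt (1 - cos th) * (kmin Y s f)%:R)%:E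
  | _ => +oo%E
  end.

Definition Bconst {d : nat} (Y : nat -> seq ('rV[R]_d -> R)) (s : R) : \bar R :=
  ereal_inf [set Bquot Y s f | f in
     [set f | classB Y s f /\ exists w, sphere d w /\ f w != 0]].

Definition Gamma (x : R) : R :=
  \int[@lebesgue_measure R]_(t in `]0, +oo[) (t `^ (x - 1) * expR (- t)).

Definition lower_const (d : nat) : R :=
  2 * Gamma ((d%:R + 1) / 2) `^ (2 / (d%:R - 1))
  / ((4 * expR (1 / 12)) `^ (2 / (d%:R - 1)) * Num.sqrt (d%:R ^+ 2 - 1)).

End SphereDefs.

(* Submission.v *)
Require Import Defs.
From HB Require Import structures.
From mathcomp Require Import all_boot all_order all_algebra.
From mathcomp Require Import all_classical all_reals all_analysis.
From mathcomp Require Import measurable_realfun.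
From mathcomp Require Import ring lra.
From mathcomp Require mpoly.
Import -(notations) mpoly.
Set Implicit Arguments.
Unset Strict Implicit.
Unset Printing Implicit Defensive.

Import Order.TTheory GRing.Theory Num.Theory.
Import numFieldNormedType.Exports.
Local Open Scope classical_set_scope.
Local Open Scope ring_scope.

(** Lower bound.  Pairing [f] with zonal polynomials [p(<w, eta>)] gives a
    functional [Phi] determined by the values [a_n] at the pole of the degree [n]
    parts of [f].  Since [s a_n >= 0] for [n >= k] and [s f(eta) <= 0], testing
    against the positive kernels [(1 + t)^m], whose normalized Gegenbauer
    coefficients lie in [0, 1] and tend to 1, yields [sum |a_n| <= 2 S] with
    [S = sum_(n < k) |a_n|], hence [|Phi(p)| <= 2 S * (mean of u)] whenever
    [|p| <= u].  As [f >= 0] off the cap of radius [theta] and [f] has nonpositive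
    mean, a polynomial close to the indicator of the cap gives
    [|Phi(P_n)| <= 4 S * (measure of the cap)] for every Gegenbauer polynomial [P_n],
    and summing [|a_n| = h_n |Phi(P_n)|] over [n < k] gives
    [1 <= 4 (measure of the cap) (sum_(n < k) h_n)] unless [S = 0].  In the latter
    case [Phi = 0]; signedness of the basis makes [f] a finite sum of harmonics
    vanishing on an open hemisphere, and it then vanishes on every great circle
    through the pole.

    Upper bounds.  [t^2 - 1] (k = 1, s = 1) and [t - t^3] (k <= 2, s = -1), where
    [t = <w, eta>]. *)

(** * Iterated Lebesgue integrals of bounded, compactly supported integrands *)

Section IteratedIntegral.
Context {R : realType}.
Notation mu := (@lebesgue_measure R).

(** The surface integral is given in coordinates, as an iterated Lebesgue integral over cones, a
    form that hides rotation invariance. Little more than linearity, strict positivity and total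
    mass 1 is drawn from it; the rest comes from orthonormality of the basis. Zonal harmonics of
    positive degree are orthogonal to constants, so a linear functional on polynomials is pinned
    down by killing [P_n] for [n > 0] and by its value at 1. This yields both independence of the
    pole and the one-dimensional formula that measures caps. The harmonic series of [f] need not
    converge pointwise: polynomial kernels turn each pairing into a finite sum, and their degree
    tends to infinity while the number of terms kept stays fixed. Constants: a cap of angle
    [theta <= pi / 2] has measure at most [sqrt 2 / 2 * (2 sin (theta / 2))^(d - 1)], and
    [sum_(n < k) h_n <= 2 k^(d - 1)]. As [sqrt (1 - cos theta) = sqrt 2 * sin (theta / 2)], the
    final inequality reads [1 <= 4 sqrt 2 * (sqrt 2 * Q)^(d - 1)] with [Q] the quotient, while the
    stated constant [r] satisfies [4 sqrt 2 * (sqrt 2 * r)^(d - 1) <= 1]. *)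

(** Tonelli applies to the positive and the negative part separately, and [fine] of their difference
    is measurable even where that difference is infinite. *)
Lemma measurable_param_Rintegral {dT} {T : measurableType dT} (f : T * R -> R) :
  measurable_fun setT f ->
  measurable_fun setT (fun x => \int[mu]_(t in setT) f (x, t)).
Proof.
move=> mf.
have mf' : measurable_fun setT (fun p => (f p)%:E).
  exact/measurable_EFinP.
apply: measurableT_comp => //=.
under eq_fun do rewrite integralE.
apply: emeasurable_funB.
- have := measurable_fun_fubini_tonelli_F (m2 := mu) ((fun p => (f p)%:E)^\+)%E
    (measurable_funepos mf') (fun x => funepos_ge0 _ x).
  apply: eq_measurable_fun => x _; rewrite /fubini_F.
  by apply: eq_integral => t _; rewrite !funeposE.
- have := measurable_fun_fubini_tonelli_F (m2 := mu) ((fun p => (f p)%:E)^\-)%E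
    (measurable_funeneg mf') (fun x => funeneg_ge0 _ x).
  apply: eq_measurable_fun => x _; rewrite /fubini_F.
  by apply: eq_integral => t _; rewrite !funenegE.
Qed.

(** Measurability in infinitely many coordinates, phrased through measurable test families instead
    of a sigma-algebra on [nat -> R]. The parameter in [T] absorbs the integrated variables one by
    one in [measurable_iint]. *)
Definition jointly_measurable {dT} {T : measurableType dT}
    (H : T -> (nat -> R) -> R) :=
  forall dS (S : measurableType dS) (u : S -> T) (X : nat -> S -> R),
    measurable_fun setT u -> (forall i, measurable_fun setT (X i)) ->
    measurable_fun setT (fun s => H (u s) (fun i => X i s)).

Definition upd (m : nat) (t : R) (x : nat -> R) : nat -> R :=
  fun i => if i == m then t else x i.

Lemma iintS m (F : (nat -> R) -> R) :
  iint m.+1 F = \int[mu]_(t in setT) iint m (fun x => F (upd m t x)).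
Proof. by []. Qed.

Lemma jointly_measurable_upd {dT} {T : measurableType dT}
    (H : T -> (nat -> R) -> R) m : jointly_measurable H ->
  jointly_measurable (fun (p : T * R) x => H p.1 (upd m p.2 x)).
Proof.
move=> mH dS S u X mu_ mX.
apply: (mH _ _ (fun s => (u s).1) (fun i s => upd m (u s).2 (X^~ s) i)).
  exact: measurableT_comp.
move=> i; rewrite /upd; case: (i == m) => //.
exact: measurableT_comp.
Qed.

Lemma measurable_iint {dT} {T : measurableType dT} n
    (H : T -> (nat -> R) -> R) : jointly_measurable H ->
  measurable_fun setT (fun x => iint n (H x)).
Proof.
elim: n dT T H => [|m IH] dT T H mH.
  apply: (mH _ _ idfun (fun _ _ => 0)) => [|i].
    exact: measurable_id.
  exact: measurable_cst.
apply: (@measurable_param_Rintegral _ _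
  (fun p => iint m (fun x => H p.1 (upd m p.2 x)))).
have h := IH _ _ _ (jointly_measurable_upd m mH).
exact: h.
Qed.

Lemma integrable_unit_supp (u : R -> R) B : measurable_fun setT u ->
  (forall t, `|u t| <= B) -> (forall t, 1 < `|t| -> u t = 0) ->
  mu.-integrable setT (EFin \o u).
Proof.
move=> mu_ uB us.
have -> : EFin \o u = (EFin \o u) \_ `[(-1), 1].
  apply/funext => t; rewrite patchE; case: ifPn => //.
  rewrite notin_setE /= in_itv/= => /negP tI.
  rewrite /= us//; move: tI; rewrite -ler_norml -ltNge //.
have H := @integrable_mkcond _ _ _ mu `[(-1), 1] (EFin \o u) (measurable_itv _).
apply: (iffLR H).
apply: measurable_bounded_integrable => //.
- by rewrite /= lebesgue_measure_itv/= lte_fin; case: ifP => // _; rewrite -EFinB ltry.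
- exact: measurable_funS mu_.
- exists B; split; first exact: num_real.
  by move=> x Bx y _; exact: le_trans (uB y) (ltW Bx).
Qed.

(* the class of integrands on which [iint n] behaves as an integral *)
Definition nice n (F : (nat -> R) -> R) :=
  [/\ jointly_measurable (fun _ : unit => F),
      exists B, forall x, `|F x| <= B &
      forall x i, (i < n)%N -> 1 < `|x i| -> F x = 0].

Lemma nice_upd m F t : nice m.+1 F -> nice m (fun x => F (upd m t x)).
Proof.
move=> [mF [B FB] sF]; split.
- move=> dS S u X mu_ mX.
  apply: (mF _ _ (fun=> tt) (fun i s => upd m t (X^~ s) i)) => // i.
  by rewrite /upd; case: (i == m).
- by exists B => x.
- move=> x i im xi; apply: (sF _ i); first exact: ltnW.
  by rewrite /upd ltn_eqF.
Qed.

Lemma nice_upd0 m F t : nice m.+1 F -> 1 < `|t| -> forall x, F (upd m t x) = 0.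
Proof. by move=> [_ _ sF] t1 x; apply: (sF _ m); rewrite // /upd eqxx. Qed.

Lemma measurable_iint_upd m F : nice m.+1 F ->
  measurable_fun setT (fun t => iint m (fun x => F (upd m t x))).
Proof.
move=> [mF _ _]; apply: (@measurable_iint _ _ m (fun t x => F (upd m t x))).
move=> dS S u X mu_ mX.
apply: (mF _ _ (fun=> tt) (fun i s => upd m (u s) (X^~ s) i)) => // i.
by rewrite /upd; case: (i == m).
Qed.

Lemma iint0 n : iint n (fun=> 0 : R) = 0.
Proof.
elim: n => //= m ->.
by rewrite Rintegral_cst// mul0r.
Qed.

(** The integrand lives on the cube [[-1, 1]^n], of volume [2 ^+ n]. This bound is what makes the
    inner integrals integrable, hence [iint] linear. *)
Lemma iint_le_norm n F (B : R) : nice n F -> (forall x, `|F x| <= B) ->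
  `|iint n F| <= B * 2 ^+ n.
Proof.
elim: n F => [|m IH] F nF FB; first by rewrite expr0 mulr1; exact: FB.
have B0 : 0 <= B by apply: le_trans (FB (fun=> 0)).
have Bt t : `|iint m (fun x => F (upd m t x))| <= B * 2 ^+ m.
  by apply: IH; [exact: nice_upd|].
have st t : 1 < `|t| -> iint m (fun x => F (upd m t x)) = 0.
  move=> t1; rewrite (_ : (fun x => _) = fun=> 0) ?iint0//.
  by apply/funext => x; exact: nice_upd0.
have int1 := integrable_unit_supp (measurable_iint_upd nF) Bt st.
rewrite iintS (le_trans (le_normr_Rintegral _ int1))//.
have -> : B * 2 ^+ m.+1 = \int[mu]_(t in `[(-1), 1]) (B * 2 ^+ m).
  rewrite Rintegral_cst//= lebesgue_measure_itv/= lte_fin.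
  by rewrite (_ : (-1 < 1 :> R) = true) /=; [rewrite exprS; lra|lra].
rewrite [leRHS]Rintegral_mkcond.
apply: le_Rintegral => //.
- by have := integrable_norm int1.
- apply: (@integrable_unit_supp _ (B * 2 ^+ m)).
  + by apply/measurable_restrict => //; apply: measurable_cst.
  + move=> t; rewrite patchE; case: ifP => _; rewrite ?normr0 ?ger0_norm//;
    by rewrite mulr_ge0// exprn_ge0.
  + move=> t t1; rewrite patchE ifF//; apply/negP; rewrite inE/= in_itv/=.
    by rewrite -ler_norml leNgt t1.
- move=> t _; rewrite patchE; case: ifPn => // tI.
  rewrite st ?normr0// ltNge ler_norml; apply/negP => H.
  by move: tI; rewrite notin_setE/= in_itv/=.
Qed.

Lemma integrable_iint_upd m F : nice m.+1 F ->
  mu.-integrable setT (EFin \o (fun t => iint m (fun x => F (upd m t x)))).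
Proof.
move=> nF; have [_ [B FB] _] := nF.
apply: (@integrable_unit_supp _ (B * 2 ^+ m)).
- exact: measurable_iint_upd.
- by move=> t; apply: iint_le_norm => //; exact: nice_upd.
- move=> t t1; rewrite (_ : (fun x => _) = fun=> 0) ?iint0//.
  by apply/funext => x; exact: nice_upd0 t1 x.
Qed.

Lemma iint_linear n a F G : nice n F -> nice n G ->
  iint n (fun x => a * F x + G x) = a * iint n F + iint n G.
Proof.
elim: n F G => [|m IH] F G nF nG //.
rewrite !iintS.
have E t : iint m (fun x => a * F (upd m t x) + G (upd m t x)) =
    a * iint m (fun x => F (upd m t x)) + iint m (fun x => G (upd m t x)).
  by apply: IH; exact: nice_upd.
under eq_Rintegral do rewrite E.
rewrite RintegralD//; first by rewrite RintegralZl//; exact: integrable_iint_upd.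
- apply: (@eq_integrable _ _ _ mu setT measurableT
    (fun t => a%:E * (EFin \o (fun t => iint m (fun x => F (upd m t x)))) t)%E) => //.
  by apply: integrableZl => //; exact: integrable_iint_upd.
- exact: integrable_iint_upd.
Qed.

Lemma iint_ge0 n (F : (nat -> R) -> R) : (forall x, 0 <= F x) -> 0 <= iint n F.
Proof.
elim: n F => [|m IH] F F0 //=.
by apply: Rintegral_ge0 => t _; exact: IH.
Qed.

(** The source of strict positivity: an integrand bounded below on a box of positive volume has a
    positive integral. *)
Lemma iint_ge_box n F (a b : nat -> R) (e : R) : 0 <= e -> nice n F ->
  (forall x, 0 <= F x) -> (forall i, a i <= b i) ->
  (forall x, (forall i, (i < n)%N -> a i <= x i <= b i) -> e <= F x) ->
  e * \prod_(i < n) (b i - a i) <= iint n F.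
Proof.
move=> e0; elim: n F => [|m IH] F nF F0 ab eF.
  by rewrite big_ord0 mulr1; apply: eF.
rewrite big_ord_recr/= mulrA -/(iint m.+1 F).
set P := e * _.
have P0 : 0 <= P by rewrite mulr_ge0// prodr_ge0// => i _; rewrite subr_ge0.
have -> : P * (b m - a m) = \int[mu]_(t in `[a m, b m]) P.
  rewrite Rintegral_cst//= lebesgue_measure_itv/= lte_fin.
  case: ifPn => //=; rewrite -leNgt => ba.
  by rewrite (@le_anti _ _ (a m) (b m)) ?ab// subrr.
rewrite [leLHS]Rintegral_mkcond iintS.
have int1 := integrable_iint_upd nF.
apply: le_Rintegral => //.
- rewrite -restrict_EFin.
  have H := @integrable_mkcond _ _ _ mu `[a m, b m] (EFin \o cst P) (measurable_itv _).
  apply: (iffLR H).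
  apply: measurable_bounded_integrable => //.
  + by rewrite /= lebesgue_measure_itv/= lte_fin; case: ifP => // _; rewrite -EFinB ltry.
  + by exists P; split; [exact: num_real|move=> x Px y _ /=; rewrite ger0_norm// ltW].
- move=> t _; rewrite patchE; case: ifPn => [|_]; last exact: iint_ge0.
  rewrite inE/= in_itv/= => tab.
  apply: IH => //; first exact: nice_upd.
  move=> x xab; apply: eF => i; rewrite /upd ltnS leq_eqVlt.
  by case: eqP => [->//|_] /= /xab.
Qed.

(* the outermost variable of [iint n] is [x (n.-1)] *)
Lemma iint_eq_off0 n F G : nice n.+1 F -> nice n.+1 G ->
  (forall x, x n != 0 -> F x = G x) -> iint n.+1 F = iint n.+1 G.
Proof.
move=> nF nG FG; rewrite !iintS /Rintegral; congr fine.
rewrite -[LHS](@integral_setD1 _ _ 0)//; last 2 first.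
- exact: measurableD.
- by apply/measurable_EFinP; apply: measurable_funTS; exact: (measurable_iint_upd nF).
rewrite -[RHS](@integral_setD1 _ _ 0)//; last 2 first.
- exact: measurableD.
- by apply/measurable_EFinP; apply: measurable_funTS; exact: (measurable_iint_upd nG).
apply: eq_integral => t; rewrite inE/= => -[_ /eqP t0]; congr (iint _ _)%:E.
by apply/funext => x; apply: FG; rewrite /upd eqxx.
Qed.

End IteratedIntegral.

(** * The normalized surface integral on continuous functions *)

Section SphereIntegral.
Context {R : realType}.

Lemma sqnorm_ge0 d (v : 'rV[R]_d) : 0 <= sqnorm v.
Proof. by apply: sumr_ge0 => i _; exact: sqr_ge0. Qed.

Lemma sqnormZ d a (v : 'rV[R]_d) : sqnorm (a *: v) = a ^+ 2 * sqnorm v.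
Proof. by rewrite /sqnorm mulr_sumr; apply: eq_bigr => i _; rewrite mxE exprMn. Qed.

Lemma sqnorm_coord d (v : 'rV[R]_d) i : v ord0 i ^+ 2 <= sqnorm v.
Proof.
by rewrite /sqnorm (bigD1 i)//= lerDl sumr_ge0// => j _; exact: sqr_ge0.
Qed.

Definition unitv d (v : 'rV[R]_d) := (Num.sqrt (sqnorm v))^-1 *: v.

Lemma unitv_sphere d (v : 'rV[R]_d) : sqnorm v != 0 -> sphere d (unitv v).
Proof.
move=> v0; rewrite /sphere/= /unitv sqnormZ exprVn sqr_sqrtr ?sqnorm_ge0//.
by rewrite mulVf.
Qed.

Lemma continuous_bigsum (T : topologicalType) (I : Type) (r : seq I)
    (F : I -> T -> R) : (forall i, continuous (F i)) ->
  continuous (fun x => \sum_(i <- r) F i x).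
Proof.
move=> Fc; elim: r => [|i r IH] x.
  by under eq_fun do rewrite big_nil; exact: cst_continuous.
under eq_fun do rewrite big_cons.
by apply: continuousD; [exact: Fc|exact: IH].
Qed.

Lemma sqnorm_continuous d : continuous (@sqnorm R d).
Proof.
apply: continuous_bigsum => i v.
under eq_fun do rewrite expr2.
by apply: continuousM; exact: coord_continuous.
Qed.

Lemma sphere_closed d : closed (@sphere R d).
Proof.
rewrite (_ : sphere d = @sqnorm R d @^-1` [set 1]) //.
by apply: closed_comp; [move=> v _; exact: sqnorm_continuous|exact: closed_eq].
Qed.

Lemma sphere_coord_le1 d (v : 'rV[R]_d) i : sphere d v -> `|v ord0 i| <= 1.
Proof.
by move=> vS; rewrite -(@expr_le1 _ 2)// real_normK ?num_real// -[leRHS]vS sqnorm_coord.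
Qed.

Lemma sphere_compact d : compact (@sphere R d.+1).
Proof.
apply: bounded_closed_compact; last exact: sphere_closed.
exists 1; split; first exact: num_real.
move=> x x1 v vS /=; rewrite [leLHS]mx_normrE.
apply/bigmax_leP; split; first exact: le_trans (ltW x1).
by move=> [i j] _ /=; rewrite ord1; exact: le_trans (sphere_coord_le1 _ vS) (ltW x1).
Qed.

Lemma within_sphere_bounded d (g : 'rV[R]_d.+1 -> R) :
  {within sphere d.+1, continuous g} ->
  exists2 B, 0 <= B & forall v, sphere d.+1 v -> `|g v| <= B.
Proof.
move=> gc; have := compact_bounded (continuous_compact gc (@sphere_compact d)).
move=> [B [_ hB]]; exists (`|B| + 1); first by rewrite addr_ge0.
move=> v vS; apply: (hB _ _ (g v)); last by exists v.
by rewrite (le_lt_trans (ler_norm B))// ltrDl.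
Qed.

Section MeasurableCoordinates.
Context {dS : measure_display} {S : measurableType dS} {d : nat}.
Variable V : S -> 'rV[R]_d.
Hypothesis mV : forall i, measurable_fun setT (fun s => V s ord0 i).

Lemma measurable_sqnorm : measurable_fun setT (fun s => sqnorm (V s)).
Proof. by apply: measurable_sum => i; exact: measurable_funX. Qed.

Lemma measurable_unitv i : measurable_fun setT (fun s => unitv (V s) ord0 i).
Proof.
rewrite (_ : (fun s => _) =
    fun s => (sqnorm (V s)) `^ (- 2^-1) * V s ord0 i).
  apply: measurable_funM => //.
  by apply: (measurableT_comp (measurable_powR _)); exact: measurable_sqnorm.
apply/funext => s; rewrite /unitv mxE; congr (_ * _).
by rewrite powRN powR12_sqrt// sqnorm_ge0.
Qed.

(** An open set is the countable union of the cubes with rational centre and radius [1 / (k + 1)]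
    that it contains, and the preimage of a cube is cut out by finitely many coordinate
    conditions. *)
Lemma measurable_open_preimage (O : set 'rV[R]_d) : open O ->
  measurable [set s | O (V s)].
Proof.
move=> oO.
pose F (p : 'rV[rat]_d * nat) : set S :=
  if asbool ([set v : 'rV[R]_d | forall i, `|v ord0 i - ratr (p.1 ord0 i)| < p.2.+1%:R^-1]
     `<=` O)
  then [set s | forall i, `|V s ord0 i - ratr (p.1 ord0 i)| < p.2.+1%:R^-1]
  else set0.
have -> : [set s | O (V s)] = \bigcup_p F p.
  apply/seteqP; split => [s /= Os|s [p _]]; last first.
    by rewrite /F; case: asboolP => // pO /= Fs; exact: pO.
  have /nbhs_ballP[e /= e0 eO] : nbhs (V s) O by exact: open_nbhs_nbhs.
  have [k ke] : exists k, (k.+1%:R : R)^-1 < e / 2.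
    have e2 : 0 < e / 2 by rewrite divr_gt0.
    by have [k] := ltr_add_invr e2; rewrite add0r; exists k.
  have q i : {q : rat | `|V s ord0 i - ratr q| < k.+1%:R^-1}.
    apply: cid.
    have := @rat_in_itvoo R (V s ord0 i - k.+1%:R^-1) (V s ord0 i + k.+1%:R^-1).
    case=> [|q]; first by rewrite ltrBlDr -addrA ltrDl addr_gt0.
    rewrite in_itv/= => /andP[q1 q2]; exists q.
    by rewrite distrC ltr_distl q1 q2.
  exists (\row_i sval (q i), k) => //; rewrite /F asboolT/=; last first.
    move=> v /= vq; apply: eO; split => // i j; rewrite ord1 /ball/=.
    have := vq j; rewrite mxE; case: (q j) => qj /= h1 h2.
    move: h1 h2 ke; set x := _^-1; move: (ratr qj) => y.
    rewrite !ltr_norml => /andP[h1 h2] /andP[h3 h4] ke.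
    by apply/andP; split; lra.
  by move=> i; rewrite mxE; case: (q i).
apply: countable_bigcupT_measurable; first exact: countableP.
move=> p; rewrite /F; case: ifP => // _.
rewrite (_ : [set s | _] = \big[setI/setT]_(i < d)
    [set s | `|V s ord0 i - ratr (p.1 ord0 i)| < p.2.+1%:R^-1]); last first.
  by rewrite -bigcap_seq; apply/seteqP; split => [s h i _|s h i]; apply: h => //=;
    rewrite mem_index_enum.
apply: bigsetI_measurable => i _.
rewrite -[X in measurable X]setTI.
apply: (measurable_fun_ltr (f := fun s => `|V s ord0 i - ratr (p.1 ord0 i)|)
  (g := cst p.2.+1%:R^-1) _ _ measurableT (Y := [set true])) => //.
by apply: measurableT_comp => //; apply: measurable_funB.
Qed.

(** [g] is controlled on [K] only, so it is extended by 0. An open superlevel set of [g] in the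
    subspace [K] is the trace of an open set, which leaves [measurable_open_preimage] and the
    measurability of [K] itself. *)
Lemma measurable_within_closed (K : set 'rV[R]_d) (g : 'rV[R]_d -> R) :
  closed K -> {within K, continuous g} ->
  measurable_fun setT (fun s => if asbool (K (V s)) then g (V s) else 0).
Proof.
move=> cK gc.
apply: (measurability _ (RGenOInfty.measurableE R)).
move=> _ [_ [a ->] <-]; rewrite setTI.
have oU : open [set x : R | a < x] by exact: open_gt.
have /open_subspaceP [U' oO OE] :
    open (g @^-1` [set x : R | a < x] : set (subspace K)).
  by move/continuousP : gc; exact.
have mK : measurable [set s | K (V s)].
  rewrite (_ : [set s | _] = ~` [set s | (~` K) (V s)]).
    by apply: measurableC; apply: measurable_open_preimage; exact: closed_openC.
  by apply/seteqP; split => [s /= h h'|s /= /contrapT].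
have mO := measurable_open_preimage oO.
rewrite (_ : _ @^-1` _ = ([set s | K (V s)] `&` [set s | U' (V s)]) `|`
   (~` [set s | K (V s)] `&` (if a < 0 then setT else set0))).
  apply: measurableU; first exact: measurableI.
  by apply: measurableI; [exact: measurableC|case: ifP].
have OE' v : K v -> U' v <-> a < g v.
  move=> Kv; have : (U' `&` K) v <-> (g @^-1` [set x : R | a < x] `&` K) v by rewrite OE.
  by move=> [h1 h2]; split => h; [case: h1|case: h2].
apply/seteqP; split => [s /=|s /=]; rewrite in_itv/= andbT.
  case: asboolP => [Ks|nKs] h; first by left; split => //; apply/OE'.
  by right; split => //; rewrite h.
case=> [[Ks /OE'-/(_ Ks)]|[nKs]]; first by rewrite asboolT.
by rewrite asboolF//; case: ifP.
Qed.

End MeasurableCoordinates.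

Section Cone.
Variable d : nat.
Implicit Types g h : 'rV[R]_d.+1 -> R.
Local Notation row_of x := (\row_(i < d.+1) x (nat_of_ord i) : 'rV[R]_d.+1).

Definition cone g (x : nat -> R) : R :=
  ballind (row_of x) * g (unitv (row_of x)).

Lemma sintE g : sint g = iint d.+1 (cone g) / iint d.+1 (cone (fun=> 1)).
Proof.
rewrite /sint /vint; congr (_ / iint _ _).
by apply/funext => x; rewrite /cone mulr1.
Qed.

Lemma ballind_ge0 (v : 'rV[R]_d.+1) : 0 <= ballind v.
Proof. by rewrite /ballind; case: ifP. Qed.

Lemma nice_cone g : {within sphere d.+1, continuous g} -> nice d.+1 (cone g).
Proof.
move=> gc; split.
- move=> dS S u X _ mX.
  pose V s := row_of (X^~ s).
  have mV i : measurable_fun setT (fun s => V s ord0 i).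
    by rewrite (_ : (fun s => _) = X i) //; apply/funext => s; rewrite mxE.
  (* Off the origin [unitv] lands on the sphere, where [g] is continuous; at the origin [unitv] is 0
     by the convention on inverses, and the value is the constant [g 0]. *)
  rewrite (_ : (fun s => _) = fun s => (if sqnorm (V s) <= 1 then 1 else 0) *
      (if sqnorm (V s) == 0 then g 0 else
       if asbool (sphere d.+1 (unitv (V s))) then g (unitv (V s)) else 0)).
    apply: measurable_funM.
      apply: measurable_fun_ifT; [|exact: measurable_cst..].
      by apply: measurable_fun_ler; [exact: measurable_sqnorm|exact: measurable_cst].
    apply: measurable_fun_ifT; [|exact: measurable_cst|].
      by apply: measurable_fun_eqr; [exact: measurable_sqnorm|exact: measurable_cst].
    apply: (measurable_within_closed (V := fun s => unitv (V s))) => //.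
      by move=> i; exact: measurable_unitv.
    exact: sphere_closed.
  apply/funext => s; rewrite /cone /ballind -/(V s); congr (_ * _).
  case: eqVneq => [V0|/unitv_sphere/asboolT -> //].
  by rewrite /unitv V0 sqrtr0 invr0 scale0r.
- have [B B0 gB] := within_sphere_bounded gc.
  exists (B + `|g 0|) => x; rewrite /cone normrM.
  suff h : `|g (unitv (row_of x))| <= B + `|g 0|.
    rewrite /ballind; case: ifP => _; first by rewrite normr1 mul1r.
    by rewrite normr0 mul0r addr_ge0.
  have [V0|/unitv_sphere/gB h] := eqVneq (sqnorm (row_of x)) 0.
    by rewrite /unitv V0 sqrtr0 invr0 scale0r lerDr.
  by rewrite (le_trans h)// lerDl.
- move=> x i id1 xi; rewrite /cone /ballind ifF ?mul0r//.
  apply/negbTE; rewrite -ltNge.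
  have := sqnorm_coord (row_of x) (Ordinal id1); rewrite mxE/=.
  by apply: lt_le_trans; rewrite -real_normK ?num_real// exprn_egt1.
Qed.

Lemma within_sphere_cst (c : R) : {within sphere d.+1, continuous (fun _ : 'rV[R]_d.+1 => c)}.
Proof. by apply: continuous_subspaceT => x; exact: cst_continuous. Qed.

Lemma eq_within_sphere g h : (forall v, sphere d.+1 v -> g v = h v) ->
  {within sphere d.+1, continuous g} -> {within sphere d.+1, continuous h}.
Proof.
by move=> gh; apply: subspace_eq_continuous => v vS; apply: gh; rewrite -in_setE.
Qed.

(** Functions equal on the sphere may still differ at [unitv 0 = 0]. The origin lies in the
    hyperplane where the outermost variable vanishes, which is negligible. *)
Lemma iint_cone_eq g h : {within sphere d.+1, continuous g} ->
  (forall v, sphere d.+1 v -> g v = h v) ->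
  iint d.+1 (cone g) = iint d.+1 (cone h).
Proof.
move=> gc gh; apply: iint_eq_off0.
- exact: nice_cone.
- by apply: nice_cone; exact: eq_within_sphere gc.
- move=> x xd; rewrite /cone gh//; apply: unitv_sphere.
  rewrite gt_eqF// (lt_le_trans _ (sqnorm_coord _ ord_max))//.
  by rewrite mxE exprn_even_gt0.
Qed.

Lemma iint_cone_ge0 g : {within sphere d.+1, continuous g} ->
  (forall v, sphere d.+1 v -> 0 <= g v) -> 0 <= iint d.+1 (cone g).
Proof.
move=> gc g0.
rewrite (@iint_cone_eq _ (fun v => if asbool (sphere d.+1 v) then g v else 0))//.
  apply: iint_ge0 => x; rewrite /cone mulr_ge0 ?ballind_ge0//.
  by case: asboolP => // /g0.
by move=> v vS; rewrite asboolT.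
Qed.

Lemma unitv_continuous_at (p : 'rV[R]_d.+1) : sqnorm p != 0 ->
  {for p, continuous (@unitv d.+1)}.
Proof.
move=> p0; rewrite /unitv; apply: continuousZ; last exact: cvg_id.
apply: continuousV.
  by rewrite sqrtr_eq0 -ltNge lt_neqAle eq_sym p0 sqnorm_ge0.
by apply: continuous_comp; [exact: sqnorm_continuous|exact: sqrt_continuous].
Qed.

(** By continuity the cone integrand exceeds [g w / 2] on a small box around [w / 2], a point inside
    the ball and away from the origin. *)
Lemma iint_cone_gt0 g w : {within sphere d.+1, continuous g} ->
  (forall v, sphere d.+1 v -> 0 <= g v) -> sphere d.+1 w -> 0 < g w ->
  0 < iint d.+1 (cone g).
Proof.
move=> gc g0 wS gw.
(* [g] may be negative at the origin, which the cone integrand sees; [h] is nonnegative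
   everywhere. *)
pose h v := if asbool (sphere d.+1 v) then g v else 0.
have gh v : sphere d.+1 v -> g v = h v by move=> vS; rewrite /h asboolT.
rewrite (iint_cone_eq gc gh).
have h0 v : 0 <= h v by rewrite /h; case: asboolP => // /g0.
have /open_subspaceP [U' oU UE] :
    open (g @^-1` [set x : R | g w / 2 < x] : set (subspace (sphere d.+1))).
  by move/continuousP : gc; apply; exact: open_gt.
have U'w : U' w.
  have : (U' `&` sphere d.+1) w by rewrite UE; split => //=; lra.
  by case.
pose p : 'rV[R]_d.+1 := 2^-1 *: w.
have sp : sqnorm p = 4^-1 by rewrite sqnormZ wS mulr1 expr2; lra.
have p0 : sqnorm p != 0 by rewrite sp; lra.
have up : unitv p = w.
  rewrite /unitv sp (_ : 4^-1 = (2^-1) ^+ 2 :> R); last by rewrite expr2; lra.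
  by rewrite sqrtr_sqr ger0_norm// invrK scalerA divff// scale1r.
have : \forall v \near p, [/\ U' (unitv v), sqnorm v <= 1 & sqnorm v != 0].
  near=> v; split.
  - near: v; apply: (unitv_continuous_at p0); rewrite up; exact: open_nbhs_nbhs.
  - near: v; apply: (@sqnorm_continuous d.+1 p [set x | x <= 1]).
    have : nbhs (sqnorm p) [set x : R | x < 1].
      by apply: open_nbhs_nbhs; split; [exact: open_lt|rewrite /= sp; lra].
    by apply: filterS => x /ltW.
  - near: v; apply: (@sqnorm_continuous d.+1 p [set x | x != 0]).
    by apply: open_nbhs_nbhs; split => //; exact: open_neq.
move=> /nbhs_ballP[e /= e0 He].
pose a i := p ord0 (inord i) - e / 2.
pose b i := p ord0 (inord i) + e / 2.
have nh : nice d.+1 (cone h) by apply: nice_cone; exact: eq_within_sphere gc.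
have gw2 : 0 <= g w / 2 by lra.
apply: lt_le_trans (iint_ge_box (a := a) (b := b) gw2 nh _ _ _).
- rewrite mulr_gt0//; first by lra.
  by apply: prodr_gt0 => i _; rewrite /a /b; lra.
- by move=> x; rewrite /cone mulr_ge0 ?ballind_ge0.
- by move=> i; rewrite /a /b; lra.
- move=> x xab; have : ball p e (row_of x).
    split => // i j; rewrite ord1 /ball/= mxE.
    have := xab j (ltn_ord j); rewrite /a /b inord_val => /andP[h1 h2].
    by rewrite ltr_norml; apply/andP; split; lra.
  move=> /He[h1 h2 h3]; have uS := unitv_sphere h3.
  rewrite /cone /ballind h2 mul1r -gh//.
  have : (g @^-1` [set x : R | g w / 2 < x] `&` sphere d.+1) (unitv (row_of x)).
    by rewrite -UE.
  by case=> /= h4 _; exact: ltW.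
Unshelve. all: by end_near. Qed.

Lemma north_sphere : sphere d.+1 (north d.+1 : 'rV[R]_d.+1).
Proof.
rewrite /sphere/= /sqnorm (bigD1 ord_max)//= !mxE eqxx expr1n big1 ?addr0// => i.
by rewrite !mxE -val_eqE/= => /negbTE ->; rewrite expr0n.
Qed.

Lemma iint_cone1_gt0 : 0 < iint d.+1 (cone (fun=> 1)).
Proof.
apply: (@iint_cone_gt0 _ (north d.+1)) => //; first exact: within_sphere_cst.
exact: north_sphere.
Qed.

Lemma sint1 : sint (fun _ : 'rV[R]_d.+1 => 1) = 1.
Proof. by rewrite sintE divff// gt_eqF// iint_cone1_gt0. Qed.

Lemma sint_linear (a : R) g h : {within sphere d.+1, continuous g} ->
  {within sphere d.+1, continuous h} ->
  sint (fun v => a * g v + h v) = a * sint g + sint h.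
Proof.
move=> gc hc; rewrite !sintE mulrA -mulrDl -(iint_linear a (nice_cone gc) (nice_cone hc)).
congr (iint _ _ / _); apply/funext => x; rewrite /cone; ring.
Qed.

Lemma eq_sint g h : {within sphere d.+1, continuous g} ->
  (forall v, sphere d.+1 v -> g v = h v) -> sint g = sint h.
Proof. by move=> gc gh; rewrite !sintE (iint_cone_eq gc gh). Qed.

Lemma sint_ge0 g : {within sphere d.+1, continuous g} ->
  (forall v, sphere d.+1 v -> 0 <= g v) -> 0 <= sint g.
Proof.
move=> gc g0; rewrite sintE; apply: divr_ge0; first exact: iint_cone_ge0.
exact: ltW iint_cone1_gt0.
Qed.

Lemma sint_gt0 g w : {within sphere d.+1, continuous g} ->
  (forall v, sphere d.+1 v -> 0 <= g v) -> sphere d.+1 w -> 0 < g w ->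
  0 < sint g.
Proof.
move=> gc g0 wS gw.
by rewrite sintE divr_gt0 ?iint_cone1_gt0//; exact: iint_cone_gt0 gc g0 wS gw.
Qed.

End Cone.
End SphereIntegral.

(* sealed: tactics such as [discriminate] would otherwise evaluate the integrals *)
HB.lock Definition smean {R : realType} {d : nat} (g : 'rV[R]_d -> R) : R := sint g.

Lemma smeanE {R : realType} {d : nat} (g : 'rV[R]_d -> R) : smean g = sint g.
Proof. by rewrite unlock. Qed.

Lemma nat_ind2 (P : nat -> Prop) : P 0 -> P 1 ->
  (forall n, P n -> P n.+1 -> P n.+2) -> forall n, P n.
Proof.
move=> P0 P1 PS n; suff : P n /\ P n.+1 by case.
by elim: n => [//|n [h1 h2]]; split => //; exact: PS.
Qed.

(** * Homogeneous polynomials, Laplacian and directional derivatives *)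

Section HarmonicPolynomials.
Context {R : realType} {d : nat}.
Local Notation MP := (mpoly d R).
Implicit Types (p q : MP) (v : 'rV[R]_d).

Definition homog n p := all (fun m => mdeg m == n) (msupp p).

Lemma homogE n p : homog n p = (p \is @ishomog1 d R n mdeg).
Proof. by rewrite dhomogE. Qed.

Lemma homogD n p q : homog n p -> homog n q -> homog n (p + q).
Proof. by rewrite !homogE; exact: dhomogD. Qed.

Lemma homogZ n c p : homog n p -> homog n (c *: p).
Proof. by rewrite !homogE; exact: dhomogZ. Qed.

Lemma homogM n m p q : homog n p -> homog m q -> homog (n + m) (p * q).
Proof. by rewrite !homogE; exact: dhomogM. Qed.

Lemma homog_sum n (I : Type) (r : seq I) (F : I -> MP) :
  (forall i, homog n (F i)) -> homog n (\sum_(i <- r) F i).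
Proof.
move=> h; elim: r => [|i r IH]; first by rewrite big_nil homogE dhomog0.
by rewrite big_cons homogD.
Qed.

Definition Xvar (i : 'I_d) : MP := mpolyX R (mnm1 i).

Lemma homogX i : homog 1 (Xvar i).
Proof. by rewrite homogE dhomogX/= mdeg1. Qed.

Definition lin v : MP := \sum_i v ord0 i *: Xvar i.
Definition rsq : MP := \sum_i Xvar i ^+ 2.
Definition dirder v p : MP := \sum_i v ord0 i *: mderiv i p.

Lemma homog_lin v : homog 1 (lin v).
Proof. by apply: homog_sum => i; apply: homogZ; exact: homogX. Qed.

Lemma homog_rsq : homog 2 rsq.
Proof. by apply: homog_sum => i; rewrite expr2; exact: homogM (homogX i) (homogX i). Qed.

Lemma homog_mderiv n i p : homog n p -> homog n.-1 (mderiv i p).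
Proof.
move=> hp; rewrite (mpolyE p) raddf_sum/= big_seq homogE.
apply: rpred_sum => m mp; rewrite mderivZ mderivX scalerA.
have [mi0|mi0] := posnP (m i); first by rewrite mi0 mulr0 scale0r dhomog0.
apply: dhomogZ; rewrite dhomogX/=.
move/allP : hp => /(_ _ mp)/eqP <-.
have mE : m = mnm_add (mnm_sub m (mnm1 i)) (mnm1 i) by rewrite submK// lep1mP -lt0n.
by rewrite [in X in _ == X]mE mdegD mdeg1 addn1.
Qed.

Lemma homog_dirder n v p : homog n p -> homog n.-1 (dirder v p).
Proof. by move=> hp; apply: homog_sum => i; apply: homogZ; exact: homog_mderiv. Qed.

Lemma euler n p : homog n p -> \sum_i Xvar i * mderiv i p = n%:R *: p.
Proof.
move=> hp; have dE i : mderiv i p = \sum_(m <- msupp p) mderiv i (mcoeff m p *: mpolyX R m).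
  by rewrite [in LHS](mpolyE p) raddf_sum.
rewrite [in RHS](mpolyE p) scaler_sumr.
under eq_bigr do rewrite dE mulr_sumr.
rewrite exchange_big/=; apply: eq_big_seq => m mp.
move/allP : hp => /(_ _ mp)/eqP <-; rewrite mdegE natr_sum scaler_suml.
apply: eq_bigr => i _; rewrite mderivZ mderivX !scalerA -scalerAr mulrC.
have [mi0|mi0] := posnP (m i); first by rewrite mi0 !(mul0r, mulr0, scale0r).
by rewrite /Xvar -mpolyXD addmC submK ?lep1mP -?lt0n.
Qed.

Lemma mderiv_Xvar i j : mderiv i (Xvar j) = (i == j)%:R.
Proof.
rewrite /Xvar mderivX mnm1E eq_sym; case: eqP => [->|_]; last by rewrite scale0r.
rewrite scale1r (_ : mnm_sub _ _ = mnm0) ?mpolyX0//.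
by apply/mnmP => k; rewrite mnmBE subnn mnm0E.
Qed.

Lemma mderiv_lin i v : mderiv i (lin v) = (v ord0 i)%:A.
Proof.
rewrite /lin raddf_sum/= (bigD1 i)//= big1 ?addr0; last first.
  by move=> j /negbTE ji; rewrite mderivZ mderiv_Xvar eq_sym ji scaler0.
by rewrite mderivZ mderiv_Xvar eqxx.
Qed.

Lemma mderiv_rsq i : mderiv i rsq = 2 *: Xvar i.
Proof.
rewrite /rsq raddf_sum/= (bigD1 i)//= big1 ?addr0; last first.
  by move=> j /negbTE ji; rewrite expr2 mderivM mderiv_Xvar eq_sym ji mulr0 mul0r addr0.
by rewrite expr2 mderivM mderiv_Xvar eqxx mulr1 mul1r scaler_nat mulr2n.
Qed.

Lemma laplacianD p q : laplacian (p + q) = laplacian p + laplacian q.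
Proof. by rewrite /laplacian -big_split; apply: eq_bigr => i _; rewrite !mderivD. Qed.

Lemma laplacianZ c p : laplacian (c *: p) = c *: laplacian p.
Proof. by rewrite /laplacian scaler_sumr; apply: eq_bigr => i _; rewrite !mderivZ. Qed.

Lemma laplacianM p q : laplacian (p * q) =
  laplacian p * q + 2 *: (\sum_i mderiv i p * mderiv i q) + p * laplacian q.
Proof.
rewrite /laplacian scaler_sumr mulr_suml mulr_sumr -!big_split; apply: eq_bigr => i _ /=.
rewrite !(mderivM, mderivD) scaler_nat; ring.
Qed.

Lemma laplacian_lin v : laplacian (lin v) = 0.
Proof. by rewrite /laplacian big1// => i _; rewrite mderiv_lin mderivZ -mpolyC1 mderivC scaler0. Qed.

Lemma laplacian_rsq : laplacian rsq = (2 * d%:R)%:A.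
Proof.
rewrite /laplacian; under eq_bigr do rewrite mderiv_rsq mderivZ mderiv_Xvar eqxx.
by rewrite sumr_const card_ord scalerMnl mulr_natr.
Qed.

Lemma laplacian_linM v p : laplacian (lin v * p) = 2 *: dirder v p + lin v * laplacian p.
Proof.
rewrite laplacianM laplacian_lin mul0r add0r; congr (_ *: _ + _).
by apply: eq_bigr => i _; rewrite mderiv_lin mulr_algl.
Qed.

Lemma laplacian_rsqM n p : homog n p ->
  laplacian (rsq * p) = (2 * d%:R + 4 * n%:R) *: p + rsq * laplacian p.
Proof.
move=> hp; rewrite laplacianM laplacian_rsq mulr_algl scalerDl; congr (_ + _ + _).
under eq_bigr do rewrite mderiv_rsq -scalerAl.
by rewrite -scaler_sumr (euler hp) !scalerA; congr (_ *: _); ring.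
Qed.

Lemma dirderD v p q : dirder v (p + q) = dirder v p + dirder v q.
Proof. by rewrite /dirder -big_split; apply: eq_bigr => i _; rewrite mderivD scalerDr. Qed.

Lemma dirderZ v c p : dirder v (c *: p) = c *: dirder v p.
Proof.
rewrite /dirder scaler_sumr; apply: eq_bigr => i _.
by rewrite mderivZ !scalerA mulrC.
Qed.

Lemma dirderM v p q : dirder v (p * q) = dirder v p * q + p * dirder v q.
Proof.
rewrite /dirder mulr_suml mulr_sumr -big_split; apply: eq_bigr => i _.
by rewrite mderivM scalerDr scalerAl scalerAr.
Qed.

Lemma dirder_lin v : dirder v (lin v) = (sqnorm v)%:A.
Proof.
rewrite /dirder /sqnorm scaler_suml; apply: eq_bigr => i _.
by rewrite mderiv_lin scalerA expr2.
Qed.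

Lemma dirder_rsq v : dirder v rsq = 2 *: lin v.
Proof.
rewrite /dirder /lin scaler_sumr; apply: eq_bigr => i _.
by rewrite mderiv_rsq !scalerA mulrC.
Qed.

Lemma laplacian_dirder v p : laplacian (dirder v p) = dirder v (laplacian p).
Proof.
have E i : mderiv i (mderiv i (dirder v p)) =
    \sum_j v ord0 j *: mderiv j (mderiv i (mderiv i p)).
  have -> : mderiv i (dirder v p) = \sum_j v ord0 j *: mderiv i (mderiv j p).
    by rewrite raddf_sum/=; apply: eq_bigr => j _; rewrite mderivZ.
  rewrite raddf_sum/=; apply: eq_bigr => j _; rewrite mderivZ.
  by congr (_ *: _); rewrite [in RHS]mderiv_comm; congr mderiv; rewrite mderiv_comm.
rewrite {1}/laplacian; under eq_bigr do rewrite E.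
rewrite exchange_big/=; apply: eq_bigr => j _.
by rewrite /laplacian [mderiv j (\sum__ _)]raddf_sum scaler_sumr.
Qed.

Definition peval p v : R := meval (fun i => v ord0 i) p.

Lemma peval_dirder n v p : homog n p -> peval (dirder v p) v = n%:R * peval p v.
Proof.
move=> /euler hp; rewrite -[RHS]mevalZ -hp /peval /dirder !raddf_sum/=.
by apply: eq_bigr => i _; rewrite mevalZ mevalM mevalXU.
Qed.

Lemma peval_lin u v : peval (lin u) v = \sum_i u ord0 i * v ord0 i.
Proof. by rewrite /peval /lin raddf_sum/=; apply: eq_bigr => i _; rewrite mevalZ mevalXU. Qed.

Lemma peval_rsq v : peval rsq v = sqnorm v.
Proof. by rewrite /peval /rsq raddf_sum/=; apply: eq_bigr => i _; rewrite !expr2 mevalM mevalXU. Qed.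

End HarmonicPolynomials.

(** * Gegenbauer polynomials and zonal harmonics *)

Section Gegenbauer.
Context {R : realType}.
Variable d : nat.

(** [gega] and [gegb] are the coefficients of the three-term recurrence for the Gegenbauer
    polynomials normalized by [P_n(1) = 1]: [(n + d - 1) P_(n+2) = (2 n + d) t P_(n+1) - (n + 1)
    P_n]. *)
Definition gega (n : nat) : R := (2 * n%:R + d%:R) / (n%:R + d%:R - 1).
Definition gegb (n : nat) : R := (n%:R + 1) / (n%:R + d%:R - 1).

(** One recursion over an arbitrary algebra serves twice: [x = 'X], [r = 1] gives the univariate
    [P_n], while [x = lin v], [r = rsq] gives its homogeneous extension
    [|w|^n P_n(<v, w> / |w|)]. *)
Fixpoint geg_pair (A : algType R) (x r : A) n : A * A :=
  if n is m.+1 then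
    let: (u, v) := geg_pair x r m in (v, gega m *: (x * v) - gegb m *: (r * u))
  else (1, x).

Definition gegh (A : algType R) (x r : A) n := (geg_pair x r n).1.

Lemma gegh0 (A : algType R) (x r : A) : gegh x r 0 = 1. Proof. by []. Qed.
Lemma gegh1 (A : algType R) (x r : A) : gegh x r 1 = x. Proof. by []. Qed.
Lemma geghSS (A : algType R) (x r : A) n :
  gegh x r n.+2 = gega n *: (x * gegh x r n.+1) - gegb n *: (r * gegh x r n).
Proof. by rewrite /gegh /=; case: (geg_pair x r n). Qed.

Definition gegp n : {poly R} := gegh 'X 1 n.

Lemma gegp_horner0 t : (gegp 0).[t] = 1. Proof. by rewrite /gegp gegh0 hornerC. Qed.
Lemma gegp_horner1 t : (gegp 1).[t] = t. Proof. by rewrite /gegp gegh1 hornerX. Qed.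

Lemma gegpSS n : gegp n.+2 = gega n *: ('X * gegp n.+1) - gegb n *: gegp n.
Proof. by rewrite /gegp geghSS mul1r. Qed.

Lemma gegp_hornerSS n t : (gegp n.+2).[t] =
  gega n * (t * (gegp n.+1).[t]) - gegb n * (gegp n).[t].
Proof. by rewrite gegpSS !hornerE. Qed.

Hypothesis d2 : (2 <= d)%N.

Lemma geg_den_gt0 n : 0 < (n%:R + d%:R - 1 : R).
Proof.
have : (2 : R) <= d%:R by rewrite ler_nat.
by have : (0 : R) <= n%:R by []; lra.
Qed.

Lemma gegaE n : gega n * (n%:R + d%:R - 1) = 2 * n%:R + d%:R.
Proof. by rewrite /gega divfK// gt_eqF// geg_den_gt0. Qed.

Lemma gegbE n : gegb n * (n%:R + d%:R - 1) = n%:R + 1.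
Proof. by rewrite /gegb divfK// gt_eqF// geg_den_gt0. Qed.

Lemma gega_gt0 n : 0 < gega n.
Proof.
apply: divr_gt0; last exact: geg_den_gt0.
have : (2 : R) <= d%:R by rewrite ler_nat.
by have : (0 : R) <= n%:R by []; lra.
Qed.

Lemma gegb_gt0 n : 0 < gegb n.
Proof.
apply: divr_gt0; last exact: geg_den_gt0.
by have : (0 : R) <= n%:R by []; lra.
Qed.

Lemma gega_gegb n : gega n - gegb n = 1.
Proof.
have D0 := geg_den_gt0 n; apply: (mulIf (lt0r_neq0 D0)).
by rewrite mulrBl gegaE gegbE; ring.
Qed.

Lemma gegp1 n : (gegp n).[1] = 1.
Proof.
elim/nat_ind2: n => [||n IH0 IH1].
- exact: gegp_horner0.
- exact: gegp_horner1.
- by rewrite gegp_hornerSS IH0 IH1 !mulr1 gega_gegb.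
Qed.

Local Notation MP := (mpoly d R).

Definition zonal (v : 'rV[R]_d) n : MP := gegh (lin v) rsq n.

Lemma zonalSS v n : zonal v n.+2 =
  gega n *: (lin v * zonal v n.+1) - gegb n *: (rsq * zonal v n).
Proof. exact: geghSS. Qed.

Lemma homog_zonal v n : homog n (zonal v n).
Proof.
elim/nat_ind2: n => [||n IH0 IH1].
- by rewrite /zonal gegh0 homogE dhomog1.
- by rewrite /zonal gegh1 homog_lin.
- rewrite zonalSS -scaleNr; apply: homogD; apply: homogZ.
    exact: homogM (homog_lin v) IH1.
  exact: homogM homog_rsq IH0.
Qed.

Lemma peval_zonal v w n : sqnorm w = 1 ->
  peval (zonal v n) w = (gegp n).[\sum_i v ord0 i * w ord0 i].
Proof.
move=> w1; elim/nat_ind2: n => [||n IH0 IH1].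
- by rewrite /zonal gegh0 gegp_horner0 /peval meval1.
- by rewrite /zonal gegh1 gegp_horner1 peval_lin.
- rewrite zonalSS gegp_hornerSS -IH0 -IH1 -peval_lin /peval.
  by rewrite mevalB !mevalZ !mevalM -/(peval rsq w) peval_rsq w1 mul1r.
Qed.

Variable v : 'rV[R]_d.
Hypothesis v1 : sqnorm v = 1.

Lemma dirder1 : dirder v (1 : MP) = 0.
Proof. by rewrite /dirder big1// => i _; rewrite -mpolyC1 mderivC scaler0. Qed.

(* zonal harmonics form an Appell sequence along their axis *)
Lemma dirder_zonal n : dirder v (zonal v n) = n%:R *: zonal v n.-1.
Proof.
elim/nat_ind2: n => [||n IH0 IH1].
- by rewrite /zonal gegh0 dirder1 scale0r.
- by rewrite /zonal gegh1 dirder_lin v1.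
- rewrite zonalSS -scaleNr dirderD !dirderZ !dirderM dirder_lin v1 dirder_rsq IH0 IH1/=.
  case: n {IH0 IH1} => [|n]/=.
    rewrite /zonal gegh0 gegh1 mulr_algl !scale1r scale0r !mulr0 addr0 mulr1.
    rewrite -[lin v + lin v]mulr2n -[lin v *+ 2]scaler_nat mulr1 !scalerA -scalerDl.
    by congr (_ *: _); have := gega_gegb 0; lra.
  have D0 := geg_den_gt0 n; have D1 := geg_den_gt0 n.+1.
  rewrite (zonalSS v n) mulr_algl scale1r.
  set u := lin v * _; set w := rsq * zonal v n.
  have -> : lin v * (n.+2%:R *: zonal v n.+1) = n.+2%:R *: u by rewrite -scalerAr.
  have -> : 2 *: lin v * zonal v n.+1 = 2 *: u by rewrite -scalerAl.
  have -> : rsq * (n.+1%:R *: zonal v n) = n.+1%:R *: w by rewrite -scalerAr.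
  have comb (a b c e f g h k : R) :
      a * b + a * c - e * f = k * b -> - (a * g) - e * h = - (k * g) ->
      a *: (b *: u - g *: w + c *: u) + (- e) *: (f *: u + h *: w) =
      k *: (b *: u - g *: w).
    move=> E1 E2; rewrite !(scalerDr, scalerBr, scalerN, scalerA, mulNr, scaleNr).
    have -> : (k * b) *: u = (a * b) *: u + (a * c) *: u - (e * f) *: u.
      by rewrite -E1 scalerBl scalerDl.
    have -> : (k * g) *: w = (a * g) *: w + (e * h) *: w.
      by rewrite -scalerDl; congr (_ *: _); lra.
    by ring.
  apply: comb => //.
    rewrite /gega /gegb; field.
    by move: (lt0r_neq0 D0) (lt0r_neq0 D1); rewrite -[n.+1%:R]nat1r => -> ->.
  rewrite /gega /gegb; field.
  by move: (lt0r_neq0 D0) (lt0r_neq0 D1); rewrite -[n.+1%:R]nat1r => -> ->.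
Qed.

(** By the Appell property [lin v * Z_(n+1)] contributes [2 (n + 1) Z_n] and [rsq * Z_n] contributes
    [(2 d + 4 n) Z_n]; the recurrence coefficients are exactly in the ratio that cancels them. *)
Lemma laplacian_zonal n : laplacian (zonal v n) = 0.
Proof.
elim/nat_ind2: n => [||n IH0 IH1].
- by rewrite /zonal gegh0 /laplacian big1// => i _; rewrite -mpolyC1 !(mderivC, mderiv0).
- by rewrite /zonal gegh1 laplacian_lin.
- rewrite zonalSS -scaleNr laplacianD !laplacianZ laplacian_linM IH1 mulr0 addr0.
  rewrite (laplacian_rsqM (homog_zonal v n)) IH0 mulr0 addr0 dirder_zonal/=.
  rewrite !scalerA -scalerDl (_ : _ + _ = 0) ?scale0r//.
  have D0 := geg_den_gt0 n; rewrite /gega /gegb; field.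
  exact: lt0r_neq0 D0.
Qed.

End Gegenbauer.

Section GegenbauerSpan.
Context {R : realType}.
Variable d : nat.
Hypothesis d2 : (2 <= d)%N.
Local Notation gegp := (@gegp R d).

Lemma gegp_size_lead n : size (gegp n) = n.+1 /\ 0 < lead_coef (gegp n).
Proof.
elim/nat_ind2: n => [||n [s0 l0] [s1 l1]].
- by rewrite /gegp gegh0 size_poly1 lead_coef1.
- by rewrite /gegp gegh1 size_polyX lead_coefX.
- have g0 := gega_gt0 (R := R) d2 n.
  have nz : gegp n.+1 != 0 by rewrite -size_poly_eq0 s1.
  have sa : size (@gega R d n *: ('X * gegp n.+1)) = n.+3.
    by rewrite size_scale ?gt_eqF// mulrC size_mulX// s1.
  have lt : (size (- (@gegb R d n *: gegp n)) < size (@gega R d n *: ('X * gegp n.+1)))%N.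
    by rewrite sa size_polyN (leq_ltn_trans (size_scale_leq _ _))// s0.
  rewrite gegpSS size_polyDl// lead_coefDl// sa; split => //.
  by rewrite lead_coefZ lead_coefM lead_coefX mul1r mulr_gt0.
Qed.

(** An induction principle: peeling off leading terms reduces an identity between linear functionals
    on polynomials to the Gegenbauer polynomials. *)
Lemma gegp_span (Q : {poly R} -> Prop) : Q 0 ->
  (forall a n p, Q p -> Q (a *: gegp n + p)) -> forall p, Q p.
Proof.
move=> Q0 QS p; have [m] := ubnP (size p).
elim: m p => // m IH p sp.
have [->//|p0] := eqVneq p 0.
have [sg lg] := gegp_size_lead (size p).-1.
set g := gegp _ in sg lg.
rewrite (_ : p = (lead_coef p / lead_coef g) *: g +
   (p - (lead_coef p / lead_coef g) *: g)); last by rewrite addrC subrK.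
apply: QS; apply: IH.
have sp0 : (0 < size p)%N by rewrite lt0n size_poly_eq0.
have {}sg : size g = size p by rewrite sg prednK.
rewrite -ltnS; apply: leq_trans sp; rewrite ltnS -(prednK sp0) ltnS.
apply/leq_sizeP => j; rewrite leq_eqVlt => /predU1P[<-|].
  rewrite coefB coefZ -[X in _ * X]/(g`_(size p).-1) -{2}sg -/(lead_coef g).
  by rewrite divfK ?gt_eqF// -/(lead_coef p) subrr.
rewrite prednK// => sj.
by rewrite coefB coefZ !nth_default ?sg// mulr0 subrr.
Qed.

End GegenbauerSpan.

(** * Scalar products and continuous functions on the sphere *)

Section Dot.
Context {R : realType} {d : nat}.
Implicit Types v w : 'rV[R]_d.

Definition dot v w : R := \sum_i v ord0 i * w ord0 i.

Lemma dotC v w : dot v w = dot w v.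
Proof. by apply: eq_bigr => i _; rewrite mulrC. Qed.

Lemma dotvv v : dot v v = sqnorm v.
Proof. by apply: eq_bigr => i _; rewrite expr2. Qed.

Lemma dotDl u v w : dot (u + v) w = dot u w + dot v w.
Proof. by rewrite /dot -big_split; apply: eq_bigr => i _; rewrite mxE mulrDl. Qed.

Lemma dotZl a v w : dot (a *: v) w = a * dot v w.
Proof. by rewrite /dot mulr_sumr; apply: eq_bigr => i _; rewrite mxE mulrA. Qed.

Lemma dotDr u v w : dot w (u + v) = dot w u + dot w v.
Proof. by rewrite dotC dotDl !(dotC w). Qed.

Lemma dotZr a v w : dot w (a *: v) = a * dot w v.
Proof. by rewrite dotC dotZl dotC. Qed.

Lemma dot_bound v w : sqnorm v = 1 -> sqnorm w = 1 -> -1 <= dot v w <= 1.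
Proof.
move=> v1 w1.
have h e : 0 <= sqnorm (v + e *: w) by exact: sqnorm_ge0.
have E e : sqnorm (v + e *: w) = 1 + 2 * e * dot v w + e ^+ 2.
  rewrite -dotvv dotDl !dotDr !dotZl !dotZr !dotvv v1 w1 (dotC w v); ring.
by have := h 1; have := h (-1); rewrite !E; nra.
Qed.

End Dot.

Section SphereFunctions.
Context {R : realType} {d : nat}.
Implicit Types f g h : 'rV[R]_d.+1 -> R.

(* a variant rather than a definition, so that implicit arguments and unification
   never unfold the filter-based continuity underneath *)
Variant csph g : Prop := Csph of {within sphere d.+1, continuous g}.

Lemma csph_within g : csph g -> {within sphere d.+1, continuous g}.
Proof. by case. Qed.

Lemma csph_eq g h : (forall v, sphere d.+1 v -> g v = h v) -> csph g -> csph h.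
Proof. by move=> gh [gc]; constructor; exact: eq_within_sphere gh gc. Qed.

Lemma csph_cst (c : R) : csph (fun=> c). Proof. by constructor; exact: within_sphere_cst. Qed.

Lemma csphD g h : csph g -> csph h -> csph (fun v => g v + h v).
Proof. by move=> [gc] [hc]; constructor => x; apply: continuousD; [exact: gc|exact: hc]. Qed.

Lemma csphM g h : csph g -> csph h -> csph (fun v => g v * h v).
Proof. by move=> [gc] [hc]; constructor => x; apply: continuousM; [exact: gc|exact: hc]. Qed.

Lemma csphN g : csph g -> csph (fun v => - g v).
Proof. by move=> [gc]; constructor => x; apply: continuousN; exact: gc. Qed.

Lemma csph_continuous g : continuous g -> csph g.
Proof. by move=> gc; constructor; exact: continuous_subspaceT. Qed.

Lemma csph_coord i : csph (fun v => v ord0 i).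
Proof. by apply: csph_continuous => v; exact: coord_continuous. Qed.

Lemma csph_sum (I : Type) (r : seq I) (F : I -> 'rV[R]_d.+1 -> R) :
  (forall i, csph (F i)) -> csph (fun v => \sum_(i <- r) F i v).
Proof.
move=> Fc; elim: r => [|i r IH].
  by apply: csph_eq (csph_cst 0) => v _; rewrite big_nil.
apply: csph_eq (csphD (Fc i) IH) => v _.
by rewrite big_cons.
Qed.

Lemma csphX g n : csph g -> csph (fun v => g v ^+ n).
Proof.
move=> gc; elim: n => [|n IH].
  by apply: csph_eq (csph_cst 1) => v _; rewrite expr0.
by apply: csph_eq (csphM gc IH) => v _; rewrite exprS.
Qed.

Lemma csph_prod (I : Type) (r : seq I) (F : I -> 'rV[R]_d.+1 -> R) :
  (forall i, csph (F i)) -> csph (fun v => \prod_(i <- r) F i v).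
Proof.
move=> Fc; elim: r => [|i r IH].
  by apply: csph_eq (csph_cst 1) => v _; rewrite big_nil.
apply: csph_eq (csphM (Fc i) IH) => v _.
by rewrite big_cons.
Qed.

Lemma csph_horner (p : {poly R}) g : csph g -> csph (fun v => p.[g v]).
Proof.
move=> gc; apply: csph_eq (csph_sum (index_enum 'I_(size p))
    (F := fun i v => p`_i * g v ^+ i) _) => [v _|i].
  by rewrite horner_coef.
by apply: csphM; [exact: csph_cst|exact: csphX].
Qed.

Lemma csph_dot u : csph (dot u).
Proof. by apply: csph_sum => i; apply: csphM; [exact: csph_cst|exact: csph_coord]. Qed.

Lemma csph_peval (p : mpoly d.+1 R) : csph (peval p).
Proof.
apply: csph_eq (csph_sum (msupp p)
    (F := fun m v => mcoeff m p * \prod_i v ord0 i ^+ m i) _) => [v _|m].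
  by rewrite /peval mevalE.
by apply: csphM; [exact: csph_cst|apply: csph_prod => i; apply: csphX; exact: csph_coord].
Qed.

Lemma csph_sph_harm n g : sph_harm d.+1 n g -> csph g.
Proof.
by move=> [p [_ _ gp]]; apply: csph_eq (csph_peval p) => v /gp ->.
Qed.

Lemma sintD g h : csph g -> csph h -> smean (fun v => g v + h v) = smean g + smean h.
Proof.
move=> gc hc; rewrite !smeanE -[sint g]mul1r -(sint_linear 1 (csph_within gc) (csph_within hc)).
by congr sint; apply/funext => v; rewrite mul1r.
Qed.

Lemma sint_cst (c : R) : smean (fun _ : 'rV[R]_d.+1 => c) = c.
Proof.
have := sint_linear c (csph_within (csph_cst 1)) (csph_within (csph_cst 0)).
have := sint_linear 1 (csph_within (csph_cst 0)) (csph_within (csph_cst 0)).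
rewrite !smeanE !mulr1 !addr0 mul1r sint1 mulr1 -!smeanE.
move: (smean _) => y; rewrite !mul1r => h0 ->.
have -> : y = 0 by lra.
by rewrite addr0.
Qed.

Lemma sintZ (c : R) g : csph g -> smean (fun v => c * g v) = c * smean g.
Proof.
move=> gc; have := sint_linear c (csph_within gc) (csph_within (csph_cst 0)).
rewrite -!smeanE sint_cst addr0 => <-.
by congr smean; apply/funext => v; rewrite addr0.
Qed.

Lemma sintN g : csph g -> smean (fun v => - g v) = - smean g.
Proof.
move=> gc; rewrite -mulN1r -(sintZ _ gc).
by congr smean; apply/funext => v; rewrite mulN1r.
Qed.

Lemma sintB g h : csph g -> csph h -> smean (fun v => g v - h v) = smean g - smean h.
Proof. by move=> gc hc; rewrite (sintD gc (csphN hc)) sintN. Qed.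

Lemma sint_sum (I : Type) (r : seq I) (F : I -> 'rV[R]_d.+1 -> R) :
  (forall i, csph (F i)) ->
  smean (fun v => \sum_(i <- r) F i v) = \sum_(i <- r) smean (F i).
Proof.
move=> Fc; elim: r => [|i r IH].
  rewrite big_nil -[RHS](sint_cst 0).
  by congr smean; apply/funext => v; rewrite big_nil.
rewrite big_cons -IH -(sintD (Fc i) (csph_sum r Fc)).
by congr smean; apply/funext => v; rewrite big_cons.
Qed.

Lemma csph_sint_ge0 g : csph g -> (forall v, sphere d.+1 v -> 0 <= g v) -> 0 <= smean g.
Proof. by move=> [gc] g0; rewrite smeanE; exact: sint_ge0. Qed.

Lemma csph_sint_gt0 g w : csph g -> (forall v, sphere d.+1 v -> 0 <= g v) ->
  sphere d.+1 w -> 0 < g w -> 0 < smean g.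
Proof. by move=> [gc]; rewrite smeanE; exact: sint_gt0. Qed.

Lemma csph_eq_sint g h : csph g -> (forall v, sphere d.+1 v -> g v = h v) ->
  smean g = smean h.
Proof. by move=> [gc] gh; rewrite !smeanE; exact: eq_sint. Qed.

Lemma csph_bounded g : csph g ->
  exists2 B, 0 <= B & forall v, sphere d.+1 v -> `|g v| <= B.
Proof. by move=> [gc]; exact: within_sphere_bounded. Qed.

Lemma le_sint g h : csph g -> csph h ->
  (forall v, sphere d.+1 v -> g v <= h v) -> smean g <= smean h.
Proof.
move=> gc hc gh; rewrite -subr_ge0 -sintB//.
by apply: csph_sint_ge0 => [|v /gh]; [exact: csphD hc (csphN gc)|rewrite subr_ge0].
Qed.

End SphereFunctions.

(** * Orthogonality and the reproducing property of zonal harmonics *)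

Section Harmonics.
Context {R : realType} {d' : nat}.
Local Notation d := d'.+2.
Variable Y : nat -> seq ('rV[R]_d -> R).
Hypothesis onb : sph_onb Y.
Local Notation gegp := (@gegp R d).
Let d2 : (2 <= d)%N. Proof. by []. Qed.

Lemma sph_harm_Yf n j : (j < size (Y n))%N -> sph_harm d n (Yf Y n j).
Proof. by case: onb => h _ _; exact: h. Qed.

Lemma csph_Yf n j : csph (Yf Y n j).
Proof.
have [jn|nj] := ltnP j (size (Y n)); first exact: csph_sph_harm (sph_harm_Yf jn).
by apply: csph_eq (csph_cst 0) => v _; rewrite /Yf nth_default.
Qed.

Lemma sint_Yf n j n' j' : (j < size (Y n))%N -> (j' < size (Y n'))%N ->
  smean (fun v => Yf Y n j v * Yf Y n' j' v) = ((n == n') && (j == j'))%:R.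
Proof. by move=> jn jn'; rewrite smeanE; case: onb => _ _ ->//; case: (_ && _). Qed.

Lemma sph_harm_expand n g : sph_harm d n g -> forall v, sphere d v ->
  g v = \sum_(j < size (Y n)) smean (fun w => g w * Yf Y n j w) * Yf Y n j v.
Proof.
move=> gh; have [c gc] : exists c : nat -> R, forall v, sphere d v ->
    g v = \sum_(j < size (Y n)) c j * Yf Y n j v by case: onb => _ h _; exact: h.
move=> v vS; rewrite gc//; apply: eq_bigr => j _; congr (_ * _).
rewrite (_ : smean _ = smean (fun w => \sum_(i < size (Y n))
    c i * (Yf Y n i w * Yf Y n j w))).
  rewrite sint_sum; last first.
    by move=> i; apply: csphM; [exact: csph_cst|apply: csphM; exact: csph_Yf].
  rewrite (bigD1 j)//= big1 ?addr0 => [|i ij].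
    rewrite sintZ; last by apply: csphM; exact: csph_Yf.
    by rewrite sint_Yf// !eqxx mulr1.
  rewrite sintZ; last by apply: csphM; exact: csph_Yf.
  by rewrite sint_Yf// eqxx/= (negbTE (ij : val i != val j)) mulr0.
apply: csph_eq_sint => [|w wS].
  by apply: csphM; [exact: csph_sph_harm gh|exact: csph_Yf].
by rewrite gc// mulr_suml; apply: eq_bigr => i _; rewrite mulrA.
Qed.

Lemma sint_sph_harm_coef n g f : sph_harm d n g -> csph f ->
  smean (fun v => f v * g v) =
  \sum_(j < size (Y n)) smean (fun w => g w * Yf Y n j w) * smean (fun v => f v * Yf Y n j v).
Proof.
move=> gh fc; have gc := csph_sph_harm gh.
rewrite (@csph_eq_sint _ _ _ (fun v => \sum_(j < size (Y n))
    smean (fun w => g w * Yf Y n j w) * (f v * Yf Y n j v))); first last.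
- move=> v vS; rewrite (sph_harm_expand gh vS) mulr_sumr.
  by apply: eq_bigr => j _; rewrite mulrCA.
- exact: csphM.
rewrite sint_sum => [|j]; last by apply: csphM; [exact: csph_cst|apply: csphM => //; exact: csph_Yf].
by apply: eq_bigr => j _; rewrite sintZ//; apply: csphM => //; exact: csph_Yf.
Qed.

(** Orthogonality across degrees is read off the orthonormal basis by expanding both functions in
    it. *)
Lemma sph_harm_orth n m (g h : 'rV[R]_d -> R) : sph_harm d n g -> sph_harm d m h -> n != m ->
  smean (fun v => g v * h v) = 0.
Proof.
move=> gh hh nm; have gc := csph_sph_harm gh.
rewrite (sint_sph_harm_coef hh gc) big1// => j _.
rewrite (_ : smean (fun v => g v * _) = 0) ?mulr0//.
rewrite (_ : smean _ = smean (fun v => Yf Y m j v * g v)); last first.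
  by congr smean; apply/funext => v; rewrite mulrC.
rewrite (sint_sph_harm_coef gh (csph_Yf m j)) big1// => i _.
by rewrite sint_Yf// eq_sym (negbTE nm) mulr0.
Qed.

Lemma sph_harm_poly n (q : mpoly d R) : homog n q -> laplacian q = 0 ->
  sph_harm d n (peval q).
Proof. by move=> hq lq; exists q; split. Qed.

Lemma sph_harm_zonal u n : sqnorm u = 1 -> sph_harm d n (fun w => (gegp n).[dot u w]).
Proof.
move=> u1; exists (zonal u n); split.
- exact: homog_zonal.
- exact: laplacian_zonal.
- by move=> v vS; rewrite -(peval_zonal u n vS).
Qed.

Lemma csph_poly_dot (p : {poly R}) (u : 'rV[R]_d) : csph (fun w => p.[dot u w]).
Proof. by apply: csph_horner; exact: csph_dot. Qed.

Definition zint (p : {poly R}) : R := smean (fun w : 'rV[R]_d => p.[dot (north d) w]).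

Lemma sint_poly_dot0 (u : 'rV[R]_d) : smean (fun w => (0 : {poly R}).[dot u w]) = 0.
Proof. by rewrite -[RHS](sint_cst (d := d'.+1) 0); congr smean; apply/funext => w; rewrite horner0. Qed.

Lemma sint_poly_dotD a p q (u : 'rV[R]_d) : smean (fun w => (a *: p + q).[dot u w]) =
  a * smean (fun w => p.[dot u w]) + smean (fun w => q.[dot u w]).
Proof.
rewrite -sintZ; last exact: csph_poly_dot.
rewrite -sintD; first by congr smean; apply/funext => w; rewrite !hornerE.
  by apply: csphM; [exact: csph_cst|exact: csph_poly_dot].
exact: csph_poly_dot.
Qed.

Lemma sint_gegp (u : 'rV[R]_d) n : sqnorm u = 1 ->
  smean (fun w => (gegp n).[dot u w]) = (n == 0)%:R.
Proof.
move=> u1; case: n => [|n].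
  by rewrite eqxx -[RHS](sint_cst (d := d'.+1)); congr smean; apply/funext => w; rewrite gegp_horner0.
have h0 : sph_harm d 0 (fun=> 1 : R).
  exists 1; split.
  - by have := homog_zonal (0 : 'rV[R]_d) 0; rewrite /zonal gegh0.
  - by rewrite /laplacian big1// => i _; rewrite -mpolyC1 !(mderivC, mderiv0).
  - by move=> v _; rewrite meval1.
rewrite /= -[RHS](sph_harm_orth (sph_harm_zonal n.+1 u1) h0 isT).
by congr smean; apply/funext => w; rewrite mulr1.
Qed.

(* zonal integrals do not depend on the pole: they are determined by
   orthogonality of the zonal harmonics to the constants *)
Lemma sint_poly_dot (p : {poly R}) (u : 'rV[R]_d) : sqnorm u = 1 ->
  smean (fun w => p.[dot u w]) = zint p.
Proof.
move=> u1; have n1 : sqnorm (north d : 'rV[R]_d) = 1 := north_sphere d'.+1.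
elim/(@gegp_span R d d2): p => [|a n p IH]; first by rewrite /zint !sint_poly_dot0.
by rewrite /zint !sint_poly_dotD IH !sint_gegp.
Qed.

Lemma zintE p : zint p = smean (fun w : 'rV[R]_d => p.[dot (north d) w]).
Proof. by []. Qed.

Lemma zintD a p q : zint (a *: p + q) = a * zint p + zint q.
Proof. exact: sint_poly_dotD. Qed.

Lemma zint0 : zint 0 = 0. Proof. exact: sint_poly_dot0. Qed.

Lemma zint_ge0 p : (forall t, -1 <= t <= 1 -> 0 <= p.[t]) -> 0 <= zint p.
Proof.
move=> p0; apply: csph_sint_ge0; first exact: csph_poly_dot.
by move=> v vS; apply: p0; apply: dot_bound => //; exact: north_sphere.
Qed.

(* the inverse of the dimension of the space of harmonics of degree [n] *)
Fixpoint znorm n : R := if n is m.+1 then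
  znorm m * n%:R * (if m is k.+1 then @gega R d k else 1) / (2 * m%:R + d%:R) else 1.

Lemma znorm_gt0 n : 0 < znorm n.
Proof.
elim: n => [|m IH]; first exact: ltr01.
apply: divr_gt0; last by rewrite -natrM -natrD ltr0n addnS.
apply: mulr_gt0; first by apply: mulr_gt0; rewrite ?ltr0n.
by case: m {IH} => // k; exact: gega_gt0.
Qed.

(* multiplication by a coordinate: <u,w> q = (harmonic of degree n+1) + c |w|^2 d_u q *)
Lemma sph_harm_dotM u n (q : mpoly d R) : homog n.+1 q -> laplacian q = 0 ->
  exists2 h : 'rV[R]_d -> R, sph_harm d n.+2 h & forall w, sphere d w ->
    dot u w * peval q w = h w + (2 * n%:R + d%:R)^-1 * peval (dirder u q) w.
Proof.
move=> hq lq; pose c : R := (2 * n%:R + d%:R)^-1.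
have evE w : sphere d w -> peval (lin u * q - c *: (rsq * dirder u q)) w =
    dot u w * peval q w - c * peval (dirder u q) w.
  move=> wS; rewrite /peval mevalB mevalZ !mevalM -/(peval rsq w) peval_rsq.
  by rewrite -/(peval (lin u) w) peval_lin (wS : sqnorm w = 1) mul1r.
have ldq : laplacian (dirder u q) = 0.
  by rewrite laplacian_dirder lq /dirder big1// => i _; rewrite mderiv0 scaler0.
exists (peval (lin u * q - c *: (rsq * dirder u q))); last first.
  by move=> w wS; rewrite evE// subrK.
apply: sph_harm_poly.
  rewrite -scaleNr; apply: homogD; first exact: homogM (homog_lin u) hq.
  by apply: homogZ; exact: homogM homog_rsq (homog_dirder u hq).
rewrite -scaleNr laplacianD laplacianZ laplacian_linM lq mulr0 addr0.
rewrite (laplacian_rsqM (homog_dirder u hq)) ldq mulr0 addr0 scalerA -scalerDl.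
rewrite (_ : _ + _ = 0) ?scale0r//= /c; field.
by apply: lt0r_neq0; have := ler0n R n; have := ler0n R d'; lra.
Qed.

Lemma homog0_peval (q : mpoly d R) v w : homog 0 q -> peval q v = peval q w.
Proof.
move=> /allP hq; rewrite /peval !mevalE; apply: eq_big_seq => m mq; congr (_ * _).
have /eqP : mdeg m == 0%N by exact: hq.
move/eqP; rewrite mdeg_eq0 => /eqP ->.
by apply: eq_bigr => i _; rewrite mnm0E !expr0.
Qed.

(** Reproducing property, by induction on the degree: one factor [<u, w>] is moved from [P_(n+1)] to
    [q]; the harmonic part of [<u, w> q] is orthogonal to [P_n], and what remains involves the
    derivative of [q] along [u], harmonic of degree [n]. At [u] itself Euler's identity turns this
    derivative back into [q]. *)
Lemma sint_gegp_peval (u : 'rV[R]_d) n (q : mpoly d R) : sqnorm u = 1 ->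
  homog n q -> laplacian q = 0 ->
  smean (fun w => (gegp n).[dot u w] * peval q w) = znorm n * peval q u.
Proof.
move=> u1; elim: n q => [|n IH] q hq lq.
  rewrite mul1r -[RHS](sint_cst (d := d'.+1)); congr smean; apply/funext => w.
  by rewrite gegp_horner0 mul1r; exact: homog0_peval.
have [h hh hE] := sph_harm_dotM u hq lq.
(* [P_1 = t P_0] lies outside the recurrence, hence the value 1 when [n = 0]. *)
pose a : R := if n is k.+1 then @gega R d k else 1.
have qc := csph_peval q.
have -> : smean (fun w => (gegp n.+1).[dot u w] * peval q w) =
    a * smean (fun w => (gegp n).[dot u w] * (dot u w * peval q w)).
  have c1 m : csph (fun w => (gegp m).[dot u w] * (dot u w * peval q w)).
    by apply: csphM; [exact: csph_poly_dot|apply: csphM => //; exact: csph_dot].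
  rewrite /a; case: n {IH hE hh h a} hq c1 => [|k] hq c1.
    rewrite mul1r; congr smean; apply/funext => w.
    by rewrite gegp_horner0 gegp_horner1 mul1r.
  (* The second term of the recurrence has degree [k], while [q] has degree [k + 2]: it integrates
     to 0. *)
  have := sph_harm_orth (sph_harm_zonal k u1) (sph_harm_poly hq lq) ltac:(by rewrite ltn_eqF).
  move=> orth; rewrite -[RHS]subr0 -(mulr0 (@gegb R d k)) -orth -!sintZ//; last first.
    by apply: csphM => //; exact: csph_poly_dot.
  rewrite -sintB.
  - by congr smean; apply/funext => w; rewrite gegp_hornerSS; ring.
  - by apply: csphM; [exact: csph_cst|exact: c1].
  - by apply: csphM; [exact: csph_cst|apply: csphM => //; exact: csph_poly_dot].
have dc : csph (fun w => (gegp n).[dot u w] * peval (dirder u q) w).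
  by apply: csphM; [exact: csph_poly_dot|exact: csph_peval].
have hc := csph_sph_harm hh.
have -> : smean (fun w => (gegp n).[dot u w] * (dot u w * peval q w)) =
    smean (fun w => (gegp n).[dot u w] * h w) +
    (2 * n%:R + d%:R)^-1 * smean (fun w => (gegp n).[dot u w] * peval (dirder u q) w).
  rewrite -sintZ// -sintD; last 2 first.
  - by apply: csphM => //; exact: csph_poly_dot.
  - by apply: csphM => //; exact: csph_cst.
  apply: csph_eq_sint => [|w wS].
    by apply: csphM; [exact: csph_poly_dot|apply: csphM => //; exact: csph_dot].
  by rewrite hE//; ring.
rewrite (sph_harm_orth (sph_harm_zonal n u1) hh) ?add0r; last by rewrite ltn_eqF// ltnS leqnSn.
rewrite (IH (dirder u q)).
- by rewrite (peval_dirder u hq) /= -/a; ring.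
- exact: (homog_dirder u hq).
- by rewrite laplacian_dirder lq /dirder big1// => i _; rewrite mderiv0 scaler0.
Qed.

Lemma sint_gegp_harm (u : 'rV[R]_d) n g : sqnorm u = 1 -> sph_harm d n g ->
  smean (fun w => (gegp n).[dot u w] * g w) = znorm n * g u.
Proof.
move=> u1 gh; have [q [hq lq gq]] := gh; rewrite gq// -(sint_gegp_peval u1 hq lq).
apply: csph_eq_sint => [|w wS]; last by rewrite gq.
by apply: csphM; [exact: csph_poly_dot|exact: csph_sph_harm gh].
Qed.

Lemma sint_gegpM (u v : 'rV[R]_d) n : sqnorm u = 1 -> sqnorm v = 1 ->
  smean (fun w => (gegp n).[dot u w] * (gegp n).[dot v w]) = znorm n * (gegp n).[dot v u].
Proof. by move=> u1 v1; rewrite (sint_gegp_harm u1 (sph_harm_zonal n v1)). Qed.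

Lemma zint_gegpM n m : zint (gegp n * gegp m) = if n == m then znorm n else 0.
Proof.
have n1 : sqnorm (north d : 'rV[R]_d) = 1 := north_sphere d'.+1.
rewrite /zint; under eq_fun do rewrite hornerM.
case: eqVneq => [<-|nm]; first by rewrite sint_gegpM// dotvv n1 gegp1// mulr1.
exact: (sph_harm_orth (sph_harm_zonal n n1) (sph_harm_zonal m n1)).
Qed.

Lemma exists_dot_north (t : R) : -1 <= t <= 1 ->
  exists2 v : 'rV[R]_d, sqnorm v = 1 & dot v (north d) = t.
Proof.
move=> t1; exists (\row_(i < d) (if i == ord_max then t else if i == ord0 then Num.sqrt (1 - t ^+ 2) else 0)).
  rewrite /sqnorm (bigD1 ord_max)//= (bigD1 ord0)//= big1 => [|i /andP[/negbTE i1 /negbTE i0]].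
    rewrite !mxE eqxx/= sqr_sqrtr ?addr0; last by rewrite subr_ge0; nra.
    by rewrite addrC subrK.
  by rewrite mxE i1 i0 expr0n.
rewrite /dot (bigD1 ord_max)//= big1 => [|i /negbTE i1]; last first.
  by rewrite [X in _ * X]mxE ifF ?mulr0//; rewrite -val_eqE in i1.
by rewrite !mxE !eqxx mulr1 addr0.
Qed.

(* Cauchy-Schwarz for two zonal harmonics of the same degree *)
Lemma gegp_bound n t : -1 <= t <= 1 -> -1 <= (gegp n).[t] <= 1.
Proof.
move=> t1; have [v v1 vt] := exists_dot_north t1.
have n1 : sqnorm (north d : 'rV[R]_d) = 1 := north_sphere d'.+1.
have z0 := znorm_gt0 n.
pose g (u : 'rV[R]_d) := fun w => (gegp n).[dot u w].
have gc u : csph (g u) by exact: csph_poly_dot.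
have h e : e ^+ 2 = 1 -> 0 <= 2 * znorm n + 2 * e * (znorm n * (gegp n).[t]).
  move=> e2; have -> : 2 * znorm n + 2 * e * (znorm n * (gegp n).[t]) =
      smean (fun w => (g v w + e * g (north d) w) ^+ 2).
    have E u u' : sqnorm u = 1 -> sqnorm u' = 1 ->
      smean (fun w => g u w * g u' w) = znorm n * (gegp n).[dot u' u] by exact: sint_gegpM.
    have -> : (fun w => (g v w + e * g (north d) w) ^+ 2) = fun w =>
        (g v w * g v w + (2 * e) * (g (north d) w * g v w)) + g (north d) w * g (north d) w.
      by apply/funext => w; rewrite sqrrD exprMn e2; ring.
    rewrite sintD; [|apply: csphD|]; rewrite ?sintD ?sintZ ?E//; try exact: csphM.
    - by rewrite !dotvv v1 n1 vt gegp1//; ring.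
    - by apply: csphM; [exact: csph_cst|exact: csphM].
    - by apply: csphM; [exact: csph_cst|exact: csphM].
  apply: csph_sint_ge0 => [|w _]; last exact: sqr_ge0.
  by apply: csphX; apply: csphD => //; apply: csphM => //; exact: csph_cst.
have := h 1 (expr1n _ _); have := h (-1) (sqrr_sign _ 1).
move: (gegp n).[t] => x h1 h2; apply/andP; split; nra.
Qed.

End Harmonics.

(** * The one-dimensional integral with weight a power of the sine *)

Section TrigIntegral.
Context {R : realType}.
Notation mu := (@lebesgue_measure R).

Lemma integrable_continuous_itv (f : R -> R) a b : continuous f ->
  mu.-integrable `[a, b] (EFin \o f).
Proof.
move=> fc; apply: continuous_compact_integrable; first exact: segment_compact.
exact: continuous_subspaceT.
Qed.

Lemma Rintegral_is_derive (f F : R -> R) (a b : R) : a < b -> continuous f ->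
  (forall x : R, is_derive x 1 F (f x)) ->
  \int[mu]_(x in `[a, b]) f x = F b - F a.
Proof.
move=> ab fc dF; rewrite /Rintegral (@continuous_FTC2 _ f F)//.
- exact: continuous_subspaceT.
- have Fc : continuous F.
    by move=> x; apply: differentiable_continuous; apply/derivable1_diffP; case: (dF x).
  split.
  + by move=> x _; case: (dF x).
  + exact/cvg_at_right_filter/Fc.
  + exact/cvg_at_left_filter/Fc.
- by move=> x _; rewrite derive1E; case: (dF x).
Qed.

Lemma continuous_sinX n : continuous (fun x : R => sin x ^+ n).
Proof.
move=> x; apply: (continuous_comp (f := @sin R) (g := fun y => y ^+ n)).
  exact: continuous_sin.
exact: exprn_continuous.
Qed.

Lemma continuous_horner (p : {poly R}) : continuous (horner p).
Proof.
by move=> x; apply: differentiable_continuous; apply/derivable1_diffP; exact: derivable_horner.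
Qed.

Lemma continuous_poly_cos (p : {poly R}) : continuous (fun x => p.[cos x]).
Proof.
move=> x; apply: (continuous_comp (f := @cos R) (g := horner p)).
  exact: continuous_cos.
exact: continuous_horner.
Qed.

Variable e : nat.

(* the weight [(1 - t ^ 2) ^ ((e - 1) / 2)] after the substitution [t = cos x] *)
Definition wint (p : {poly R}) : R := \int[mu]_(x in `[0, pi]) (p.[cos x] * sin x ^+ e).

Lemma continuous_wint (p : {poly R}) : continuous (fun x => p.[cos x] * sin x ^+ e).
Proof. by move=> x; exact: (continuousM (@continuous_poly_cos p x) (@continuous_sinX e x)). Qed.

Lemma wintD a (p q : {poly R}) : wint (a *: p + q) = a * wint p + wint q.
Proof.
have ip r := @integrable_continuous_itv _ 0 pi (@continuous_wint r).
rewrite /wint -(RintegralZl a _ (ip p)); last exact: measurable_itv.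
rewrite -RintegralD//.
- by apply: eq_Rintegral => x _; rewrite hornerD hornerZ mulrDl mulrA.
- have c : continuous (fun x : R => a * (p.[cos x] * sin x ^+ e)).
    by move=> x; exact: (continuousM (@cst_continuous _ _ a x) (@continuous_wint p x)).
  exact: integrable_continuous_itv c.
Qed.

Lemma wint0 : wint 0 = 0.
Proof. by have := wintD (-1) 0 0; rewrite scaler0 addr0; lra. Qed.

Lemma wintZ a (p : {poly R}) : wint (a *: p) = a * wint p.
Proof. by rewrite -[a *: p]addr0 wintD wint0 addr0. Qed.

Lemma wint_sub (p q : {poly R}) : wint (p - q) = wint p - wint q.
Proof. by rewrite addrC -scaleN1r wintD; lra. Qed.

(** Integrates the derivative of [sin x ^+ e.+1 * p.[cos x]], which vanishes at both ends of
    [[0, pi]]. *)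
Lemma wint_parts (p : {poly R}) : e.+1%:R * wint ('X * p) = wint ((1 - 'X^2) * p^`()).
Proof.
apply/eqP; rewrite -subr_eq0 -wintZ -wint_sub /wint.
rewrite (_ : (fun x => _) = fun x => (e.+1%:R *: ('X * p) - (1 - 'X^2) * p^`()).[cos x] * sin x ^+ e) //.
suff dF (x : R) : is_derive x 1 (fun x => sin x ^+ e.+1 * p.[cos x])
    ((e.+1%:R *: ('X * p) - (1 - 'X^2) * p^`()).[cos x] * sin x ^+ e).
  rewrite (Rintegral_is_derive (pi_gt0 R) (@continuous_wint _) dF).
  by rewrite sinpi sin0 !expr0n/= !mul0r subrr.
have d1 : is_derive x 1 (fun x => p.[cos x]) (- sin x * p^`().[cos x]).
  have := is_derive1_comp (f := horner p) (g := @cos R) (x := x) (a := p^`().[cos x]) (b := - sin x).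
  by rewrite mulrC => h; apply: h.
have d2 : is_derive x 1 (fun x : R => sin x ^+ e.+1) (e.+1%:R * sin x ^+ e * cos x).
  have -> : (fun x0 : R => sin x0 ^+ e.+1) = (@sin R) ^+ e.+1.
    by apply/funext => y; rewrite exprfctE.
  by apply: (is_derive_eq (is_deriveX e.+1 (is_derive_sin x))).
apply: is_derive_eq.
rewrite /GRing.scale/= !(hornerD, hornerN, hornerZ, hornerM, hornerX, hornerXn, hornerC) (exprS _ e).
have -> : cos x * cos x = 1 - sin x ^+ 2 by rewrite -expr2 -(cos2Dsin2 x) addrK.
by ring.
Qed.

Local Notation d := e.+2.
Local Notation gegp := (@gegp R d).

(** Raising and lowering relations, proved jointly: the second at [n] gives the first at [n + 1],
    and both at [n] give the second at [n + 1]. *)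
Lemma gegp_deriv n :
  (1 - 'X^2) * (gegp n)^`() = (n%:R + e%:R) * ('X * gegp n - gegp n.+1) /\
  (1 - 'X^2) * (gegp n.+1)^`() = n.+1%:R * (gegp n - 'X * gegp n.+1).
Proof.
elim: n => [|n [E2 E1]].
  split.
    by rewrite /gegp gegh0 gegh1 mulr1 subrr mulr0 -polyC1 derivC mulr0.
  by rewrite /gegp gegh1 gegh0 derivX mulr1 mul1r expr2.
have D0 := geg_den_gt0 (R := R) (d := d) isT n.
have aE : (@gega R d n)%:P = 1 + (@gegb R d n)%:P.
  by rewrite -polyC1 -polyCD -(gega_gegb (R := R) (d := d) isT n) subrK.
have bE : (@gegb R d n)%:P * (n%:R + e%:R + 1) = n%:R + 1.
  have h := gegbE (R := R) (d := d) isT n.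
  have -> : n%:R + e%:R + 1 = (n%:R + e%:R + 1 : R)%:P by rewrite !polyCD polyC1 !polyC_natr.
  have -> : n%:R + 1 = (n%:R + 1 : R)%:P by rewrite !polyCD polyC1 !polyC_natr.
  rewrite -polyCM -h; congr (_ * _)%:P.
  by rewrite -(natr1 e.+1) -(natr1 e); ring.
have dE : (gegp n.+2)^`() = (1 + (@gegb R d n)%:P) * (gegp n.+1 + 'X * (gegp n.+1)^`()) -
    (@gegb R d n)%:P * (gegp n)^`().
  by rewrite gegpSS derivB !derivZ derivM derivX mul1r -!mul_polyC aE.
move: dE; rewrite gegpSS -!mul_polyC aE; move: (_%:P) bE => b bE dE.
split.
  rewrite E1; have -> : n.+1%:R + e%:R = n%:R + e%:R + 1 :> {poly R} by rewrite -(natr1 n); ring.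
  have -> : (n%:R + e%:R + 1) * ('X * gegp n.+1 - ((1 + b) * ('X * gegp n.+1) - b * gegp n)) =
     b * (n%:R + e%:R + 1) * (gegp n - 'X * gegp n.+1) by ring.
  by rewrite bE natr1.
rewrite dE.
have -> : (1 - 'X^2) * ((1 + b) * (gegp n.+1 + 'X * (gegp n.+1)^`()) - b * (gegp n)^`()) =
    (1 + b) * ((1 - 'X^2) * gegp n.+1) + (1 + b) * ('X * ((1 - 'X^2) * (gegp n.+1)^`())) -
    b * ((1 - 'X^2) * (gegp n)^`()) by ring.
rewrite E1 E2 -(natr1 n.+1) -(natr1 n).
set P0 := gegp n; set P1 := gegp n.+1.
apply/eqP; rewrite -subr_eq0; apply/eqP.
have -> : (1 + b) * ((1 - 'X^2) * P1) + (1 + b) * ('X * ((n%:R + 1) * (P0 - 'X * P1))) -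
    b * ((n%:R + e%:R) * ('X * P0 - P1)) -
    (n%:R + 1 + 1) * (P1 - 'X * ((1 + b) * ('X * P1) - b * P0)) =
    (b * (n%:R + e%:R + 1) - (n%:R + 1)) * (P1 - 'X * P0) by ring.
by rewrite bE subrr mul0r.
Qed.

(** Integration by parts and the lowering relation link degrees [n + 2] and [n] by a recurrence
    carrying the factor [n]. That factor kills degree 2 although degree 0 has positive integral; the
    other degrees follow from 1 and 2. *)
Lemma wint_gegp n : wint (gegp n.+1) = 0.
Proof.
have wX : wint ('X : {poly R}) = 0.
  have := wint_parts 1; rewrite mulr1 -polyC1 derivC mulr0 wint0.
  by move/eqP; rewrite mulf_eq0 pnatr_eq0 => /eqP.
have rec n' : wint (gegp n'.+2) * ((n'%:R + e%:R + 1) * (n'%:R + e%:R + 2)) =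
    (n'%:R + 1) * n'%:R * wint (gegp n').
  have D0 := geg_den_gt0 (R := R) (d := d) isT n'.
  have w1 : e.+1%:R * wint ('X * gegp n'.+1) =
      n'.+1%:R * (wint (gegp n') - wint ('X * gegp n'.+1)).
    have [_ E1] := gegp_deriv n'.
    by rewrite wint_parts E1 mulr_natl -scaler_nat wintZ wint_sub.
  have a1 := gegaE (R := R) (d := d) isT n'; have b1 := gegbE (R := R) (d := d) isT n'.
  rewrite gegpSS wint_sub !wintZ; move: w1 D0 a1 b1.
  rewrite -(natr1 n') -(natr1 e.+1) -(natr1 e).
  set w := wint ('X * _); set v := wint (gegp n').
  move: w v (gega _ _) (gegb _ _) (n'%:R) (e%:R) => w v a b x y w1 D0 a1 b1.
  have W : w * (x + y + 2) = (x + 1) * v by lra.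
  have A : a * (x + y + 1) = 2 * x + y + 2 by lra.
  have B : b * (x + y + 1) = x + 1 by lra.
  have -> : (a * w - b * v) * ((x + y + 1) * (x + y + 2)) =
    (a * (x + y + 1)) * (w * (x + y + 2)) - (b * (x + y + 1)) * v * (x + y + 2) by ring.
  by rewrite A B W; ring.
have nz n' : (n'%:R + e%:R + 1) * (n'%:R + e%:R + 2) != 0 :> R.
  by apply: lt0r_neq0; apply: mulr_gt0; have := ler0n R n'; have := ler0n R e; lra.
elim/nat_ind2: n => [||n IH _].
- exact: wX.
- by apply: (mulIf (nz 0%N)); rewrite rec mulr0 !mul0r.
- by apply: (mulIf (nz n.+1)); rewrite rec IH mulr0 mul0r.
Qed.

Lemma wint1_recl : e.+1%:R * wint 'X^2 = wint (1 - 'X^2).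
Proof. by have := wint_parts 'X; rewrite derivX mulr1 -expr2. Qed.

Lemma le_wint (p q : {poly R}) : (forall t, -1 <= t <= 1 -> p.[t] <= q.[t]) ->
  wint p <= wint q.
Proof.
move=> pq; apply: le_Rintegral => //; [exact: integrable_continuous_itv (@continuous_wint _)..|].
move=> x /=; rewrite in_itv/= => xpi; apply: ler_wpM2r.
  by rewrite exprn_ge0// sin_ge0_pi.
by apply: pq; rewrite cos_geN1 cos_le1.
Qed.

(** Write [sin x = 2 sin (x / 2) cos (x / 2)] and use [cos (x / 2) ^+ e <= 1 <= sqrt 2 * cos (x /
    2)], valid up to [pi / 2]. The right-hand side then has an elementary primitive; this is where
    the [sqrt 2] of the cap estimate comes from. *)
Lemma sinX_le_half (x : R) : 0 <= x <= pi / 2 ->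
  sin x ^+ e <= Num.sqrt 2 * 2 ^+ e * sin (x / 2) ^+ e * cos (x / 2).
Proof.
move=> /andP[x0 xpi]; have pi0 := pi_gt0 R.
have c0 : 0 <= cos (x / 2) by apply: cos_ge0_pihalf; lra.
have s0 : 0 <= sin (x / 2) by apply: sin_ge0_pi; lra.
have sE : sin x = 2 * sin (x / 2) * cos (x / 2).
  by rewrite {1}(splitr x) sinD; ring.
have cE : cos x = 2 * cos (x / 2) ^+ 2 - 1.
  by rewrite {1}(splitr x) cosD; have := cos2Dsin2 (x / 2); lra.
have cx : 0 <= cos x by apply: cos_ge0_pihalf; lra.
have r2 : 1 <= Num.sqrt 2 * cos (x / 2).
  rewrite -(@expr_ge1 _ 2)//; last by rewrite mulr_ge0// sqrtr_ge0.
  by rewrite exprMn sqr_sqrtr//; lra.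
rewrite sE !exprMn.
rewrite (_ : Num.sqrt 2 * 2 ^+ e * _ * _ = 2 ^+ e * sin (x / 2) ^+ e * (Num.sqrt 2 * cos (x / 2))); last by ring.
apply: ler_wpM2l; first by rewrite mulr_ge0// exprn_ge0.
by apply: le_trans r2; rewrite exprn_ile1// cos_le1.
Qed.

Lemma wint_cap (chi : {poly R}) eps (th : R) : 0 < th <= pi / 2 ->
  (forall t, -1 <= t <= 1 -> chi.[t] <= 1) -> 0 <= eps ->
  (forall t, -1 <= t <= cos th -> chi.[t] <= eps) ->
  e.+1%:R * wint chi <=
    e.+1%:R * (eps * wint 1) + Num.sqrt 2 * (2 * sin (th / 2)) ^+ e.+1.
Proof.
move=> /andP[th0 thpi] chi1 eps0 chieps; have pi0 := pi_gt0 R.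
rewrite -lerBlDl -mulrBr -wintZ -wint_sub alg_polyC.
set q := chi - eps%:P.
have qc := @continuous_wint q.
have iq a b := @integrable_continuous_itv _ a b qc.
pose G (x : R) := Num.sqrt 2 * 2 ^+ e * sin (x / 2) ^+ e * cos (x / 2).
have dh (x : R) : is_derive x 1 (fun y : R => y / 2) 2^-1.
  by apply: is_derive_eq; rewrite /GRing.scale/= !(mulr1, mulr0, add0r, addr0).
have halfc (x : R) : {for x, continuous (fun y : R => y / 2)}.
  by apply: differentiable_continuous; apply/derivable1_diffP; case: (dh x).
have Gc : continuous G.
  move=> x.
  have c1 : {for x, continuous (fun y : R => sin (y / 2) ^+ e)}.
    exact: (continuous_comp (halfc x) (@continuous_sinX e (x / 2))).
  have c2 : {for x, continuous (fun y : R => cos (y / 2))}.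
    exact: (continuous_comp (halfc x) (@continuous_cos R (x / 2))).
  exact: (continuousM (continuousM (@cst_continuous _ _ (Num.sqrt 2 * 2 ^+ e) x) c1) c2).
have dF (x : R) : is_derive x 1 (fun x => Num.sqrt 2 * (2 * sin (x / 2)) ^+ e.+1 / e.+1%:R) (G x).
  have ds : is_derive x 1 (fun y : R => sin (y / 2)) (cos (x / 2) / 2).
    exact: (is_derive1_comp (f := @sin R) (g := fun y => y / 2)).
  have dX : is_derive x 1 (fun y : R => sin (y / 2) ^+ e.+1)
      (e.+1%:R * sin (x / 2) ^+ e * (cos (x / 2) / 2)).
    have -> : (fun y : R => sin (y / 2) ^+ e.+1) = (fun y : R => sin (y / 2)) ^+ e.+1.
      by apply/funext => y; rewrite exprfctE.
    exact: (is_derive_eq (is_deriveX e.+1 ds)).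
  have -> : (fun x => Num.sqrt 2 * (2 * sin (x / 2)) ^+ e.+1 / e.+1%:R) =
      (Num.sqrt 2 * 2 ^+ e.+1 / e.+1%:R) \*: (fun y : R => sin (y / 2) ^+ e.+1).
    by apply/funext => y; rewrite exprMn mulrA mulrAC.
  apply: is_derive_eq; rewrite /G /GRing.scale/= exprS; field.
  by rewrite nat1r pnatr_eq0.
have -> : Num.sqrt 2 * (2 * sin (th / 2)) ^+ e.+1 =
    e.+1%:R * \int[mu]_(x in `[0, th]) G x.
  rewrite (Rintegral_is_derive th0 Gc dF) mul0r sin0 mulr0 expr0n/= mulr0 mul0r subr0.
  by rewrite mulrCA divff ?pnatr_eq0// mulr1.
apply: ler_wpM2l => //; rewrite /wint.
have th_pi : th <= pi by lra.
have := @Rintegral_itvB R (fun x => q.[cos x] * sin x ^+ e) (BLeft 0) (BRight pi) th (iq 0 pi).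
rewrite !bnd_simp => /(_ (ltW th0) th_pi) H.
apply: (@le_trans _ _ (\int[mu]_(x in `[0, th]) (q.[cos x] * sin x ^+ e))).
  rewrite -subr_le0 H.
  rewrite (_ : 0 = \int[mu]_(x in `]th, pi]) 0); last by rewrite Rintegral_cst// mul0r.
  apply: le_Rintegral => //.
  - by apply: integrableS (iq th pi) => //; exact: subset_itv_oc_cc.
  - have c0 : continuous (fun _ : R => 0 : R) by move=> y; exact: cst_continuous.
    by apply: integrableS (integrable_continuous_itv th pi c0) => //; exact: subset_itv_oc_cc.
  move=> x /=; rewrite in_itv/= => /andP[thx xpi].
  apply: mulr_le0_ge0; last by rewrite exprn_ge0// sin_ge0_pi//; lra.
  rewrite /q hornerD hornerN hornerC subr_le0; apply: chieps.
  rewrite cos_geN1 ltW// ltr_cos ?in_itv/=//; lra.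
apply: le_Rintegral => //; first exact: integrable_continuous_itv.
move=> x /=; rewrite in_itv/= => /andP[x0 xth].
apply: le_trans (sinX_le_half (x := x) _); last by lra.
rewrite ler_piMl//; first by rewrite exprn_ge0// sin_ge0_pi//; lra.
rewrite /q hornerD hornerN hornerC; have := chi1 (cos x); rewrite cos_geN1 cos_le1 => /(_ isT); lra.
Qed.

End TrigIntegral.

(** * Total mass and the measure of a cap *)

Section TrigNormalization.
Context {R : realType}.

Lemma wint1_SS e : wint e.+2 (1 : {poly R}) = wint e (1 - 'X^2).
Proof.
apply: eq_Rintegral => x _.
rewrite hornerD hornerN hornerXn -polyC1 !hornerC mul1r.
by rewrite -(cos2Dsin2 x) addrAC subrr add0r -exprD add2n.
Qed.

(** With [W_e] the total weight, Wallis' recurrence [(e + 2) W_(e+2) = (e + 1) W_e] shows that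
    [(e + 1) W_e] does not decrease in steps of two. *)
Lemma wint1_ge2 e : 2 <= e.+1%:R * wint e (1 : {poly R}).
Proof.
elim/nat_ind2: e => [||e IH _].
- have := pi_ge2 R.
  rewrite mul1r /wint; under eq_Rintegral do rewrite -polyC1 hornerC expr0 mulr1.
  rewrite Rintegral_cst//= lebesgue_measure_itv/= lte_fin pi_gt0/= mul1r subr0.
  by [].
- rewrite /wint; under eq_Rintegral do rewrite -polyC1 hornerC mul1r expr1.
  have dF (x : R) : is_derive x 1 (fun x => - cos x) (sin x).
    by apply: is_derive_eq; rewrite opprK.
  by rewrite (Rintegral_is_derive (pi_gt0 R) (@continuous_sin R) dF) cospi cos0; lra.
- have h1 := wint1_recl (R := R) e.
  have h2 : wint e ('X^2 : {poly R}) = wint e 1 - wint e.+2 1.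
    by rewrite wint1_SS wint_sub opprB addrC subrK.
  have w0 : 0 <= wint e.+2 (1 : {poly R}).
    rewrite -(wint0 (R := R) e.+2); apply: le_wint => t _ /=.
    by rewrite -polyC1 !hornerC.
  apply: le_trans IH _; move: h1; rewrite h2 -wint1_SS.
  rewrite -(natr1 e.+2) -(natr1 e.+1) -(natr1 e) => h1.
  by have := ler0n R e; nra.
Qed.

Variable d' : nat.
Local Notation d := d'.+2.
Variable Y : nat -> seq ('rV[R]_d -> R).
Hypothesis onb : sph_onb Y.

(* both sides kill every Gegenbauer polynomial of positive degree *)
Lemma zint_wint (p : {poly R}) : @zint R d' p * wint d' 1 = wint d' p.
Proof.
elim/(@gegp_span R d isT): p => [|a n p IH].
  by rewrite wint0 zint0 mul0r.
rewrite zintD wintD -IH mulrDl -mulrA; congr (_ * _ + _).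
rewrite zintE (sint_gegp onb _ (north_sphere d'.+1)).
case: n => [|n]; first by rewrite mul1r /gegp gegh0.
by rewrite mul0r wint_gegp.
Qed.

(** The factor [sqrt 2 / 2] is the [sqrt 2] of [wint_cap] divided by the lower bound 2 for [d'.+1]
    times the total weight. *)
Lemma zint_cap (chi : {poly R}) eps (th : R) : 0 < th <= pi / 2 ->
  (forall t, -1 <= t <= 1 -> chi.[t] <= 1) -> 0 <= eps ->
  (forall t, -1 <= t <= cos th -> chi.[t] <= eps) ->
  zint chi (d' := d') <= eps + Num.sqrt 2 / 2 * (2 * sin (th / 2)) ^+ d'.+1.
Proof.
move=> th0 chi1 eps0 chieps; have := wint_cap d' th0 chi1 eps0 chieps.
rewrite -(zint_wint chi); set W := wint _ _; set z := zint _; set S := _ ^+ _.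
have W2 : 2 <= d'.+1%:R * W := wint1_ge2 d'.
have S0 : 0 <= S.
  rewrite exprn_ge0// mulr_ge0//; have pi0 := pi_gt0 R.
  by case/andP: th0 => *; apply: sin_ge0_pi; lra.
have r0 : 0 <= Num.sqrt 2 * S :> R by rewrite mulr_ge0 ?sqrtr_ge0.
move: (d'.+1%:R) W2 => x W2 h.
rewrite -lerBlDl; apply: (@le_trans _ _ (Num.sqrt 2 * S / (x * W))); last first.
  rewrite [leRHS]mulrAC; apply: ler_wpM2l => //.
  by rewrite lef_pV2 ?posrE; lra.
by rewrite ler_pdivlMr; nra.
Qed.

Lemma zint_parts (p : {poly R}) :
  d'.+1%:R * zint ('X * p) (d' := d') = zint ((1 - 'X^2) * p^`()) (d' := d').
Proof.
have W0 : wint d' (1 : {poly R}) != 0.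
  apply/eqP => W0; have := wint1_ge2 d'; rewrite W0 mulr0; lra.
have h1 := zint_wint ('X * p); have h2 := zint_wint ((1 - 'X^2) * p^`()).
have h3 := wint_parts d' p; move: h3; rewrite -h1 -h2 mulrA.
move: (wint d' 1) W0 (zint _) (zint _) => W W0 x y; exact: mulIf.
Qed.

End TrigNormalization.

(** * Positive polynomial kernels as an approximate identity *)

Section ApproximateIdentity.
Context {R : realType} {d' : nat}.
Local Notation d := d'.+2.
Variable Y : nat -> seq ('rV[R]_d -> R).
Hypothesis onb : sph_onb Y.
Local Notation gegp := (@gegp R d).
Local Notation zint := (@zint R d').
Local Notation znorm := (@znorm R d').

Lemma zint_add p q : zint (p + q) = zint p + zint q.
Proof. by rewrite -[p in LHS]scale1r zintD mul1r. Qed.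

Lemma zintZ a p : zint (a *: p) = a * zint p.
Proof. by rewrite -[a *: p]addr0 zintD zint0 addr0. Qed.

Lemma zint_sub p q : zint (p - q) = zint p - zint q.
Proof. by rewrite addrC -scaleN1r zintD mulN1r addrC. Qed.

Lemma le_zint p q : (forall t, -1 <= t <= 1 -> p.[t] <= q.[t]) -> zint p <= zint q.
Proof.
by move=> pq; rewrite -subr_ge0 -zint_sub; apply: zint_ge0 => t /pq; rewrite hornerD hornerN subr_ge0.
Qed.

(* the kernel of degree [m] is [kern m / zint (kern m)] *)
Definition kern m : {poly R} := (1 + 'X) ^+ m.

Lemma kernE m t : (kern m).[t] = (1 + t) ^+ m.
Proof. by rewrite /kern horner_exp hornerD hornerX -polyC1 hornerC. Qed.

Lemma zint_kern_gt0 m : 0 < zint (kern m).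
Proof.
have n1 : sqnorm (north d : 'rV[R]_d) = 1 := north_sphere d'.+1.
rewrite zintE; apply: (@csph_sint_gt0 _ _ _ (north d)).
- exact: csph_poly_dot.
- move=> v vS; rewrite kernE exprn_ge0//.
  by have /andP[] := dot_bound n1 vS; lra.
- exact: north_sphere.
- by rewrite kernE dotvv n1 exprn_gt0.
Qed.

(** Integration by parts with [(1 - t^2) kern' = m (1 - t) kern]. It measures concentration at the
    pole: the mean of [1 - t] under the normalized kernel is [(d - 1) / (m + d - 1)]. *)
Lemma zint_kern_onem m : (m%:R + d'.+1%:R) * zint ((1 - 'X) * kern m) = d'.+1%:R * zint (kern m).
Proof.
have := zint_parts onb (kern m).
have -> : (1 - 'X^2) * (kern m)^`() = m%:R *: ((1 - 'X) * kern m).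
  rewrite /kern deriv_exp derivD derivX -polyC1 derivC add0r mul1r polyC1.
  case: m => [|m]; first by rewrite mulr0n mulr0 scale0r.
  by rewrite [RHS]scaler_nat mulrnAr; congr (_ *+ _); rewrite /= (exprS (1 + 'X)); ring.
have -> : 'X * kern m = kern m - (1 - 'X) * kern m by ring.
rewrite zint_sub zintZ; move: (zint _) (zint _) => x y h.
by rewrite mulrDl -h; ring.
Qed.

(** Near [v] continuity gives [e]; away from [v] the bounded difference is absorbed by a multiple of
    [1 - <v, w>]. Being affine in [<v, w>], the bound can be integrated exactly against a kernel. *)
Lemma csph_modulus (g : 'rV[R]_d -> R) v e : csph g -> sphere d v -> 0 < e ->
  exists2 C, 0 <= C & forall w, sphere d w -> `|g w - g v| <= e + C * (1 - dot v w).
Proof.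
move=> gc vS e0; have [B B0 gB] := csph_bounded gc.
have : \forall w \near within (sphere d) (nbhs v), `|g v - g w| < e.
  have := (@subspace_continuousP _ (sphere d) _ g).1 (csph_within gc) v vS.
  by move/cvgrPdist_lt; apply.
rewrite /prop_near1 /within/= => /nbhs_ballP[r /= r0 rg].
have C0 : 0 <= 2 * B / (r ^+ 2 / 2).
  by apply: divr_ge0; [exact: mulr_ge0|apply: divr_ge0; rewrite ?sqr_ge0].
exists (2 * B / (r ^+ 2 / 2)) => //.
move=> w wS; have dvw : 0 <= 1 - dot v w by have /andP[_] := dot_bound vS wS; lra.
have [bw|nbw] := pselect (ball v r w).
  rewrite distrC (le_trans (ltW (rg w bw wS)))// lerDl; exact: mulr_ge0.
have [i ri] : exists i, r <= `|v ord0 i - w ord0 i|.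
  apply: contrapT => H; apply: nbw; split => // i j; rewrite ord1 /ball/= ltNge.
  by apply/negP => h; apply: H; exists j.
(* On the sphere [|v - w|^2 = 2 (1 - <v, w>)], and one coordinate already differs by at least
   [r]. *)
have rE : r ^+ 2 / 2 <= 1 - dot v w.
  have : r ^+ 2 <= sqnorm (v + (-1) *: w).
    apply: le_trans (sqnorm_coord _ i); rewrite !mxE mulN1r -[leRHS]real_normK ?num_real//.
    by rewrite ler_pXn2r ?nnegrE// ltW.
  rewrite -dotvv dotDl !dotDr !dotZl !dotZr !dotvv (dotC w v) vS wS; lra.
have r20 : 0 < r ^+ 2 / 2 by rewrite divr_gt0 ?exprn_gt0.
have h1 : `|g w - g v| <= 2 * B.
  by rewrite (le_trans (ler_normB _ _))//; have := gB _ wS; have := gB _ vS; lra.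
apply: le_trans h1 _; rewrite -[leLHS]add0r lerD//; first exact: ltW.
rewrite mulrAC ler_pdivlMr// ler_wpM2l//; exact: mulr_ge0.
Qed.

Lemma kern_bound (k0 k1 : {poly R}) (g : 'rV[R]_d -> R) v e C : csph g -> sphere d v ->
  (forall w, sphere d w -> `|g w - g v| <= e + C * (1 - dot v w)) ->
  0 < zint k0 -> (forall t, -1 <= t <= 1 -> 0 <= k0.[t]) ->
  (forall t, k1.[t] = (1 - t) * k0.[t]) ->
  `|g v - smean (fun w => g w * k0.[dot v w]) / zint k0| <= e + C * (zint k1 / zint k0).
Proof.
move=> gc vS gC z0 k0_ge0 k1E.
have kc := csph_poly_dot k0 v.
have k1c := csph_poly_dot k1 v.
have zE : zint k0 = smean (fun w => k0.[dot v w]) by rewrite (sint_poly_dot onb _ vS).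
have z1E : zint k1 = smean (fun w => k1.[dot v w]) by rewrite (sint_poly_dot onb _ vS).
have -> : g v - smean (fun w => g w * k0.[dot v w]) / zint k0 =
    smean (fun w => (g v - g w) * k0.[dot v w]) / zint k0.
  have -> : smean (fun w => (g v - g w) * k0.[dot v w]) =
      g v * zint k0 - smean (fun w => g w * k0.[dot v w]).
    rewrite zE -(sintZ _ kc) -sintB; last exact: csphM.
      by congr smean; apply/funext => w; rewrite mulrBl.
    by apply: csphM => //; exact: csph_cst.
  by rewrite mulrBl mulfK// lt0r_neq0.
rewrite normrM normfV [`|zint _|]gtr0_norm// ler_pdivrMr// mulrDl.
have -> : C * (zint k1 / zint k0) * zint k0 = C * zint k1 by rewrite -mulrA divfK// lt0r_neq0.
have c1 : csph (fun w => e * k0.[dot v w]) by apply: csphM => //; exact: csph_cst.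
have c2 : csph (fun w => C * k1.[dot v w]) by apply: csphM => //; exact: csph_cst.
have -> : e * zint k0 + C * zint k1 = smean (fun w => e * k0.[dot v w] + C * k1.[dot v w]).
  by rewrite (sintD c1 c2) (sintZ e kc) (sintZ C k1c) zE z1E.
have hc := csphD c1 c2.
have pc : csph (fun w => (g v - g w) * k0.[dot v w]).
  by apply: csphM => //; apply: csphD (csph_cst _) (csphN gc).
have pt w : sphere d w -> `|(g v - g w) * k0.[dot v w]| <= e * k0.[dot v w] + C * k1.[dot v w].
  move=> wS; have k0' : 0 <= k0.[dot v w] by apply: k0_ge0; exact: dot_bound.
  rewrite normrM (ger0_norm k0') k1E mulrA -mulrDl.
  by apply: ler_wpM2r => //; rewrite distrC gC.
rewrite ler_norml; apply/andP; split; last first.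
  by apply: le_sint => // w wS; exact: le_trans (ler_norm _) (pt w wS).
rewrite lerNl -(sintN pc); apply: le_sint => //; first exact: csphN.
by move=> w wS; rewrite (le_trans _ (pt w wS))// -normrN ler_norm.
Qed.

Lemma kern_approx (g : 'rV[R]_d -> R) v : csph g -> sphere d v ->
  smean (fun w => g w * (kern m).[dot v w]) / zint (kern m) @[m --> \oo] --> g v.
Proof.
move=> gc vS; apply/cvgrPdist_le => /= e e0.
have e20 : 0 < e / 2 by rewrite divr_gt0.
have [C C0 gC] := csph_modulus gc vS e20.
near=> m.
have z0 := zint_kern_gt0 m; have z1 := zint_kern_onem m.
have m0 : 0 < m%:R + d'.+1%:R :> R by rewrite -natrD ltr0n addnS.
apply: le_trans (kern_bound (k1 := (1 - 'X) * kern m) gc vS gC z0 _ _) _.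
- by move=> t /andP[t1 _]; rewrite kernE exprn_ge0//; lra.
- by move=> t; rewrite hornerM hornerD hornerN hornerX -polyC1 hornerC.
rewrite [leRHS]splitr lerD2l.
have -> : zint ((1 - 'X) * kern m) / zint (kern m) = d'.+1%:R / (m%:R + d'.+1%:R).
  move: z0 z1; move: (zint _) (zint _) => x y y0 h.
  by apply/eqP; rewrite eqr_div ?lt0r_neq0// mulrC h.
rewrite mulrA ler_pdivrMr//.
have : C * d'.+1%:R / (e / 2) <= m%:R by near: m; exact: nbhs_infty_ger.
rewrite ler_pdivrMr// mulrC => h; apply: le_trans h _.
by rewrite mulrC ler_wpM2l ?lerDl// ltW.
Unshelve. all: by end_near. Qed.

(** [t P_(n+1)] is a positive combination of [P_(n+2)] and [P_n], so multiplication by [t] preserves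
    nonnegativity of all Gegenbauer coefficients. Iterated from the constant 1, this covers
    [(1 + t)^m]. *)
Lemma zint_XM_gegp (p : {poly R}) n : (forall k, 0 <= zint (p * gegp k)) ->
  0 <= zint (p * ('X * gegp n)).
Proof.
move=> p0; case: n => [|n].
  have -> : 'X * gegp 0 = gegp 1 by rewrite /gegp gegh0 gegh1 mulr1.
  exact: p0.
have a0 := gega_gt0 (R := R) (d := d) isT n; have b0 := gegb_gt0 (R := R) (d := d) isT n.
have -> : 'X * gegp n.+1 = (@gega R d n)^-1 *: (gegp n.+2 + @gegb R d n *: gegp n).
  by rewrite gegpSS subrK scalerA mulVf ?scale1r// gt_eqF.
rewrite -scalerAr zintZ mulrDr zint_add -scalerAr zintZ.
by apply: mulr_ge0; [rewrite invr_ge0 ltW|apply: addr_ge0 => //; apply: mulr_ge0 => //; exact: ltW].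
Qed.

Lemma zint_kern_gegp_ge0 m n : 0 <= zint (kern m * gegp n).
Proof.
elim: m n => [|m IH] n.
  rewrite /kern expr0 mul1r zintE (sint_gegp onb) ?ler0n//.
  exact: north_sphere.
have -> : kern m.+1 * gegp n = kern m * gegp n + kern m * ('X * gegp n).
  by rewrite /kern exprS; ring.
by rewrite zint_add addr_ge0//; exact: zint_XM_gegp.
Qed.

Definition kcoef m n : R := zint (kern m * gegp n) / zint (kern m).

Lemma kcoef_ge0 m n : 0 <= kcoef m n.
Proof. by rewrite divr_ge0 ?zint_kern_gegp_ge0// ltW// zint_kern_gt0. Qed.

Lemma kcoef_le1 m n : kcoef m n <= 1.
Proof.
rewrite ler_pdivrMr ?zint_kern_gt0// mul1r; apply: le_zint => t t1.
rewrite hornerM ler_piMr//; last by have /andP[] := gegp_bound onb n t1.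
by rewrite kernE exprn_ge0//; lra.
Qed.

(** The approximate identity applied at the pole to the zonal harmonic itself, whose value there is
    [P_n(1) = 1]. *)
Lemma kcoef_cvg n : kcoef m n @[m --> \oo] --> (1 : R).
Proof.
have n1 : sqnorm (north d : 'rV[R]_d) = 1 := north_sphere d'.+1.
have := kern_approx (csph_poly_dot (gegp n) (north d)) n1.
rewrite dotvv n1 gegp1//; apply: cvg_trans; apply: near_eq_cvg; near=> m.
rewrite /kcoef zintE; congr (smean _ / _); apply/funext => w.
by rewrite hornerM mulrC.
Unshelve. all: by end_near. Qed.

(** Every cut-off beyond [N0] is allowed, so that the expansion can be truncated at an index imposed
    by another sum. *)
Lemma gegp_expand (p : {poly R}) : exists N0, forall N, (N0 <= N)%N ->
  p = \sum_(n < N) (zint (p * gegp n) / znorm n) *: gegp n.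
Proof.
elim/(@gegp_span R d isT): p => [|a k p [N0 IH]].
  exists 0%N => N _; rewrite big1// => n _.
  by rewrite mul0r zint0 mul0r scale0r.
exists (maxn N0 k.+1) => N; rewrite geq_max => /andP[N0N kN].
have E n : (zint ((a *: gegp k + p) * gegp n) / znorm n) *: gegp n =
    (a * (if k == n then znorm k else 0) / znorm n) *: gegp n + (zint (p * gegp n) / znorm n) *: gegp n.
  by rewrite mulrDl -scalerAl zintD (zint_gegpM onb) mulrDl scalerDl.
under eq_bigr do rewrite E.
rewrite big_split/= -IH//; congr (_ + _).
rewrite (bigD1 (Ordinal kN))//= eqxx big1 => [|i ik].
  by rewrite addr0 mulfK// gt_eqF// znorm_gt0.
rewrite ifF ?mulr0 ?mul0r ?scale0r//.
by apply/negbTE; rewrite eq_sym; exact: ik.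
Qed.

End ApproximateIdentity.

(** * Polynomial approximation of a step function *)

Lemma bernoulli_le {R : realType} (y : R) N : -1 <= y -> 1 + N%:R * y <= (1 + y) ^+ N.
Proof.
move=> y1; elim: N => [|N IH]; first by rewrite mul0r addr0 expr0.
rewrite exprS; have y0 : 0 <= 1 + y by lra.
apply: le_trans (ler_wpM2l y0 IH); rewrite -(natr1 N).
by have := ler0n R N; have := sqr_ge0 y; rewrite expr2; nra.
Qed.

Lemma cvg_bigsum {R : realType} (r : seq nat) (F : nat -> nat -> R) (l : nat -> R) :
  (forall n, F n m @[m --> \oo] --> l n) ->
  \sum_(n <- r) F n m @[m --> \oo] --> \sum_(n <- r) l n.
Proof.
move=> Fl; elim: r => [|n r IH].
  by under eq_fun do rewrite big_nil; rewrite big_nil; exact: cvg_cst.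
by under eq_fun do rewrite big_cons; rewrite big_cons; exact: cvgD.
Qed.

(* chi = (1 - x^n)^(2^n) with x affine in t, equal to 1/2 midway between c' and c *)
Lemma poly_step {R : realType} (c' c e : R) : 0 <= c' -> c' < c -> c <= 1 -> 0 < e ->
  exists chi : {poly R}, [/\ forall t, -1 <= t <= 1 -> 0 <= chi.[t] <= 1,
    forall t, -1 <= t <= c' -> chi.[t] <= e &
    forall t, c <= t <= 1 -> 1 - e <= chi.[t]].
Proof.
move=> c'0 cc c1 e0.
pose m := (c' + c) / 2; pose b := (2 * (1 + m))^-1.
have mge0 : 0 <= m by rewrite /m; lra.
have cm : c' < m by rewrite /m; lra.
have mc : m < c by rewrite /m; lra.
have m0 : 0 < 1 + m by lra.
have b0 : 0 < b by rewrite invr_gt0; lra.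
have bm : b * (1 + m) = 2^-1 by rewrite /b; field; lra.
pose x t : R := 2^-1 - b * (t - m).
pose dl := b * (c - c') / 2.
have dl0 : 0 < dl by rewrite divr_gt0// mulr_gt0//; lra.
have dl2 : 2 * dl <= 1.
  have : b * (c - c') <= b * (1 + m) by rewrite ler_wpM2l ?ltW// /m; lra.
  by rewrite bm /dl; lra.
(* For [t <= c'], [2 x >= 1 + 2 dl] and [(1 - x^n)^(2^n) <= (1 + x^n)^(-2^n) <= (2 x)^(-n) <= q2^n].
   For [t >= c], [2 x <= q1] and Bernoulli gives a value of at least [1 - (2 x)^n >= 1 - q1^n]. *)
pose q1 := 1 - 2 * dl; pose q2 := (1 + 2 * dl)^-1.
have [n [n1 n2]] : exists n : nat, q1 ^+ n <= e /\ q2 ^+ n <= e.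
  have q1a : 0 <= q1 by rewrite /q1; lra.
  have q1b : q1 < 1 by rewrite /q1; lra.
  have h1 : q1 ^+ n @[n --> \oo] --> (0 : R) by apply: cvg_expr; rewrite ger0_norm.
  have h2 : q2 ^+ n @[n --> \oo] --> (0 : R).
    by apply: cvg_expr; rewrite gtr0_norm ?invr_gt0 ?invf_lt1; lra.
  have : \forall n \near \oo, q1 ^+ n <= e /\ q2 ^+ n <= e.
    near=> n; split.
      near: n; apply: cvgr_le h1 _ _; exact: e0.
    near: n; apply: cvgr_le h2 _ _; exact: e0.
  by move=> /filter_ex[n]; exists n.
pose chi : {poly R} := (1 - (2^-1%:P - b%:P * ('X - m%:P)) ^+ n) ^+ (2 ^ n).
have chiE t : chi.[t] = (1 - x t ^+ n) ^+ (2 ^ n).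
  by rewrite /chi horner_exp hornerD hornerN horner_exp -polyC1
    !(hornerD, hornerN, hornerM, hornerX, hornerC).
have x01 t : -1 <= t <= 1 -> 0 <= x t <= 1.
  move=> /andP[t1 t2]; rewrite /x.
  have h1 : b * (t - m) <= b * (1 + m) by apply: (ler_wpM2l (ltW b0)); lra.
  have h2 : - (b * (1 + m)) <= b * (t - m).
    have : 0 <= b * (1 + t) by apply: mulr_ge0; [exact: ltW|lra].
    by clear -b0; lra.
  by move: h1 h2; rewrite bm => h1 h2; apply/andP; split; lra.
have y01 t : -1 <= t <= 1 -> 0 <= 1 - x t ^+ n <= 1.
  move=> /x01/andP[h1 h2]; have := exprn_ge0 n h1; have := exprn_ile1 n h1 h2.
  by move=> h3 h4; apply/andP; split; lra.
have N2 t : (2 ^ n)%:R * x t ^+ n = (2 * x t) ^+ n by rewrite natrX exprMn.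
exists chi; split => t.
- by move=> /y01/andP[h1 h2]; rewrite chiE exprn_ge0//= exprn_ile1.
- move=> /andP[t1 tc]; have t11 : -1 <= t <= 1 by apply/andP; split; lra.
  have /andP[y0 y1] := y01 t t11; have /andP[x0 x1] := x01 t t11.
  have xdl : 1 + 2 * dl <= 2 * x t.
    have h : b * (t - m) <= b * (c' - m) by apply: (ler_wpM2l (ltW b0)); lra.
    by move: h; rewrite /x /dl /m; lra.
  rewrite chiE; apply: le_trans n2.
  have dl1 : 0 < 1 + 2 * dl by lra.
  rewrite /q2 exprVn -[leRHS]mul1r ler_pdivlMr ?exprn_gt0//.
  apply: (@le_trans _ _ ((1 - x t ^+ n) ^+ (2 ^ n) * (1 + x t ^+ n) ^+ (2 ^ n))).
    apply: ler_wpM2l; first exact: exprn_ge0.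
    have xn0 : 0 <= x t ^+ n by exact: exprn_ge0.
    apply: le_trans (bernoulli_le (2 ^ n) _); last by lra.
    rewrite N2; apply: (@le_trans _ _ ((2 * x t) ^+ n)); last by lra.
    by rewrite lerXn2r ?nnegrE//; lra.
  rewrite -exprMn; apply: exprn_ile1; have xn1 := exprn_ile1 n x0 x1; have xn0 := exprn_ge0 n x0.
    by nra.
  by nra.
- move=> /andP[tc t1]; have t11 : -1 <= t <= 1 by apply/andP; split; lra.
  have /andP[y0 y1] := y01 t t11; have /andP[x0 x1] := x01 t t11.
  have xdl : 2 * x t <= q1.
    have h : b * (c - m) <= b * (t - m) by apply: (ler_wpM2l (ltW b0)); lra.
    by move: h; rewrite /x /q1 /dl /m; lra.
  rewrite chiE; apply: le_trans (bernoulli_le (2 ^ n) _); last by lra.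
  rewrite mulrN N2; apply: (@le_trans _ _ (1 - q1 ^+ n)); first by lra.
  by rewrite lerD2l lerN2 lerXn2r ?nnegrE//; lra.
Unshelve. all: by end_near. Qed.

(** * The zonal functional: coefficient sums and the cap estimate *)

Section ZonalPairing.
Context {R : realType} {d' : nat}.
Local Notation d := d'.+2.
Variable Y : nat -> seq ('rV[R]_d -> R).
Hypothesis onb : sph_onb Y.
Local Notation gegp := (@gegp R d).
Local Notation zint := (@zint R d').
Local Notation znorm := (@znorm R d').
Local Notation kcoef := (@kcoef R d').
Variable f : 'rV[R]_d -> R.
Hypothesis fc : csph f.
Let n1 : sqnorm (north d : 'rV[R]_d) = 1 := north_sphere d'.+1.

Definition zpair (p : {poly R}) : R := smean (fun w => f w * p.[dot (north d) w]).

Lemma csph_zpair p : csph (fun w => f w * p.[dot (north d) w]).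
Proof. by apply: csphM => //; exact: csph_poly_dot. Qed.

Lemma zpairD a p q : zpair (a *: p + q) = a * zpair p + zpair q.
Proof.
rewrite -(sintZ _ (csph_zpair p)) -sintD; last exact: csph_zpair.
  by congr smean; apply/funext => w; rewrite hornerD hornerZ; ring.
by apply: csphM; [exact: csph_cst|exact: csph_zpair].
Qed.

Lemma zpair0 : zpair 0 = 0.
Proof.
rewrite -[RHS](sint_cst (d := d'.+1) 0); congr smean; apply/funext => w.
by rewrite horner0 mulr0.
Qed.

Lemma zpair_add p q : zpair (p + q) = zpair p + zpair q.
Proof. by rewrite -[p in LHS]scale1r zpairD mul1r. Qed.

Lemma zpair_sub p q : zpair (p - q) = zpair p - zpair q.
Proof. by rewrite addrC -scaleN1r zpairD mulN1r addrC. Qed.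

Lemma zpairZ a p : zpair (a *: p) = a * zpair p.
Proof. by rewrite -[a *: p]addr0 zpairD zpair0 addr0. Qed.

Lemma zpair_sum (r : seq nat) (F : nat -> {poly R}) :
  zpair (\sum_(n <- r) F n) = \sum_(n <- r) zpair (F n).
Proof.
elim: r => [|n r IH]; first by rewrite !big_nil zpair0.
by rewrite !big_cons zpair_add IH.
Qed.

(* the value at the pole of the degree [n] part of [f] *)
Definition zc n : R := zpair (gegp n) / znorm n.

Lemma zpair_expand p : exists N0, forall N, (N0 <= N)%N ->
  zpair p = \sum_(0 <= n < N) zint (p * gegp n) * zc n.
Proof.
have [N0 pE] := gegp_expand onb p; exists N0 => N N0N.
rewrite {1}(pE N N0N) -(big_mkord xpredT (fun n => (zint (p * gegp n) / znorm n) *: gegp n)).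
rewrite zpair_sum; apply: eq_big_seq => n _; rewrite zpairZ /zc.
by rewrite mulrAC mulrA.
Qed.

Variables (s : R) (k : nat).
Hypothesis s1 : s = 1 \/ s = -1.
Hypothesis tail0 : forall n, (k <= n)%N -> 0 <= s * zpair (gegp n).
Hypothesis f0 : s * f (north d) <= 0.

Let head := \sum_(0 <= n < k) `|zc n|.

Lemma s_norm x : `|s * x| = `|x|.
Proof. by rewrite normrM; case: s1 => ->; rewrite ?normrN normr1 mul1r. Qed.

Lemma zc_tail n : (k <= n)%N -> s * zc n = `|zc n|.
Proof.
move=> kn; rewrite -(s_norm (zc n)) ger0_norm// /zc mulrA.
by rewrite divr_ge0 ?tail0// ltW// znorm_gt0.
Qed.

(* the kernel average of [s * f] at the pole tends to [s * f eta <= 0], so the tail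
   of the series at the pole is dominated by its head *)
Lemma zc_kern_bound m N : (k <= N)%N ->
  \sum_(k <= n < N) kcoef m n * `|zc n| <=
  s * (zpair (kern m) / zint (kern m)) + head.
Proof.
move=> kN; have [N0 E] := zpair_expand (kern m).
have z0 := @zint_kern_gt0 R d' m.
set M := maxn N0 N; have NM : (N <= M)%N by rewrite leq_maxr.
rewrite (E M (leq_maxl _ _)) mulr_suml mulr_sumr.
have -> : \sum_(0 <= n < M) s * (zint (kern m * gegp n) * zc n / zint (kern m)) =
    \sum_(0 <= n < M) kcoef m n * (s * zc n).
  by apply: eq_bigr => n _; rewrite /Submission.kcoef; move: (zint _) (zint _) => a b; ring.
rewrite (big_cat_nat (leq0n k) (leq_trans kN NM))/= (big_cat_nat kN NM)/=.
have -> : \sum_(k <= n < N) kcoef m n * (s * zc n) = \sum_(k <= n < N) kcoef m n * `|zc n|.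
  by apply: eq_big_nat => n /andP[kn _]; rewrite zc_tail.
have h1 : 0 <= \sum_(N <= n < M) kcoef m n * (s * zc n).
  rewrite big_nat; apply: sumr_ge0 => n /andP[Nn _].
  by rewrite zc_tail ?(leq_trans kN)// mulr_ge0// (kcoef_ge0 onb).
have h2 : - head <= \sum_(0 <= n < k) kcoef m n * (s * zc n).
  rewrite -sumrN; apply: ler_sum => n _.
  rewrite lerNl; apply: (@le_trans _ _ (kcoef m n * `|zc n|)).
    rewrite -(s_norm (zc n)) -(mulrN (kcoef m n)).
    by rewrite ler_wpM2l ?(kcoef_ge0 onb)// -normrN ler_norm.
  by rewrite ler_piMl// (kcoef_le1 onb).
by move: h1 h2; rewrite /head; lra.
Qed.

(** For fixed [N] the sum is finite, so the kernel degree tends to infinity termwise; the right-hand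
    side of [zc_kern_bound] tends to [s * f (north d) + head <= head]. *)
Lemma zc_tail_bound N : (k <= N)%N -> \sum_(k <= n < N) `|zc n| <= head.
Proof.
move=> kN.
have c1 : \sum_(k <= n < N) kcoef m n * `|zc n| @[m --> \oo] --> \sum_(k <= n < N) `|zc n|.
  apply: cvg_bigsum => n; rewrite -[X in _ --> X]mul1r.
  by apply: cvgM; [exact: kcoef_cvg onb n|exact: cvg_cst].
have c2 : s * (zpair (kern m) / zint (kern m)) + head @[m --> \oo] --> s * f (north d) + head.
  apply: cvgD; last exact: cvg_cst.
  by apply: cvgM; [exact: cvg_cst|exact: (kern_approx onb fc (north_sphere d'.+1))].
apply: (@le_trans _ _ (s * f (north d) + head)); last by have := f0; lra.
apply: ler_cvg_to c1 c2 _; near=> m; exact: zc_kern_bound.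
Unshelve. all: by end_near. Qed.

Lemma zc_sum_bound N : \sum_(0 <= n < N) `|zc n| <= 2 * head.
Proof.
have head0 : 0 <= head by apply: sumr_ge0.
have [kN|Nk] := leqP k N.
  by rewrite (big_cat_nat (leq0n k) kN)/=; have := zc_tail_bound kN; rewrite /head; lra.
apply: (@le_trans _ _ head); last lra.
rewrite /head (big_cat_nat (leq0n N) (ltnW Nk))/= lerDl; exact: sumr_ge0.
Qed.

(** As [|P_n| <= 1], each Gegenbauer coefficient of [p] is at most the mean of [|p|]; since [zint]
    acts on polynomials, that mean is replaced by the one of a polynomial majorant [u]. *)
Lemma zpair_bound p u : (forall t, -1 <= t <= 1 -> `|p.[t]| <= u.[t]) ->
  `|zpair p| <= zint u * (2 * head).
Proof.
move=> pu; have [N E] := zpair_expand p; rewrite (E N (leqnn N)).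
apply: le_trans (ler_norm_sum _ _ _) _.
have u0 : 0 <= zint u by apply: zint_ge0 => t /pu; exact: le_trans.
apply: le_trans (ler_wpM2l u0 (zc_sum_bound N)).
rewrite mulr_sumr; apply: ler_sum => n _; rewrite normrM ler_wpM2r//.
have pt t : -1 <= t <= 1 -> `|(p * gegp n).[t]| <= u.[t].
  move=> t1; rewrite hornerM normrM -[leRHS]mulr1 ler_pM ?pu// ler_norml.
  exact: gegp_bound onb _ _ t1.
rewrite ler_norml; apply/andP; split.
  rewrite lerNl -mulN1r -zintZ; apply: le_zint => t t1.
  by rewrite hornerZ mulN1r (le_trans _ (pt t t1))// -normrN ler_norm.
by apply: le_zint => t t1; exact: le_trans (ler_norm _) (pt t t1).
Qed.

Variables (B th th' : R).
Hypothesis fB : forall w, sphere d w -> `|f w| <= B.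
Hypothesis th0 : 0 < th.
Hypothesis thth : th < th'.
Hypothesis th_pi : th' <= pi / 2.
Hypothesis f_cap : forall w, sphere d w -> dot (north d) w <= cos th -> 0 <= f w.
Hypothesis f_mean : zpair 1 <= 0.

Let B0 : 0 <= B. Proof. by apply: le_trans (fB n1). Qed.

(** The gap between [th] and [th'] gives a polynomial room to fall from 1 to 0; it is closed at the
    very end, when [th'] decreases to the radius of [f]. *)
Lemma cap_cutoff e : 0 < e -> exists chi : {poly R},
  [/\ forall t, -1 <= t <= 1 -> 0 <= chi.[t] <= 1,
    forall t, cos th <= t <= 1 -> 1 - e <= chi.[t] &
    zint chi <= e + Num.sqrt 2 / 2 * (2 * sin (th' / 2)) ^+ d'.+1].
Proof.
move=> e0; have pi0 := pi_gt0 R; have t0 := th0; have t1 := thth; have t2 := th_pi.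
have c'0 : 0 <= cos th' by apply: cos_ge0_pihalf; lra.
have cc : cos th' < cos th by rewrite ltr_cos ?in_itv/=//; lra.
have [chi [h1 h2 h3]] := poly_step c'0 cc (cos_le1 _) e0.
exists chi; split => //; apply: (zint_cap onb (chi := chi) (eps := e) (th := th')) => //; last exact: ltW.
- by rewrite th_pi andbT; lra.
- by move=> t /h1/andP[].
Qed.

(** Split [P_m = P_m chi + P_m (1 - chi)]. The first part is bounded by [zint chi * (2 * head)]. In
    the second, [|P_m| <= 1] can be discarded where [f >= 0], and [1 - chi] is small elsewhere; what
    is left, [zpair (1 - chi)], is at most [- zpair chi] because the mean is nonpositive, which
    costs the same bound once more. *)
Lemma zpair_gegp_cap m :
  `|zpair (gegp m)| <= 2 * Num.sqrt 2 * (2 * sin (th' / 2)) ^+ d'.+1 * head.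
Proof.
set V := _ ^+ d'.+1; have B_ge0 := B0.
have head0 : 0 <= head by apply: sumr_ge0.
(* [4 * head + 2 * B] collects the errors proportional to [e]; the [+ 1] keeps the divisor
   positive. *)
suff h e : 0 < e -> `|zpair (gegp m)| <=
    2 * Num.sqrt 2 * V * head + e * (4 * head + 2 * B + 1).
  have K0 : 0 < 4 * head + 2 * B + 1 by lra.
  apply/ler_addgt0Pr => e e0; apply: le_trans (h (e / (4 * head + 2 * B + 1)) _) _.
    exact: divr_gt0.
  by rewrite divfK// gt_eqF.
move=> e0; have [chi [chi01 chi1 chiV]] := cap_cutoff e0.
have zb : `|zpair chi| <= zint chi * (2 * head).
  by apply: zpair_bound => t /chi01/andP[h _]; rewrite ger0_norm.
have zgb : `|zpair (gegp m * chi)| <= zint chi * (2 * head).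
  apply: zpair_bound => t t1; have /andP[h _] := chi01 t t1.
  rewrite hornerM normrM (ger0_norm h) ler_piMl// ler_norml.
  exact: gegp_bound onb _ _ t1.
(* Used with [r = 1] and [r = -1], the two halves of an absolute value. The two terms [B * e] pay
   for the possible negativity of [f] inside the cap, once on each side. *)
have rest r : `|r| <= 1 -> r * zpair (gegp m * (1 - chi)) <= zpair (1 - chi) + 2 * B * e.
  move=> r1; rewrite -zpairZ -(sint_cst (d := d'.+1) (2 * B * e)).
  rewrite -sintD; [|exact: csph_zpair|exact: csph_cst].
  apply: le_sint; first exact: csph_zpair.
    by apply: csphD (csph_zpair _) (csph_cst _).
  move=> w wS; set t := dot _ _; have t1 : -1 <= t <= 1 by exact: dot_bound.
  have /andP[x0 x1] := chi01 t t1.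
  have g1 : `|r * (gegp m).[t]| <= 1.
    by rewrite normrM mulr_ile1// ler_norml; exact: gegp_bound onb _ _ t1.
  rewrite hornerZ hornerM hornerD hornerN -polyC1 hornerC mulrA.
  move: g1; rewrite ler_norml => /andP[g1 g2].
  have [tc|tc] := leP t (cos th).
    have fw := f_cap wS tc.
    have : f w * (1 - chi.[t]) * (r * (gegp m).[t]) <= f w * (1 - chi.[t]) * 1.
      by apply: ler_wpM2l => //; rewrite mulr_ge0//; lra.
    have : 0 <= 2 * B * e by apply: mulr_ge0; [exact: mulr_ge0|exact: ltW].
    move: (gegp m).[t] => G; lra.
  have x2 : 1 - e <= chi.[t] by apply: chi1; rewrite (ltW tc) /=; case/andP: t1.
  have fb := fB wS.
  have b1 : `|f w * (1 - chi.[t])| <= B * e.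
    by rewrite normrM ler_pM// ger0_norm; lra.
  have b2 : `|f w * (1 - chi.[t]) * (r * (gegp m).[t])| <= B * e.
    by rewrite normrM -[leRHS]mulr1 ler_pM// ler_norml g1 g2.
  move: b1 b2; rewrite !ler_norml => /andP[b1 b1'] /andP[b2 b2'].
  move: b1 b2'; move: (gegp m).[t] => G; lra.
have zs : zpair (1 - chi) <= zint chi * (2 * head).
  rewrite zpair_sub; move: zb; rewrite ler_norml => /andP[zb _]; have fm := f_mean; lra.
have split1 : zpair (gegp m) = zpair (gegp m * chi) + zpair (gegp m * (1 - chi)).
  by rewrite -zpair_add -mulrDr addrC subrK mulr1.
have key : `|zpair (gegp m)| <= 2 * (zint chi * (2 * head)) + 2 * B * e.
  have r1 : `|1 : R| <= 1 by rewrite normr1.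
  have r2 : `|-1 : R| <= 1 by rewrite normrN normr1.
  have := rest 1 r1; have := rest (-1) r2; rewrite split1 mul1r mulN1r.
  move: zgb; rewrite !ler_norml => /andP[a1 a2] a3 a4; apply/andP; split; move: a1 a2 a3 a4 zs; lra.
apply: le_trans key _.
have : zint chi * head <= (e + Num.sqrt 2 / 2 * V) * head by rewrite ler_wpM2r.
by move: e0; lra.
Qed.

Lemma zc_head_cap : head = 0 \/
  1 <= 2 * Num.sqrt 2 * (2 * sin (th' / 2)) ^+ d'.+1 * \sum_(0 <= n < k) (znorm n)^-1.
Proof.
have [->|headn] := eqVneq head 0; [by left|right].
have head0 : 0 < head by rewrite lt_neqAle eq_sym headn; apply: sumr_ge0.
rewrite mulr_sumr -(ler_pM2r head0) mul1r mulr_suml {1}/head.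
apply: ler_sum => n _; rewrite /zc normrM normfV (gtr0_norm (znorm_gt0 n)).
rewrite mulrAC; apply: ler_wpM2r; first by rewrite invr_ge0 ltW// znorm_gt0.
exact: zpair_gegp_cap.
Qed.

End ZonalPairing.

(** * Dimensions of the spaces of harmonics *)

Section DimensionBound.
Context {R : realType} {d' : nat}.
Local Notation znorm := (@znorm R d').

(** The classical formula [h_n = (2 n + d - 2) / (n + d - 2) * 'C(n + d - 2, d - 2)] without
    division. It starts at degree 1, since for [d = 2] the fraction degenerates at degree 0. *)
Lemma znorm_bin n : (n.+1 + d')%:R = (2 * n.+1%:R + d'%:R) * 'C(n.+1 + d', d')%:R * znorm n.+1.
Proof.
have D0 : 0 <= d'%:R :> R by exact: ler0n.
elim: n => [|n IH].
  rewrite /= add1n binSn !mul1r -addn2 !natrD -!natr1 mulr0 add0r.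
  by field; lra.
have n0 : 0 <= n%:R :> R by exact: ler0n.
have bin : n.+2%:R * 'C(n.+2 + d', d')%:R = (n.+2 + d')%:R * 'C(n.+1 + d', d')%:R :> R.
  rewrite -!natrM; congr (_%:R).
  by have := mul_bin_down (n.+2 + d') d'; rewrite addnK.
rewrite [znorm n.+2]/= -/(znorm n.+1).
set z := znorm n.+1; set b := 'C(n.+2 + _, _)%:R in bin *.
have -> : (2 * n.+2%:R + d'%:R) * b * (z * n.+2%:R * gega d'.+2 n / (2 * n.+1%:R + d'.+2%:R)) =
  (n.+2%:R * b) * z * gega d'.+2 n :> R.
  by rewrite -!natr1; field; lra.
rewrite bin; move: IH; rewrite -/z; set b' := 'C(_, _)%:R => IH.
have -> : (n.+2 + d')%:R * b' * z * gega d'.+2 n =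
  (n.+2 + d')%:R * ((2 * n.+1%:R + d'%:R) * b' * z) / (n.+1 + d')%:R :> R.
  by rewrite /gega !natrD -!natr1; field; lra.
by rewrite -IH !natrD -!natr1; field; lra.
Qed.

Lemma znormV_le n : (znorm n)^-1 <= 2 * 'C(n + d', d')%:R.
Proof.
case: n => [|n]; first by rewrite /= invr1 add0n binn; lra.
have := @znorm_gt0 R d' n.+1; have := znorm_bin n.
move: (znorm n.+1) => z E z0; rewrite -(ler_pM2r z0) mulVf ?gt_eqF//.
have D0 : 0 < (n.+1 + d')%:R :> R by rewrite ltr0n.
rewrite -(ler_pM2l D0) mulr1 {1}E.
rewrite [leRHS]mulrA; apply: ler_wpM2r; first exact: ltW.
rewrite mulrA; apply: ler_wpM2r; first exact: ler0n.
by rewrite natrD; have := ler0n R d'; lra.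
Qed.

(** The binomial is the product of the factors [(k + i) / (i + 1)] for [i <= e], each at most [k]
    once [k >= 1]. *)
Lemma bin_le_expn k e : ('C(k + e, e.+1) <= k ^ e.+1)%N.
Proof.
elim: e => [|e IH]; first by rewrite addn0 bin1 expn1.
rewrite -(leq_pmul2l (ltn0Sn e.+1)).
have -> : (e.+2 * 'C(k + e.+1, e.+2) = (k + e.+1) * 'C(k + e, e.+1))%N.
  by rewrite -mul_bin_diag addnS.
apply: leq_trans (leq_mul (leqnn _) IH) _; rewrite [(k ^ e.+2)%N]expnS mulnA leq_mul2r.
case: k {IH} => [|k]; first by rewrite exp0n.
by apply/orP; right; rewrite addSnnS mulSn -addSnnS leq_add2l leq_pmulr.
Qed.

Lemma sum_znormV k : \sum_(0 <= n < k) (znorm n)^-1 <= 2 * k%:R ^+ d'.+1.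
Proof.
apply: (@le_trans _ _ (2 * 'C(k + d', d'.+1)%:R)).
  elim: k => [|k IH]; first by rewrite big_geq// mulr_ge0.
  rewrite big_nat_recr//= addSn binS natrD mulrDr.
  by apply: lerD => //; exact: znormV_le.
by rewrite -natrX ler_pM2l// ler_nat bin_le_expn.
Qed.

End DimensionBound.

(** * Upper bounds for Gamma and the explicit constant *)

Section GammaBound.
Context {R : realType}.
Notation mu := (@lebesgue_measure R).

(** The primitive of [t^n e^(-t)] that tends to 0 at infinity, built by repeated integration by
    parts. *)
Fixpoint gammaF n (t : R) : R :=
  if n is m.+1 then n%:R * gammaF m t - t ^+ n * expR (- t) else - expR (- t).

Lemma gammaF0 n : gammaF n 0 = - n`!%:R.
Proof.
elim: n => [|n IH]; first by rewrite /= oppr0 expR0.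
by rewrite /= IH expr0n/= mul0r subr0 factS natrM mulrN.
Qed.

Lemma is_derive_gammaF n (t : R) : is_derive t 1 (gammaF n) (t ^+ n * expR (- t)).
Proof.
have dE : is_derive t 1 (fun t : R => expR (- t)) (- expR (- t)).
  by apply: is_derive_eq; rewrite /GRing.scale/=; ring.
elim: n => [|n IH].
  by rewrite /=; apply: is_derive_eq; ring.
have dX : is_derive t 1 (fun t : R => t ^+ n.+1) (n.+1%:R * t ^+ n).
  have := is_deriveX n.+1 (is_derive_id t (1 : R)).
  rewrite {1}/GRing.scale/= mulr1; congr (is_derive t 1 _ _).
  by apply/funext => y; rewrite exprfctE.
rewrite [gammaF n.+1]/=.
by apply: is_derive_eq; rewrite /GRing.scale/= exprS; ring.
Qed.

Lemma cvg_expn_expR n : t ^+ n * expR (- t) @[t --> +oo%R] --> (0 : R).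
Proof.
apply: (@squeeze_cvgr _ _ _ _ (fun=> 0) (fun t => n.+1`!%:R * t^-1)).
- near=> t; have t0 : 0 < t by near: t; exact: nbhs_pinfty_gt.
  apply/andP; split; first by rewrite mulr_ge0// ?exprn_ge0 ?expR_ge0// ltW.
  rewrite expRN ler_pdivrMr ?expR_gt0// mulrAC ler_pdivlMr// -exprSr mulrC.
  rewrite -ler_pdivrMr ?ltr0n ?fact_gt0//.
  by apply: le_trans (expR_ge1Dxn n (ltW t0)); rewrite lerDr.
- exact: cvg_cst.
- rewrite -[X in _ --> X](mulr0 n.+1`!%:R); apply: cvgM; first exact: cvg_cst.
  by apply/gtr0_cvgV0 => //; exact: nbhs_pinfty_gt.
Unshelve. all: by end_near. Qed.

Lemma gammaF_cvg n : gammaF n t @[t --> +oo%R] --> (0 : R).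
Proof.
elim: n => [|n IH] /=.
  by rewrite -oppr0; apply: cvgN; exact: cvgr_expR.
rewrite -(subr0 0) -[X in X - _](mulr0 n.+1%:R); apply: cvgB (cvg_expn_expR _).
by apply: cvgM => //; exact: cvg_cst.
Qed.

(** A polynomial majorant of [t^(x - 1)] makes the integral elementary; two consecutive degrees
    suffice for half-integral [x]. The same majorant gives the finiteness that [fine] requires. *)
Lemma Gamma_le_fact (x a b : R) n : 0 <= a -> 0 <= b ->
  (forall t, 0 < t -> t `^ (x - 1) <= a * t ^+ n + b * t ^+ n.+1) ->
  Gamma x <= a * n`!%:R + b * n.+1`!%:R.
Proof.
move=> a0 b0 xab.
pose u t : R := a * (t ^+ n * expR (- t)) + b * (t ^+ n.+1 * expR (- t)).
pose F t : R := a * gammaF n t + b * gammaF n.+1 t.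
have dF (t : R) : is_derive t 1 F (u t).
  have d1 := is_derive_gammaF n t; have d2 := is_derive_gammaF n.+1 t.
  by rewrite /F /u; apply: is_derive_eq; rewrite /GRing.scale/=; ring.
have u0 t : 0 <= t -> 0 <= u t.
  by move=> t0; rewrite addr_ge0// mulr_ge0// mulr_ge0// ?expR_ge0// exprn_ge0.
have cu : continuous u.
  move=> t; apply: cvgD; (apply: cvgM; first exact: cvg_cst);
    (apply: cvgM; first exact: exprn_continuous);
    (apply: continuous_comp; [exact: opp_continuous|exact: continuous_expR]).
have mu_u : measurable_fun (`]0, +oo[%classic : set R) (fun t : R => (u t)%:E).
  by apply/measurable_EFinP/measurable_funTS; exact: continuous_measurable_fun.
have FTC : (\int[mu]_(t in `[0%R, +oo[) (u t)%:E = 0%:E - (F 0)%:E)%E.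
  apply: ge0_continuous_FTC2y => //.
  - exact: continuous_subspaceT.
  - rewrite -(addr0 0) -[X in X + _](mulr0 a) -[X in _ + X](mulr0 b).
    by apply: cvgD; (apply: cvgM; [exact: cvg_cst|exact: gammaF_cvg]).
  - apply: cvg_at_right_filter; apply: differentiable_continuous.
    by apply/derivable1_diffP; have := dF 0; case.
  - by move=> t _; rewrite derive1E; exact: derive_val.
have F0 : (0%:E - (F 0)%:E)%E = (a * n`!%:R + b * n.+1`!%:R)%:E.
  by rewrite /F !gammaF0 -EFinB; congr (_%:E); ring.
rewrite F0 in FTC.
set V := _ + _ in FTC *.
pose I := (\int[mu]_(t in `]0%R, +oo[) (t `^ (x - 1) * expR (- t))%:E)%E.
have I0 : (0 <= I)%E.
  by apply: integral_ge0 => t _; rewrite lee_fin mulr_ge0 ?powR_ge0 ?expR_ge0.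
have IV : (I <= V%:E)%E.
  rewrite -FTC -integral_itv_obnd_cbnd; last first.
    exact: mu_u.
  apply: ge0_le_integral => //=.
  - by move=> t _; rewrite lee_fin mulr_ge0 ?powR_ge0 ?expR_ge0.
  - apply/measurable_EFinP/measurable_funTS/measurable_funM.
      exact: measurable_powR.
    by apply: measurableT_comp => //; exact: measurable_expR.
  - move=> t; rewrite in_itv/= andbT => t0; rewrite lee_fin /u !mulrA -mulrDl.
    by rewrite ler_wpM2r ?expR_ge0// xab.
have -> : Gamma x = fine I by [].
have If : I \is a fin_num by rewrite ge0_fin_numE// (le_lt_trans IV)// ltry.
by rewrite -lee_fin fineK.
Qed.

Lemma Gamma_ge0 (x : R) : 0 <= Gamma x.
Proof.
by apply: fine_ge0; apply: integral_ge0 => t _;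
  rewrite lee_fin mulr_ge0 ?powR_ge0 ?expR_ge0.
Qed.

(** Log-convexity of Gamma between consecutive integers: for odd [e] the argument lies midway
    between two integers, for even [e] it is an integer. *)
Lemma Gamma_half_le e : Gamma ((e%:R + 2) / 2 : R) ^+ 2 <= (e./2`! * (uphalf e)`!)%:R.
Proof.
rewrite -[in X in Gamma X](odd_double_half e) uphalf_half.
move: (odd e) (e./2) => [] n; rewrite -mul2n natrD natrM.
- set g := Gamma _; have n0 : 0 < n.+1%:R :> R by rewrite ltr0n.
  (* Chosen so that the two terms [c n! / 2] and [(n + 1)! / (2 c)] of the bound coincide. *)
  pose c : R := Num.sqrt n.+1%:R.
  have c0 : 0 < c by rewrite sqrtr_gt0.
  have c2 : c ^+ 2 = n.+1%:R by rewrite sqr_sqrtr// ltW.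
  have gc : g <= c / 2 * n`!%:R + c^-1 / 2 * n.+1`!%:R.
    (* AM-GM: [sqrt t <= (c + t / c) / 2] *)
    apply: Gamma_le_fact => [||t t0]; [by rewrite mulr_ge0// ltW|by rewrite mulr_ge0// invr_ge0 ltW|].
    have -> : (1%N%:R + 2 * n%:R + 2) / 2 - 1 = n%:R + 2^-1 :> R by field.
    rewrite powRD ?gt_eqF ?implybT// powR_mulrn ?(ltW t0)// powR12_sqrt ?(ltW t0)//.
    set q := Num.sqrt t; have q2 : q ^+ 2 = t by rewrite sqr_sqrtr// ltW.
    have -> : c / 2 * t ^+ n + c^-1 / 2 * t ^+ n.+1 = t ^+ n * (c / 2 + q ^+ 2 / c / 2).
      by rewrite q2 exprSr; field; rewrite gt_eqF.
    apply: ler_wpM2l; first by rewrite exprn_ge0// ltW.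
    rewrite -subr_ge0.
    have -> : c / 2 + q ^+ 2 / c / 2 - q = (c - q) ^+ 2 / c / 2.
      by field; rewrite gt_eqF.
    by rewrite !divr_ge0// ?sqr_ge0// ltW.
  have E : c / 2 * n`!%:R + c^-1 / 2 * n.+1`!%:R = c * n`!%:R.
    by rewrite factS natrM -c2; field; rewrite gt_eqF.
  rewrite E in gc.
  apply: (@le_trans _ _ ((c * n`!%:R) ^+ 2)); first by rewrite lerXn2r ?nnegrE ?Gamma_ge0// mulr_ge0// ltW.
  by rewrite exprMn c2 add1n factS !natrM expr2 mulrCA.
- have g1 : Gamma ((0%N%:R + 2 * n%:R + 2) / 2 : R) <= n`!%:R.
    apply: (@le_trans _ _ (1 * n`!%:R + 0 * n.+1`!%:R)); last by rewrite mul1r mul0r addr0.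
    apply: Gamma_le_fact => // t t0.
    have -> : (0%N%:R + 2 * n%:R + 2) / 2 - 1 = n%:R :> R by field.
    by rewrite powR_mulrn ?(ltW t0)// mul1r mul0r addr0.
  by rewrite add0n natrM -expr2 lerXn2r ?nnegrE ?Gamma_ge0.
Qed.

(** A crude Stirling bound, shaped for [lower_const_expn]. In steps of two the left side grows by at
    most [((e + 2) / 2)^4], by AM-GM; the right side grows by more, since [(1 + 4 / e)^e >= 5] by
    Bernoulli where a factor 4 is enough. *)
Lemma fact_half_le e : (0 < e)%N ->
  (e./2`! * (uphalf e)`!)%:R ^+ 2 <= 8 * (e%:R * (e%:R + 2) / 8) ^+ e :> R.
Proof.
elim/nat_ind2: e => [||e IH _] //; first by rewrite /= expr1n expr1; lra.
have [->|e0] := posnP e; first by rewrite /= expr1n expr2; lra.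
have er : 0 < e%:R :> R by rewrite ltr0n.
have h1 : (e.+2./2`! * (uphalf e.+2)`!)%:R <=
    ((e%:R + 2) / 2) ^+ 2 * (e./2`! * (uphalf e)`!)%:R :> R.
  rewrite /= !factS mulnACA natrM; apply: ler_wpM2r; first exact: ler0n.
  have e2 : e%:R = e./2%:R + (uphalf e)%:R :> R.
    by rewrite -natrD uphalf_half addnCA addnn odd_double_half.
  rewrite natrM -[e./2.+1%:R]natr1 -[(uphalf e).+1%:R]natr1 e2; move: (e./2%:R : R) ((uphalf e)%:R : R) => a b.
  rewrite -subr_ge0.
  have -> : ((a + b + 2) / 2) ^+ 2 - (a + 1) * (b + 1) = ((a - b) / 2) ^+ 2 by field.
  exact: sqr_ge0.
have h2 : (e.+2./2`! * (uphalf e.+2)`!)%:R ^+ 2 <=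
    ((e%:R + 2) / 2) ^+ 4 * (8 * (e%:R * (e%:R + 2) / 8) ^+ e) :> R.
  apply: le_trans (_ : _ <= (((e%:R + 2) / 2) ^+ 2 * (e./2`! * (uphalf e)`!)%:R) ^+ 2) _.
    by rewrite lerXn2r ?nnegrE// mulr_ge0// sqr_ge0.
  rewrite exprMn -exprM; apply: ler_wpM2l; last exact: IH.
  by rewrite exprn_ge0// divr_ge0//; lra.
move=> _; apply: le_trans h2 _.
have h3 : 5 * e%:R ^+ e <= (e%:R + 4) ^+ e :> R.
  have -> : (e%:R + 4) ^+ e = e%:R ^+ e * (1 + 4 / e%:R) ^+ e :> R.
    by rewrite -exprMn; congr (_ ^+ e); field; rewrite gt_eqF.
  rewrite mulrC; apply: ler_wpM2l; first by rewrite exprn_ge0 ?ltW.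
  have /(bernoulli_le e) : -1 <= 4 / e%:R :> R by rewrite (@le_trans _ _ 0)// ?divr_ge0// ?ltW//; lra.
  by rewrite mulrC divfK ?gt_eqF//; lra.
have -> : e.+2%:R = e%:R + 2 :> R by rewrite -addn2 natrD.
have p0 : 0 <= (e%:R + 2) ^+ e / 8 ^+ e :> R by rewrite divr_ge0 ?exprn_ge0//; lra.
have -> : 8 * ((e%:R + 2) * (e%:R + 2 + 2) / 8) ^+ e.+2 =
  ((e%:R + 2) ^+ e / 8 ^+ e) * ((e%:R + 2) ^+ 2 * (e%:R + 4) ^+ 2 * (e%:R + 4) ^+ e / 8) :> R.
  have -> : (e%:R + 2) * (e%:R + 2 + 2) / 8 = (e%:R + 2) * (e%:R + 4) / 8 :> R by ring.
  rewrite 2!exprS !exprMn exprVn; move: ((e%:R + 4) ^+ e) ((e%:R + 2) ^+ e) ((8 ^+ e)^-1) => x y z.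
  by field.
have -> : ((e%:R + 2) / 2) ^+ 4 * (8 * (e%:R * (e%:R + 2) / 8) ^+ e) =
  ((e%:R + 2) ^+ e / 8 ^+ e) * ((e%:R + 2) ^+ 4 * e%:R ^+ e / 2) :> R.
  rewrite !exprMn !exprVn; move: (e%:R ^+ e : R) ((e%:R + 2) ^+ e) ((8 ^+ e)^-1) => x y z.
  by field.
apply: ler_wpM2l => //.
have x0 : 0 <= e%:R ^+ e :> R by rewrite exprn_ge0 ?ltW.
have k1 : (e%:R + 2) ^+ 2 <= (e%:R + 4) ^+ 2 :> R by rewrite lerXn2r ?nnegrE//; lra.
have k2 : 4 * e%:R ^+ e <= (e%:R + 4) ^+ e :> R by lra.
have k3 := ler_wpM2l (sqr_ge0 (e%:R + 2)) (ler_pM (sqr_ge0 _) (mulr_ge0 (ler0n R 4) x0) k1 k2).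
rewrite (exprM _ 2 2); move: k3.
move: ((e%:R + 2) ^+ 2) ((e%:R + 4) ^+ 2) (e%:R ^+ e) ((e%:R + 4) ^+ e) => p q x y.
by rewrite expr2; lra.
Qed.

(** The power [m = d - 1] removes the fractional exponents. With [w = sqrt (d^2 - 1)] and
    [expR (1 / 12) >= 1] it remains to see [(2 sqrt 2 / w)^m G^2 <= 2 sqrt 2]; squared, this is
    [G^4 <= 8 (m (m + 2) / 8)^m], the combination of the two preceding lemmas. *)
Lemma lower_const_expn e :
  4 * Num.sqrt 2 * (Num.sqrt 2 * lower_const e.+2) ^+ e.+1 <= 1 :> R.
Proof.
have s0 := sqrtr_ge0 (2 : R).
have s2 : Num.sqrt 2 ^+ 2 = 2 :> R by rewrite sqr_sqrtr.
set m := e.+1; have er : 0 < m%:R :> R by rewrite ltr0n.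
have dm : e.+2%:R = m%:R + 1 :> R by rewrite natr1.
pose G := Gamma ((m%:R + 2) / 2 : R).
have G0 : 0 <= G by exact: Gamma_ge0.
have G4 : G ^+ 4 <= 8 * (m%:R * (m%:R + 2) / 8) ^+ m.
  apply: le_trans (fact_half_le (ltn0Sn e)).
  by rewrite (exprM G 2 2) lerXn2r ?nnegrE ?sqr_ge0// Gamma_half_le.
have root (a : R) : 0 <= a -> (a `^ (2 / m%:R)) ^+ m = a ^+ 2.
  move=> a0; rewrite -powR_mulrn ?powR_ge0// -powRrM divfK ?gt_eqF//.
  by rewrite powR_mulrn.
have rE : lower_const e.+2 ^+ m =
    2 ^+ m * G ^+ 2 / ((4 * expR (1 / 12)) ^+ 2 * Num.sqrt (m%:R * (m%:R + 2)) ^+ m) :> R.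
  rewrite /lower_const dm addrK.
  have -> : m%:R + 1 + 1 = m%:R + 2 :> R by ring.
  have -> : (m%:R + 1) ^+ 2 - 1 = m%:R * (m%:R + 2) :> R by ring.
  rewrite exprMn exprVn ![(_ * _) ^+ m]exprMn !root// mulr_ge0 ?expR_ge0.
set w := Num.sqrt (m%:R * (m%:R + 2)) in rE.
have w2 : w ^+ 2 = m%:R * (m%:R + 2) by rewrite sqr_sqrtr// mulr_ge0//; lra.
have w0 : 0 < w by rewrite sqrtr_gt0 mulr_gt0//; lra.
have e1 : 1 <= expR (1 / 12) :> R by rewrite -[X in X <= _]expR0 ler_expR divr_ge0.
rewrite exprMn rE.
have wm0 : 0 < w ^+ m by rewrite exprn_gt0.
have h : (Num.sqrt 2 * 2 / w) ^+ m * G ^+ 2 <= 2 * Num.sqrt 2.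
  rewrite -(ler_pXn2r (n := 2))// ?nnegrE; last 2 first.
    by rewrite mulr_ge0 ?sqr_ge0// exprn_ge0// divr_ge0// ?ltW// mulr_ge0.
    by rewrite mulr_ge0.
  rewrite !exprMn -!exprM s2 ![(m * 2)%N]mulnC !exprM s2 exprVn w2.
  have q0 : 0 < m%:R * (m%:R + 2) :> R by rewrite -w2 exprn_gt0.
  rewrite exprVn.
  have -> : 2 ^+ m * (2 ^+ 2) ^+ m * ((m%:R * (m%:R + 2)) ^+ m)^-1 = ((m%:R * (m%:R + 2) / 8) ^+ m)^-1 :> R.
    by rewrite -exprVn -exprMn -exprMn -exprVn; congr (_ ^+ m); field; rewrite gt_eqF//; lra.
  rewrite ler_pdivrMl ?exprn_gt0 ?divr_gt0//.
  by rewrite -expr2 -exprM; apply: le_trans G4 _; rewrite mulrC; lra.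
set E := expR _ in e1 *.
have -> : 4 * Num.sqrt 2 * (Num.sqrt 2 ^+ m * (2 ^+ m * G ^+ 2 / ((4 * E) ^+ 2 * w ^+ m))) =
  (Num.sqrt 2 / 4) * ((Num.sqrt 2 * 2 / w) ^+ m * G ^+ 2) / E ^+ 2 :> R.
  rewrite !exprMn exprVn; move: (w ^+ m) wm0 (2 ^+ m) (Num.sqrt 2 ^+ m) => W W0 x y.
  by field; rewrite !gt_eqF//; lra.
rewrite ler_pdivrMr ?exprn_gt0//; last by lra.
rewrite mul1r; apply: (@le_trans _ _ 1); last by rewrite exprn_ege1.
have := ler_wpM2l (divr_ge0 s0 (ler0n R 4)) h.
have -> : Num.sqrt 2 / 4 * (2 * Num.sqrt 2) = Num.sqrt 2 ^+ 2 / 2 :> R by field.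
by rewrite s2 divff.
Qed.

End GammaBound.

(** * Finite harmonic expansions and their zeros *)

Lemma csph_norm {R : realType} {d : nat} (g : 'rV[R]_d.+1 -> R) : csph g -> csph (fun v => `|g v|).
Proof. by move=> [gc]; constructor => x; apply: cvg_norm; exact: gc. Qed.

Section Homogeneous.
Context {R : realType} {d : nat}.

Lemma homog_pevalZ n (q : mpoly d R) a v : homog n q -> peval q (a *: v) = a ^+ n * peval q v.
Proof.
move=> /allP hq; rewrite /peval !mevalE mulr_sumr; apply: eq_big_seq => m mq.
have /eqP <- : mdeg m == n by exact: hq.
rewrite mulrCA; congr (_ * _); rewrite mdegE -prodrXr -big_split/=.
by apply: eq_bigr => i _; rewrite mxE exprMn.
Qed.

Lemma peval_curve (q : mpoly d R) (c : 'I_d -> {poly R}) :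
  exists A : {poly R}, forall u, A.[u] = peval q (\row_i (c i).[u]).
Proof.
exists (\sum_(m <- msupp q) (mcoeff m q)%:P * \prod_i (c i) ^+ (m i)) => u.
rewrite /peval mevalE horner_sum; apply: eq_bigr => m _.
rewrite hornerM hornerC horner_prod; congr (_ * _).
by apply: eq_bigr => i _; rewrite horner_exp mxE.
Qed.

Lemma poly_eq0_ge1 (h : {poly R}) (a : R) : (forall u, a <= u -> h.[u] = 0) -> h = 0.
Proof.
move=> h0; apply: (@roots_geq_poly_eq0 _ h [seq a + i%:R | i <- iota 0 (size h)]).
- by apply/allP => x /mapP[i _ ->]; rewrite /root h0// lerDl.
- rewrite map_inj_uniq ?iota_uniq// => i j /addrI /eqP.
  by rewrite eqr_nat => /eqP.
- by rewrite size_map size_iota.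
Qed.

End Homogeneous.

Section SphericalHarmonics.
Context {R : realType} {d' : nat}.
Local Notation d := d'.+2.
Variable Y : nat -> seq ('rV[R]_d -> R).
Hypothesis onb : sph_onb Y.
Local Notation gegp := (@gegp R d).
Local Notation znorm := (@znorm R d').
Local Notation zint := (@zint R d').
Variable f : 'rV[R]_d -> R.
Hypothesis fc : csph f.
Local Notation fc_ n j := (smean (fun w => f w * Yf Y n j w)).

Definition hproj n (v : 'rV[R]_d) : R := \sum_(j < size (Y n)) fc_ n j * Yf Y n j v.

Lemma smean_gegp_hproj u n : sqnorm u = 1 ->
  smean (fun w => f w * (gegp n).[dot u w]) = znorm n * hproj n u.
Proof.
move=> u1; rewrite (sint_sph_harm_coef onb (sph_harm_zonal n u1) fc) mulr_sumr.
apply: eq_bigr => j _; rewrite (sint_gegp_harm onb u1 (sph_harm_Yf onb (ltn_ord j))).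
by rewrite mulrA mulrC -mulrA mulrCA; ring.
Qed.

Lemma zpair_gegp n : zpair f (gegp n) = znorm n * hproj n (north d).
Proof. exact: smean_gegp_hproj (north_sphere d'.+1). Qed.

Lemma hproj_peval n : exists2 q : mpoly d R, homog n q &
  forall v, sphere d v -> hproj n v = peval q v.
Proof.
have /(_ _)/cid P (j : 'I_(size (Y n))) : exists q : mpoly d R, homog n q /\
    forall v, sphere d v -> Yf Y n j v = peval q v.
  by have [q [q1 _ q2]] := sph_harm_Yf onb (ltn_ord j); exists q.
exists (\sum_(j < size (Y n)) fc_ n j *: projT1 (P j)).
  by apply: homog_sum => j; apply: homogZ; case: (P j) => q [].
move=> v vS; rewrite /hproj /peval raddf_sum; apply: eq_bigr => j _.
by rewrite (projT2 (P j)).2// /peval -mevalZ.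
Qed.

(** Degree 0 harmonics are constant on the sphere, and two constants cannot be orthonormal. Hence
    the sign condition on [coef Y f 0 0] controls the whole degree 0 part. *)
Lemma size_Y0 : (size (Y 0) <= 1)%N.
Proof.
rewrite leqNgt; apply/negP => Y1.
have c j : (j < size (Y 0))%N -> exists a : R, forall v, sphere d v -> Yf Y 0 j v = a.
  move=> /(sph_harm_Yf onb)[q [q0 _ qE]]; exists (peval q 0) => v /qE ->.
  exact: homog0_peval.
have Y0 : (0 < size (Y 0))%N by exact: ltnW.
have [a aE] := c _ Y0; have [b bE] := c _ Y1.
have M i j (x y : R) : (forall v, sphere d v -> Yf Y 0 i v = x) ->
    (forall v, sphere d v -> Yf Y 0 j v = y) ->
    smean (fun v => Yf Y 0 i v * Yf Y 0 j v) = x * y.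
  move=> xE yE; rewrite -(sint_cst (d := d'.+1) (x * y)).
  apply/esym/csph_eq_sint; first exact: csph_cst.
  by move=> v vS; rewrite xE// yE.
have := M _ _ _ _ aE aE; have := M _ _ _ _ bE bE; have := M _ _ _ _ aE bE.
rewrite !(sint_Yf onb)//= => /esym/eqP; rewrite mulf_eq0 => /orP[]/eqP->; rewrite !mul0r.
  by move=> _ /eqP; rewrite oner_eq0.
by move=> /eqP; rewrite oner_eq0.
Qed.

Lemma sint_poly_hproj p v : sqnorm v = 1 -> exists N0, forall N, (N0 <= N)%N ->
  smean (fun w => f w * p.[dot v w]) = \sum_(0 <= n < N) zint (p * gegp n) * hproj n v.
Proof.
move=> v1; have [N0 pE] := gegp_expand onb p; exists N0 => N N0N.
rewrite {1}(pE N N0N) big_mkord.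
rewrite (_ : smean _ = smean (fun w => \sum_(n < N)
    (zint (p * gegp n) / znorm n) * (f w * (gegp n).[dot v w]))); last first.
  congr smean; apply/funext => w; rewrite horner_sum mulr_sumr.
  by apply: eq_bigr => n _; rewrite hornerZ mulrCA.
have fg n : csph (fun w => f w * (gegp n).[dot v w]) by apply: csphM => //; exact: csph_poly_dot.
rewrite sint_sum => [|n]; last by apply: csphM; [exact: csph_cst|exact: fg].
apply: eq_bigr => n _; rewrite sintZ// smean_gegp_hproj// mulrA divfK//.
by rewrite gt_eqF// znorm_gt0.
Qed.

(** Kernel averages of [f] at [v] tend to [f v]; they are also finite sums of [hproj n v] with
    weights tending to 1. Limits are unique. *)
Lemma finite_expansion N v : sphere d v -> (forall n, (N <= n)%N -> hproj n v = 0) ->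
  f v = \sum_(0 <= n < N) hproj n v.
Proof.
move=> vS h0; have c1 := kern_approx onb fc vS.
have c2 : smean (fun w => f w * (kern m).[dot v w]) / zint (kern m) @[m --> \oo]
    --> \sum_(0 <= n < N) hproj n v.
  rewrite [X in X @ _ --> _](_ : _ = fun m => \sum_(0 <= n < N) @kcoef R d' m n * hproj n v).
    apply: cvg_bigsum => n; rewrite -[X in _ --> X]mul1r.
    by apply: cvgM; [exact: kcoef_cvg onb n|exact: cvg_cst].
  apply/funext => m; have [N0 E] := sint_poly_hproj (kern m) vS.
  rewrite (E _ (leq_maxl N0 N)) (big_cat_nat (leq0n N) (leq_maxr _ _))/=.
  rewrite [X in _ + X]big_nat [X in _ + X]big1 => [|n /andP[Nn _]]; last by rewrite h0// mulr0.
  rewrite addr0 mulr_suml; apply: eq_bigr => n _; rewrite /kcoef mulrAC.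
  by [].
exact: (cvg_unique _ c1 c2).
Qed.

(* the circle through the pole [z] in direction [y], in rational parametrization;
   homogeneity turns [f] along it into a polynomial over a power of [1 + |y|^2 u^2] *)
Lemma vanish_on_circle N (z y : 'rV[R]_d) : sqnorm z = 1 -> dot z y = 0 -> 0 < sqnorm y ->
  (forall v, sphere d v -> f v = \sum_(0 <= n < N) hproj n v) ->
  (forall v, sphere d v -> dot z v < 0 -> f v = 0) ->
  forall u, f ((1 + sqnorm y * u ^+ 2)^-1 *: ((1 - sqnorm y * u ^+ 2) *: z + (2 * u) *: y)) = 0.
Proof.
move=> z1 zy q0 fE f0; set q := sqnorm y in q0 *.
pose D u : R := 1 + q * u ^+ 2.
have D0 u : 0 < D u by rewrite /D; have := sqr_ge0 u; nra.
pose x u := (1 - q * u ^+ 2) *: z + (2 * u) *: y.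
have xS u : sphere d ((D u)^-1 *: x u).
  rewrite /sphere/= sqnormZ -dotvv /x !(dotDl, dotDr, dotZl, dotZr) (dotC y z) zy !dotvv z1 -/q.
  by rewrite /D; field; rewrite gt_eqF//; exact: D0.
have zx u : dot z ((D u)^-1 *: x u) = (D u)^-1 * (1 - q * u ^+ 2).
  by rewrite /x dotZr dotDr !dotZr zy dotvv z1; ring.
have [p pE] : exists p : {poly R}, forall u, p.[u] = D u ^+ N * f ((D u)^-1 *: x u).
  have /(_ _)/cid P n : exists A : {poly R}, forall u, (n < N)%N ->
      A.[u] = D u ^+ N * hproj n ((D u)^-1 *: x u).
    have [r rh rE] := hproj_peval n.
    have [A AE] := peval_curve r (fun i => (1 - q%:P * 'X^2) * (z ord0 i)%:P + 2%:P * 'X * (y ord0 i)%:P).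
    (* Degree [n] produces the denominator [D u ^+ n]; the extra power brings all degrees to the
       common denominator [D u ^+ N]. *)
    exists ((1 + q%:P * 'X^2) ^+ (N - n) * A) => u nN.
    rewrite hornerM AE rE// (homog_pevalZ _ _ rh) horner_exp.
    have -> : (1 + q%:P * 'X^2).[u] = D u.
      by rewrite hornerD -polyC1 hornerM !hornerC hornerXn.
    have -> : \row_i ((1 - q%:P * 'X^2) * (z ord0 i)%:P + 2%:P * 'X * (y ord0 i)%:P).[u] = x u.
      apply/rowP => i; rewrite !mxE hornerD !hornerM hornerD hornerN -polyC1 hornerM !hornerC hornerX hornerXn.
      by [].
    rewrite mulrA exprVn; congr (_ * _); rewrite -[in RHS](subnK (ltnW nN)) exprD mulfK//.
    by rewrite expf_neq0// gt_eqF.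
  exists (\sum_(0 <= n < N) projT1 (P n)) => u.
  rewrite fE// mulr_sumr horner_sum; apply: eq_big_nat => n /andP[_ nN].
  by case: (P n) => A /= ->.
have p0 : p = 0.
  (* From this bound on, [q * u ^+ 2 > 1] and the point lies in the open hemisphere where [f]
     vanishes, so [p] has infinitely many roots. *)
  apply: (@poly_eq0_ge1 _ _ (1 + q^-1)) => u u1; rewrite pE f0 ?mulr0//.
  rewrite zx pmulr_rlt0 ?invr_gt0// subr_lt0.
  have qi : 0 < q^-1 by rewrite invr_gt0.
  have u2 : q^-1 < u ^+ 2 by nra.
  by rewrite -(ltr_pM2l q0) divff ?gt_eqF in u2.
move=> u; have := pE u; rewrite p0 horner0 => /esym/eqP.
by rewrite mulf_eq0 expf_eq0 gt_eqF// andbF => /eqP.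
Qed.

(** Half-angle substitution [tan (a / 2) = sin a / (1 + cos a)] with [t = cos a]; [r] is the square
    of that tangent. *)
Lemma circle_param (t : R) : 0 <= t -> let r := (1 - t ^+ 2) * (1 + t)^-1 ^+ 2 in
  (1 + r)^-1 * (1 - r) = t /\ (1 + r)^-1 * (2 / (1 + t)) = 1.
Proof.
move=> t0 r; have h : (1 + r) * (1 + t) = 2 by rewrite /r; field; lra.
have r0 : 1 + r != 0.
  by apply/eqP => r0; move/eqP: h; rewrite r0 mul0r eq_sym pnatr_eq0.
split; last by rewrite -h; field; rewrite r0; lra.
have -> : 1 - r = t * (1 + r) by rewrite /r; field; lra.
by rewrite mulrC mulfK.
Qed.

Lemma vanish_on_sphere N (z : 'rV[R]_d) : z = north d ->
  (forall v, sphere d v -> f v = \sum_(0 <= n < N) hproj n v) ->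
  (forall v, sphere d v -> dot z v < 0 -> f v = 0) ->
  forall v, sphere d v -> f v = 0.
Proof.
move=> zE fE f0 v vS.
have z1 : sqnorm z = 1 by rewrite zE; exact: north_sphere d'.+1.
have v1 : sqnorm v = 1 by [].
set t := dot z v.
have tb : -1 <= t <= 1 by exact: dot_bound.
have [tm|tm] := ltP t 0; first exact: f0.
pose y := v + (- t) *: z.
have zy : dot z y = 0.
  by rewrite /y dotDr dotZr dotvv z1 -/t; ring.
have y2 : sqnorm y = 1 - t ^+ 2.
  rewrite /y -dotvv !(dotDr, dotDl, dotZl, dotZr) (dotC v z) !dotvv z1 v1 -/t.
  by ring.
(* At the pole itself [y = 0] fixes no circle: any unit vector orthogonal to [z] is used instead,
   with parameter [u = 0]. *)
have [t1|t1] := eqVneq t 1.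
  have vz : v = z.
    have : sqnorm y = 0 by rewrite y2 t1; ring.
    move=> /eqP; rewrite /sqnorm psumr_eq0 => [/allP s0|i _]; last exact: sqr_ge0.
    apply/rowP => i; have := s0 i (mem_index_enum _); rewrite sqrf_eq0 !mxE t1 mulN1r subr_eq0.
    by move=> /eqP.
  have [e e1 ez] := @exists_dot_north R d' 0 (ltac:(apply/andP; split; lra)).
  have := @vanish_on_circle N z e z1 _ _ fE f0 0; rewrite dotC {1}zE ez e1 => /(_ erefl ltr01).
  by rewrite expr0n/= !mulr0 subr0 addr0 invr1 !scale1r scale0r addr0 -vz.
have q0 : 0 < sqnorm y.
  have : t < 1 by rewrite lt_neqAle t1; case/andP: tb.
  by rewrite y2; nra.
have := vanish_on_circle z1 zy q0 fE f0 (1 + t)^-1; rewrite y2.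
have [E1 E2] := circle_param tm.
rewrite scalerDr !scalerA E1 E2.
by rewrite scale1r /y addrCA -scalerDl subrr scale0r addr0.
Qed.

End SphericalHarmonics.

(** * The degenerate case: all zonal moments vanish *)

Section Degenerate.
Context {R : realType} {d' : nat}.
Local Notation d := d'.+2.
Variable Y : nat -> seq ('rV[R]_d -> R).
Hypothesis onb : sph_onb Y.
Local Notation gegp := (@gegp R d).
Variable f : 'rV[R]_d -> R.
Hypothesis fc : csph f.
Hypothesis fz0 : forall p : {poly R}, zpair f p = 0.

(** If [f] were positive somewhere below height [c], the polynomial [1 - chi], close to the
    indicator of the region below [c], would have a positive pairing with [f]. *)
Lemma zpair0_cap c : 0 < c -> c <= 1 ->
  (forall w, sphere d w -> dot (north d) w <= c -> 0 <= f w) ->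
  forall w, sphere d w -> dot (north d) w < c -> f w = 0.
Proof.
move=> c0 c1 fcap w0 w0S w0c; set t0 := dot _ w0 in w0c.
apply/eqP; rewrite eq_le (fcap w0 w0S (ltW w0c)) andbT leNgt; apply/negP => fw0.
have [c' [c'0 c'c t0c']] : exists c' : R, [/\ 0 <= c', c' < c & t0 < c'].
  exists ((Num.max t0 0 + c) / 2); have := le_max t0 t0 0; have := le_max 0 t0 0.
  rewrite !lexx orbT => a1 a2; have : Num.max t0 0 < c by rewrite gt_max w0c c0.
  by split; lra.
(* [g] is the product of the positive parts of [f] and of [c' - t]: continuous, positive at [w0],
   and zero for [t >= c']. As [c' - t <= 2], [f (1 - chi)] dominates [(1 - e) / 2 * g] where
   [f >= 0]. *)
pose g w := (f w + `|f w|) / 2 * ((c' - dot (north d) w + `|c' - dot (north d) w|) / 2).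
have hc (h : 'rV[R]_d -> R) : csph h -> csph (fun w => (h w + `|h w|) / 2).
  by move=> ch; apply: csphM (csph_cst _); apply: csphD => //; exact: csph_norm.
have gc : csph g.
  apply: csphM; first exact: hc.
  apply: hc; apply: csphD; first exact: csph_cst.
  by apply: csphN; exact: csph_dot.
have pos (x : R) : 0 <= (x + `|x|) / 2.
  by have := ler_norm (- x); rewrite normrN => h; rewrite divr_ge0//; lra.
have g0 w : 0 <= g w by exact: mulr_ge0.
have gp : 0 < smean g.
  apply: (csph_sint_gt0 gc _ w0S) => //; rewrite /g -/t0.
  have x0 : 0 < c' - t0 by lra.
  by rewrite !gtr0_norm// mulr_gt0//; lra.
have [B B0 fB] := csph_bounded fc.
(* Small enough that the gain [(1 - e) / 2 * smean g] exceeds the loss [B * e] coming from heights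
   above [c]. *)
pose e : R := smean g / (2 * (smean g + B + 1)).
have K0 : 0 < 2 * (smean g + B + 1) by lra.
have e0 : 0 < e by exact: divr_gt0.
have eK : e * (2 * (smean g + B + 1)) = smean g by rewrite divfK// gt_eqF.
have e1 : e < 1 by nra.
have [chi [chi01 chi0 chi1]] := poly_step c'0 c'c c1 e0.
have key : 0 <= zpair f (1 - chi) - ((1 - e) / 2 * smean g - B * e).
  rewrite -(sintZ _ gc) -(sint_cst (d := d'.+1) (B * e)).
  have h1 : csph (fun w => (1 - e) / 2 * g w) by apply: csphM => //; exact: csph_cst.
  have h2 : csph (fun _ : 'rV[R]_d => B * e) by exact: csph_cst.
  have h3 := csph_zpair fc (1 - chi).
  rewrite -(sintB h1 h2) -(sintB h3); last by apply: csphD h1 (csphN h2).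
  apply: csph_sint_ge0.
    by apply: csphD h3 _; apply: csphN; apply: csphD h1 (csphN h2).
  move=> w wS; have := dot_bound (north_sphere d'.+1) wS; rewrite /g.
  set t := dot _ w => t1; have /andP[x0 x1] := chi01 _ t1.
  have := fB w wS; rewrite ler_norml => /andP[fb1 fb2].
  rewrite hornerD hornerN -polyC1 hornerC.
  have [ct|tc] := leP c t.
    have x2 : 1 - e <= chi.[t] by apply: chi1; rewrite ct; case/andP: t1.
    rewrite [`|c' - t|]ler0_norm; last by lra.
    have -> : (c' - t + - (c' - t)) / 2 = 0 :> R by ring.
    by rewrite !mulr0; nra.
  have f0 : 0 <= f w by apply: fcap => //; exact: ltW.
  have fB0 : 0 <= f w * (1 - chi.[t]) by rewrite mulr_ge0//; lra.
  have Be : 0 <= B * e by rewrite mulr_ge0// ltW.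
  rewrite (ger0_norm f0).
  have [tc'|tc'] := leP t c'.
    have x2 : chi.[t] <= e by apply: chi0; rewrite tc' andbT; case/andP: t1.
    rewrite ger0_norm; last by lra.
    have -> : (f w + f w) / 2 * ((c' - t + (c' - t)) / 2) = f w * (c' - t) :> R by field.
    have y1 : f w * (c' - t) <= f w * 2 by apply: ler_wpM2l => //; case/andP: t1; lra.
    have y2 : (1 - e) / 2 * (f w * (c' - t)) <= (1 - e) / 2 * (f w * 2).
      by apply: ler_wpM2l => //; lra.
    have y3 : f w * (1 - e) <= f w * (1 - chi.[t]) by apply: ler_wpM2l => //; lra.
    by move: y2 y3 Be; move: (chi.[t]) (c' - t) => X Z; lra.
  rewrite ltr0_norm; last by lra.
  have -> : (c' - t + - (c' - t)) / 2 = 0 :> R by ring.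
  by rewrite !mulr0; move: (chi.[t]) fB0 => X; lra.
by rewrite fz0 in key; nra.
Qed.

Lemma degenerate_vanish s k c : s = 1 \/ s = -1 ->
  (forall n j, (j < size (Y n))%N -> 0 <= Yf Y n j (north d)) ->
  (exists N, forall n j, (N <= n)%N -> (j < size (Y n))%N -> 0 < Yf Y n j (north d)) ->
  (forall n j, (k <= n)%N -> (j < size (Y n))%N -> 0 <= s * smean (fun w => f w * Yf Y n j w)) ->
  0 < c -> c <= 1 ->
  (forall w, sphere d w -> dot (north d) w <= c -> 0 <= f w) ->
  forall w, sphere d w -> f w = 0.
Proof.
move=> s1 Yn [N Yp] tl c0 c1 fcap.
have cf0 n j : (maxn k N <= n)%N -> (j < size (Y n))%N -> smean (fun w => f w * Yf Y n j w) = 0.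
  rewrite geq_max => /andP[kn Nn] jn.
  have := fz0 (gegp n); rewrite (zpair_gegp onb fc) => /eqP.
  rewrite mulf_eq0 gt_eqF ?znorm_gt0//= => /eqP h0.
  (* A vanishing sum of nonnegative terms: each term is zero, and as [Yf Y n j (north d) > 0] the
     coefficient itself vanishes. *)
  have : s * hproj Y f n (north d) = 0 by rewrite h0 mulr0.
  rewrite /hproj mulr_sumr => /eqP; rewrite psumr_eq0 => [|i _]; last first.
    by rewrite mulrA mulr_ge0// ?tl// Yn.
  move=> /allP/(_ (Ordinal jn) (mem_index_enum _)); rewrite !mulf_eq0 /=.
  rewrite (gt_eqF (Yp _ _ Nn jn)) orbF => /orP[/eqP sE|/eqP//].
  by case: s1; rewrite sE => /eqP; rewrite eq_sym ?oppr_eq0 oner_eq0.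
have h0 n v : (maxn k N <= n)%N -> hproj Y f n v = 0.
  by move=> Kn; rewrite /hproj big1// => j _; rewrite cf0// mul0r.
apply: (vanish_on_sphere onb (N := maxn k N) (z := north d)) => //.
- by move=> v vS; apply: (finite_expansion onb fc vS) => n /h0.
- by move=> v vS vz; apply: (zpair0_cap c0 c1 fcap) => //; exact: lt_trans vz c0.
Qed.

End Degenerate.

(** * The lower bound for the quotient *)

Section LowerBound.
Context {R : realType} {d' : nat}.
Local Notation d := d'.+2.
Variable Y : nat -> seq ('rV[R]_d -> R).
Local Notation gegp := (@gegp R d).
Local Notation znorm := (@znorm R d').
Local Notation r := (@lower_const R d).

Lemma kminP s f : (exists N, tailpos Y s f N) ->
  [/\ (1 <= kmin Y s f)%N, tailpos Y s f (kmin Y s f) &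
      forall m, (1 <= m)%N -> tailpos Y s f m -> (kmin Y s f <= m)%N].
Proof.
move=> [N tN]; apply: (@xgetPex _ 0%N [set k | [/\ (1 <= k)%N, tailpos Y s f k & _]]).
have ex : exists k, (1 <= k)%N && `[< tailpos Y s f k >].
  (* [N.+1] rather than [N], since admissible indices start at 1. *)
  by exists N.+1 => /=; apply/asboolP => n j Nn; apply: tN; exact: ltnW.
exists (ex_minn ex); case: ex_minnP => m /andP[m1 /asboolP tm] mmin.
by split => // k k1 tk; apply: mmin; rewrite k1; apply/asboolP.
Qed.

Lemma acos_north_ge (w : 'rV[R]_d) t : sphere d w -> 0 <= t <= pi ->
  dot (north d) w <= cos t -> t <= geodist w (north d).
Proof.
move=> wS t0; have := dot_bound (north_sphere d'.+1) wS; rewrite dotC.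
rewrite /geodist -/(dot w (north d)); set x := dot w _ => x1 xt.
have [a0 aK] := acos_def x1.
by rewrite leNgt -ltr_cos ?in_itv// aK -leNgt.
Qed.

(** Settles obtuse radii, where both factors of the quotient are at least 1. If [r > 1], then
    [4 sqrt 2 * (sqrt 2 * r)^(d - 1)] would exceed 1. *)
Lemma lower_const_le1 : r <= 1.
Proof.
rewrite leNgt; apply/negP => r1; have := @lower_const_expn R d'.
have s1 : 1 <= Num.sqrt 2 :> R by rewrite -[X in X <= _]sqrtr1 ler_wsqrtr//; lra.
have : 1 <= (Num.sqrt 2 * r) ^+ d'.+1.
  by rewrite exprn_ege1//; nra.
by move: (_ ^+ _) => x; nra.
Qed.

Lemma sqrt_onem_cos (x : R) : 0 <= x <= pi -> Num.sqrt (1 - cos x) = Num.sqrt 2 * sin (x / 2).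
Proof.
move=> /andP[x0 xp]; have s0 : 0 <= sin (x / 2).
  by apply: sin_ge0_pi; apply/andP; split; have := pi_gt0 R; lra.
have -> : 1 - cos x = 2 * sin (x / 2) ^+ 2.
  have {1}-> : x = (x / 2) *+ 2 by rewrite -mulr_natr divfK.
  by rewrite cos_mulr2n sin2cos2; ring.
by rewrite sqrtrM// sqrtr_sqr ger0_norm.
Qed.

Hypothesis Ys : signed_onb Y.
Let onb : sph_onb Y. Proof. by case: Ys. Qed.
Variables (s : R) (f : 'rV[R]_d -> R).
Hypothesis s1 : s = 1 \/ s = -1.
Hypothesis fB : classB Y s f.
Hypothesis fn0 : exists w, sphere d w /\ f w != 0.
Let fc : csph f. Proof. by case: fB. Qed.
Let k := kmin Y s f.

Let tail : forall n j, (k <= n)%N -> (j < size (Y n))%N ->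
  0 <= s * smean (fun w => f w * Yf Y n j w).
Proof.
move=> n j kn jn; rewrite smeanE.
by case: fB => _ _ /kminP[_ tk _] _; exact: tk.
Qed.

Lemma zpair_gegp_tail n : (k <= n)%N -> 0 <= s * zpair f (gegp n).
Proof.
move=> kn; rewrite (zpair_gegp onb fc) mulrCA; apply: mulr_ge0; first exact/ltW/znorm_gt0.
rewrite /hproj mulr_sumr; apply: sumr_ge0 => j _; rewrite mulrA mulr_ge0 ?tail//.
by case: Ys => _ Y0 _; exact: Y0.
Qed.

Lemma zpair1_le0 : zpair f 1 <= 0.
Proof.
have -> : zpair f 1 = zpair f (gegp 0) by [].
rewrite (zpair_gegp onb fc) mul1r /hproj.
have := size_Y0 onb; rewrite leq_eqVlt ltnS leqn0 => /orP[]/eqP Y0; last first.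
  by rewrite Y0 big_ord0.
have Yn : 0 <= Yf Y 0 0 (north d) by case: Ys => _ Yn _; apply: Yn; rewrite Y0.
have cf : smean (fun w => f w * Yf Y 0 0 w) <= 0 by rewrite smeanE; case: fB.
by rewrite Y0 big_ord_recl big_ord0 addr0 mulr_le0_ge0.
Qed.

Lemma cap_lower_bound th th' : 0 < th -> th < th' -> th' <= pi / 2 ->
  (forall w, sphere d w -> dot (north d) w <= cos th -> 0 <= f w) ->
  r <= Num.sqrt (1 - cos th') * k%:R.
Proof.
move=> th0 tt tp fcap; have [B B0 fB'] := csph_bounded fc.
have f0 : s * f (north d) <= 0 by case: fB.
have pi0 := pi_gt0 R.
have [h0|] := zc_head_cap onb fc s1 zpair_gegp_tail f0 fB' th0 tt tp fcap zpair1_le0.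
  have zc0 n : zc f n = 0.
    have := zc_sum_bound onb fc s1 zpair_gegp_tail f0 n.+1; rewrite h0 mulr0 big_nat_recr//= => h.
    have h1 : 0 <= \sum_(0 <= i < n) `|zc f i| by exact: sumr_ge0.
    by apply/eqP; rewrite -normr_le0; lra.
  have z0 p : zpair f p = 0.
    have [N E] := zpair_expand onb fc p; rewrite (E _ (leqnn N)).
    by rewrite big1// => n _; rewrite zc0 mulr0.
  (* [th < pi / 2], so the region where [f >= 0] reaches past the equator, as the degenerate case
     demands. *)
  have c0 : 0 < cos th by apply: cos_gt0_pihalf; apply/andP; split; lra.
  case: fn0 => w [wS]; rewrite (degenerate_vanish onb fc z0 s1 _ _ tail c0 (cos_le1 _) fcap)// ?eqxx//.
  - by case: Ys.
  - by case: Ys.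
set S := \sum_(0 <= n < k) _ => h1.
have Sk : S <= 2 * k%:R ^+ d'.+1 by exact: sum_znormV.
have sn0 : 0 <= sin (th' / 2) by apply: sin_ge0_pi; apply/andP; split; lra.
rewrite sqrt_onem_cos; last by apply/andP; split; lra.
set x := sin _ in h1 sn0 *.
have q0 : 0 < Num.sqrt 2 :> R by rewrite sqrtr_gt0.
have q2 : Num.sqrt 2 * Num.sqrt 2 = 2 :> R by rewrite -expr2 sqr_sqrtr.
rewrite leNgt; apply/negP => xr.
(* [2 sin (th' / 2) k] is [sqrt 2] times the quotient at [th'], the quantity whose power
   [lower_const_expn] controls. *)
have h2 : 2 * x * k%:R < Num.sqrt 2 * r.
  have -> : 2 * x * k%:R = Num.sqrt 2 * (Num.sqrt 2 * x * k%:R) by rewrite -{1}q2; ring.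
  by rewrite ltr_pM2l.
have h3 : (2 * x * k%:R) ^+ d'.+1 < (Num.sqrt 2 * r) ^+ d'.+1.
  have x0 : 0 <= 2 * x * k%:R by rewrite !mulr_ge0.
  by rewrite ltrXn2r// nnegrE// (le_trans x0)// ltW.
have h4 := @lower_const_expn R d'.
have : 2 * Num.sqrt 2 * (2 * x) ^+ d'.+1 * S <= 4 * Num.sqrt 2 * (2 * x * k%:R) ^+ d'.+1.
  have -> : 4 * Num.sqrt 2 * (2 * x * k%:R) ^+ d'.+1 =
      2 * Num.sqrt 2 * (2 * x) ^+ d'.+1 * (2 * k%:R ^+ d'.+1).
    by rewrite [(_ * k%:R) ^+ _]exprMn; ring.
  apply: ler_wpM2l => //; apply: mulr_ge0; first by rewrite mulr_ge0// ltW.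
  by rewrite exprn_ge0// mulr_ge0.
have : 4 * Num.sqrt 2 * (2 * x * k%:R) ^+ d'.+1 < 4 * Num.sqrt 2 * (Num.sqrt 2 * r) ^+ d'.+1.
  by rewrite ltr_pM2l// mulr_gt0.
by move: h4 h1; lra.
Qed.

(** The infimum defining the radius need not be attained, so the estimate is proved for every larger
    [th'] and passed to the limit from the right. The radius [pi] leaves no such [th'] and falls
    under the obtuse case. *)
Lemma Bquot_lower_bound : (r%:E <= Bquot Y s f)%E.
Proof.
have pi0 := pi_gt0 R.
have k1 : 1 <= k%:R :> R.
  by rewrite ler1n; case: fB => _ _ /kminP[].
have r1 := lower_const_le1.
rewrite /Bquot; case E : (thetaE f) => [th||]; rewrite ?leey// lee_fin -/k.
have th0 : 0 <= th.
  rewrite -lee_fin -E; apply/ereal_infP => _ [t [/andP[t0 _] _] <-].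
  by rewrite lee_fin ltW.
have obtuse x : cos x <= 0 -> r <= Num.sqrt (1 - cos x) * k%:R.
  move=> c0; have : 1 <= Num.sqrt (1 - cos x).
    by rewrite -[X in X <= _]sqrtr1 ler_wsqrtr//; lra.
  by move=> h; apply: le_trans r1 _; nra.
have thpi : th <= pi.
  have : (thetaE f < +oo)%E by rewrite E ltry.
  move=> /ereal_inf_lt[_ [t [/andP[t0 tp] tf] <-] _].
  apply: (le_trans _ tp); rewrite -lee_fin -E; apply: ereal_inf_lbound.
  by exists t => //; split => //; rewrite t0.
have [->|thn] := eqVneq th pi; first by apply: obtuse; rewrite cospi; lra.
have thlt : th < pi by rewrite lt_neqAle thn.
have step th' : th < th' -> th' <= pi -> r <= Num.sqrt (1 - cos th') * k%:R.
  move=> tt tp; have [tpi|tpi] := leP th' (pi / 2); last first.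
    by apply: obtuse; rewrite -cos_pihalf ltW// ltr_cos// in_itv/=; apply/andP; split; lra.
  have : (thetaE f < th'%:E)%E by rewrite E lte_fin.
  move=> /ereal_inf_lt[_ [t [/andP[t0 tpi'] tf] <-]]; rewrite lte_fin => tt'.
  apply: (cap_lower_bound t0 tt' tpi) => w wS wt; apply: tf => //.
  by apply: acos_north_ge => //; rewrite (ltW t0).
have c1 : (fun=> r) @ th^'+ --> r by exact: cvg_cst.
have c2 : Num.sqrt (1 - cos x) * k%:R @[x --> th^'+] --> Num.sqrt (1 - cos th) * k%:R.
  apply: cvgM; last exact: cvg_cst.
  apply: cvg_at_right_filter.
  apply: (continuous_comp (f := fun x : R => 1 - cos x) (g := @Num.sqrt R)); last exact: sqrt_continuous.
  by apply: cvgB; [exact: cvg_cst|exact: continuous_cos].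
apply: ler_cvg_to c1 c2 _; near=> x; apply: step.
  by near: x; exact: nbhs_right_gt.
by apply: ltW; near: x; exact: nbhs_right_lt.
Unshelve. all: by end_near. Qed.

End LowerBound.

(** * Explicit functions for the upper bounds *)

Section UpperBound.
Context {R : realType} {d' : nat}.
Local Notation d := d'.+2.
Variable Y : nat -> seq ('rV[R]_d -> R).
Hypothesis Ys : signed_onb Y.
Let onb : sph_onb Y. Proof. by case: Ys. Qed.
Local Notation gegp := (@gegp R d).
Local Notation znorm := (@znorm R d').

Lemma gegpN1 n : (gegp n).[-1] = (-1) ^+ n.
Proof.
elim/nat_ind2: n => [||n IH0 IH1]; rewrite ?gegp_horner0 ?gegp_horner1//.
rewrite gegp_hornerSS IH0 IH1 !(exprS _ n.+1) (exprS _ n).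
have := @gega_gegb R d isT n; move: (gega _ _) (gegb _ _) ((-1) ^+ n) => a b x ab.
have -> : a = 1 + b by rewrite -ab; ring.
by ring.
Qed.

Lemma coef_gegp n m j : (j < size (Y m))%N ->
  smean (fun w => (gegp n).[dot (north d) w] * Yf Y m j w) =
  if n == m then znorm n * Yf Y m j (north d) else 0.
Proof.
move=> jm; have n1 := north_sphere (R := R) d'.+1.
have [->|nm] := eqVneq n m; first exact: (sint_gegp_harm onb n1 (sph_harm_Yf onb jm)).
exact: (sph_harm_orth onb (sph_harm_zonal n n1) (sph_harm_Yf onb jm)).
Qed.

(* for i = 0, 1 the extremal candidates are proportional to t^2 - 1 and t - t^3, t = <w, eta>. *)
Lemma Bconst_upper_bound s i : s = 1 \/ s = -1 -> ((0 < i)%N || (s == 1)) ->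
  (Bconst Y s <= (Num.sqrt 2 * i.+1%:R)%:E)%E.
Proof.
move=> s1 is1; have s2 : s * s = 1 by case: s1 => ->; ring.
have n1 : sqnorm (north d : 'rV[R]_d) = 1 by exact: north_sphere d'.+1.
(* [P_(i+2)] and [P_i] agree at [1] and, by parity, at [-1], so [f] vanishes at both poles. Only
   degrees [i] and [i + 2] occur, and only degree [i] has the wrong sign, whence [k <= i + 1]. For
   [i = 0] that sign must make the mean nonpositive, which forces [s = 1]. *)
pose f (w : 'rV[R]_d) : R := s * ((gegp i.+2).[dot (north d) w] - (gegp i).[dot (north d) w]).
have gc n : csph (fun w : 'rV[R]_d => (gegp n).[dot (north d) w]) by exact: csph_poly_dot.
have fc : csph f.
  by apply: csphM (csph_cst _) _; apply: csphD (gc _) (csphN (gc _)).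
have cf n j : (j < size (Y n))%N -> s * coef Y f n j =
    (if i.+2 == n then znorm i.+2 * Yf Y n j (north d) else 0) -
    (if i == n then znorm i * Yf Y n j (north d) else 0).
  move=> jn; have Yc := csph_Yf onb n j.
  rewrite -!(coef_gegp _ jn) /coef -smeanE.
  rewrite -(sintB (csphM (gc _) Yc) (csphM (gc _) Yc)) -sintZ; last exact: csphM.
  congr smean; apply/funext => w; rewrite /f.
  by rewrite -[in RHS]mulrBl !mulrA s2 mul1r.
have tp m : (i < m)%N -> tailpos Y s f m.
  move=> im n j mn jn; rewrite cf// (ltn_eqF (leq_trans im mn)) subr0.
  case: eqP => // _; rewrite mulr_ge0 ?(ltW (znorm_gt0 _))//.
  by case: Ys => _ Yn _; exact: Yn.
have fB : classB Y s f.
  split; [by case: fc| |by exists i.+1; exact: tp|]; last first.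
    by rewrite /f dotvv n1 !gegp1 ?subrr ?mulr0.
  have [Y0|Y0] := ltnP 0 (size (Y 0)); last first.
    rewrite /coef -smeanE (_ : smean _ = 0)//.
    rewrite -[RHS](sint_cst (d := d'.+1) 0); congr smean; apply/funext => w.
    by rewrite /Yf nth_default// mulr0.
  have := cf 0%N 0%N Y0; have Yn : 0 <= Yf Y 0 0 (north d) by case: Ys => _ Yn _; exact: Yn.
  case: (posnP i) is1 => [-> /= /eqP-> |i0 _].
    by rewrite !mul1r sub0r => ->; rewrite oppr_le0.
  rewrite /= ?(gtn_eqF i0) subr0 => /eqP; rewrite mulf_eq0 => /orP[/eqP sE|/eqP->//].
  by move/eqP: s2; rewrite sE mul0r eq_sym oner_eq0.
(* Were [P_(i+2)] and [P_i] equal on the sphere, orthogonality would make [znorm i] zero. *)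
have fn0 : exists w, sphere d w /\ f w != 0.
  apply: contrapT => /forallNP f0.
  have f0' w : sphere d w -> (gegp i.+2).[dot (north d) w] = (gegp i).[dot (north d) w].
    move=> wS; have /not_andP[//|/negP/negPn/eqP/(congr1 ( *%R s))] := f0 w.
    by rewrite /f mulrA s2 mul1r mulr0 => /eqP; rewrite subr_eq0 => /eqP.
  have := zint_gegpM onb i i; rewrite eqxx => zi.
  have := zint_gegpM onb i.+2 i; rewrite gtn_eqF// => zi2.
  have : @zint R d' (gegp i.+2 * gegp i) = @zint R d' (gegp i * gegp i).
    rewrite !zintE; apply: csph_eq_sint; first exact: csph_poly_dot.
    by move=> w wS; rewrite !hornerM f0'.
  by rewrite zi zi2 => /eqP; rewrite lt_eqF// znorm_gt0.
have pi0 := pi_gt0 R.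
(* The only point at distance [pi] is the south pole, where [f] is zero. *)
have thpi : theta_set f pi.
  split=> [|w wS pw]; first by rewrite pi0 lexx.
  have w1 : -1 <= dot (north d) w <= 1 by exact: dot_bound.
  have [a0 aK] := acos_def w1.
  have : dot (north d) w = -1.
    rewrite -aK -cospi; congr cos; apply/eqP; rewrite eq_le; apply/andP; split; first by case/andP: a0.
    by move: pw; rewrite /geodist -/(dot w (north d)) dotC.
  by rewrite /f => ->; rewrite !gegpN1 2!exprS mulrA mulrNN !mul1r subrr mulr0.
have := ereal_inf_lbound (S := (fun t => t%:E) @` theta_set f) (x := pi%:E).
rewrite -/(thetaE f) => /(_ (ex_intro2 _ _ _ thpi erefl)) le_pi.
have ge_0 : (0%:E <= thetaE f)%E.
  by apply/ereal_infP => _ [t [/andP[t0 _] _] <-]; rewrite lee_fin ltW.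
apply: le_trans (_ : Bquot Y s f <= _)%E.
  by apply: ereal_inf_lbound; exists f.
move: le_pi ge_0; rewrite /Bquot; case: (thetaE f) => [th||]//; rewrite !lee_fin => th1 th0.
have [k1 _ kmin_le] := kminP (ex_intro _ i.+1 (tp _ (ltnSn i))).
apply: ler_pM => //.
  by rewrite ler_wsqrtr//; have := cos_geN1 th; lra.
by rewrite ler_nat; apply: kmin_le => //; exact: tp.
Qed.

End UpperBound.

Unset Implicit Arguments.
Local Close Scope classical_set_scope.

Theorem mainTheorem3 (R : realType) (s : R) (d : nat)
  (Y : nat -> seq ('rV[R]_d -> R)) :
  (2 <= d)%N -> (s = 1 \/ s = -1) -> signed_onb Y ->
  [/\ ((@lower_const R d)%:E <= Bconst Y s)%E,
      (Bconst Y 1 <= (Num.sqrt 2)%:E)%E &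
      (Bconst Y (-1) <= (2 * Num.sqrt 2)%:E)%E].
Proof.
case: d Y => [|[|d']] // Y _ s1 Ys; split.
- by apply/ereal_infP => _ [f [fB fn0] <-]; exact: Bquot_lower_bound.
- rewrite -[Num.sqrt 2]mulr1; apply: (Bconst_upper_bound Ys (i := 0)) => //; last by rewrite eqxx.
  by left.
- by rewrite mulrC; apply: (Bconst_upper_bound Ys (i := 1)) => //; right.
Qed.
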